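(* Let $\ell$ be a prime. Let $G$ be a finite group, let $N\lhd G$ be a normal subgroup such that $G/N$ is solvable, and let $H$ be a subgroup with $N\le H\le G$ such that $H/N$ is nilpotent. If $\theta\in\operatorname{IBr}_\ell(H)$, then there exists $\chi\in\operatorname{IBr}_\ell(G)$ such that $\theta$ is an irreducible constituent of the restriction $\chi_H$ and $\chi(1)$ divides $|G:H|\,\theta(1)$.
   Context: For a finite group $X$ and a prime $\ell$, $\operatorname{IBr}_\ell(X)$ denotes the set of irreducible $\ell$-Brauer characters of $X$, i.e. the Brauer characters (complex-valued functions on the $\ell$-regular elements of $X$, with respect to a fixed choice of lifting of roots of unity from characteristic $\ell$ to characteristic $0$) of the simple modules of $X$ over an algebraically closed field of characteristic $\ell$. The restriction $\chi_H$ is the Brauer character of $H$ obtained by restricting $\chi$ to the $\ell$-regular elements of $H$; it is uniquely a nonnegative integer combination of elements of $\operatorname{IBr}_\ell(H)$, and $\theta$ is a constituent of $\chi_H$ (written $\theta\le\chi_H$) if its coefficient is positive. The degree $\chi(1)$ is the value at the identity. *)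

(* Defs.v *)
From mathcomp Require Import all_boot all_order all_fingroup all_algebra.
From mathcomp Require Import all_solvable all_field all_character.

Set Implicit Arguments.
Unset Strict Implicit.
Unset Printing Implicit Defensive.

Import GroupScope Order.TTheory GRing.Theory Num.Theory.
Local Open Scope ring_scope.

Definition root_of_unity (F : fieldType) (a : F) : Prop :=
  exists2 n, (0 < n)%N & a ^+ n = 1.

(* A lifting of the roots of unity of F to characteristic 0: an embedding of  *)
(* the group of roots of unity of F into that of algC; values of lift at      *)
(* other elements of F are irrelevant. For F algebraically closed of          *)
(* characteristic l, the n-torsion of both groups is cyclic of order n when   *)
(* l does not divide n, so such an embedding is automatically an isomorphism  *)
(* onto the group of complex roots of unity of order prime to l.              *)
Definition unity_lift (F : fieldType) (lift : F -> algC) : Prop :=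
  [/\ lift 1 = 1,
      forall a b, root_of_unity a -> root_of_unity b ->
        lift (a * b) = lift a * lift b
    & forall a b, root_of_unity a -> root_of_unity b ->
        lift a = lift b -> a = b].

(* The eigenvalues of A, with algebraic multiplicities. *)
Definition eigenvalues (F : closedFieldType) n (A : 'M[F]_n) : seq F :=
  sval (closed_field_poly_normal (char_poly A)).

Lemma eigenvaluesP (F : closedFieldType) n (A : 'M[F]_n) :
  char_poly A = \prod_(a <- eigenvalues A) ('X - a%:P).
Proof.
rewrite /eigenvalues; case: closed_field_poly_normal => r /= {1}->.
by rewrite (monicP (char_poly_monic A)) scale1r.
Qed.

Lemma char_poly_conj (R : comNzRingType) n (U V A : 'M[R]_n) :
  V *m U = 1%:M -> char_poly (V *m A *m U) = char_poly A.
Proof.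
move=> VU1; rewrite /char_poly /char_poly_mx !map_mxM.
set U' := map_mx polyC U; set V' := map_mx polyC V.
have VU'1 : V' *m U' = 1%:M by rewrite -map_mxM VU1 map_mx1.
have -> : 'X%:M - V' *m map_mx polyC A *m U'
          = V' *m ('X%:M - map_mx polyC A) *m U'.
  by rewrite mulmxBr mulmxBl scalar_mxC -[X in _ = X - _]mulmxA VU'1 mulmx1.
by rewrite !det_mulmx mulrAC -det_mulmx VU'1 det1 mul1r.
Qed.

Section BrauerCharacters.

Variables (F : closedFieldType) (lift : F -> algC) (ell : nat).
Variables (gT : finGroupType) (G : {group gT}).

Fact brauer_subproof n (rG : mx_representation F G n) :
  is_class_fun <<G>>
    [ffun x => (\sum_(a <- eigenvalues (rG x)) lift a)
                 *+ ((x \in G) && ell^'.-elt x)].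
Proof.
rewrite genGid; apply: intro_class_fun => [x y Gx Gy | _ /negbTE-> //].
rewrite groupJr // /p_elt orderJ /eigenvalues conjgE.
rewrite !repr_mxM ?groupM ?groupV // mulmxA char_poly_conj //.
by rewrite -repr_mxM ?groupV // mulVg repr_mx1.
Qed.

(* Functions on the ell-regular elements of G are encoded as class functions  *)
(* on G that vanish on the other elements; 'Res[H] then agrees with the       *)
(* restriction to the ell-regular elements of H.                              *)
Definition brauer n (rG : mx_representation F G n) : 'CF(G) :=
  Cfun 0 (brauer_subproof rG).

Definition IBr (phi : 'CF(G)) : Prop :=
  exists n (rG : mx_representation F G n),
    mx_irreducible rG /\ phi = brauer rG.

(* theta has positive coefficient in the expression of psi as a nonnegative   *)
(* integer combination of irreducible Brauer characters.                      *)
Definition IBr_constituent (theta psi : 'CF(G)) : Prop :=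
  exists (s : seq 'CF(G)) (m : 'CF(G) -> nat),
    [/\ uniq s,
        forall phi, phi \in s -> IBr phi,
        psi = \sum_(phi <- s) phi *+ m phi,
        theta \in s
      & (0 < m theta)%N].

End BrauerCharacters.

(* Main.v *)
Require Import Defs.
From mathcomp Require Import all_boot all_order all_fingroup all_algebra.
From mathcomp Require Import all_solvable all_field all_character.
From mathcomp Require Import zify ring.

(* Work with modules linked by nonzero intertwiners; these compose, so the      *)
(* claim is transitive in (H, G). Induction reduces it to G = HA, with A / N a  *)
(* chief factor of G complemented and not centralised by H / N, and to theta    *)
(* restricting to an irreducible X of N. If X has stabiliser N in A, Clifford   *)
(* theory gives dimension |G : H| theta(1) above theta. Otherwise X is          *)
(* A-invariant and coprime averaging gives an H-invariant irreducible L of A    *)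
(* over X. A and H act projectively on Hom_N(X, L), of dimension e with e = 1   *)
(* or e^2 = |A : N|, and an H-stable line there yields an extension of L to G   *)
(* over theta. To find it, take y central of prime order q <> ell modulo the    *)
(* kernel of H on A / N, and D = O_{q, ell}'(H) <[y]>: comparing the            *)
(* endomorphisms of D with their twists by a linear character gives an          *)
(* eigenspace of D of dimension prime to q, in which the simple H-submodules    *)
(* fixed by O_q(H)' are lines.                                                  *)

Set Implicit Arguments.
Unset Strict Implicit.
Unset Printing Implicit Defensive.

Import GroupScope Order.TTheory GRing.Theory Num.Theory.
Local Open Scope ring_scope.

(** The theorem is proved for modules. A nonzero H-homomorphism from a simple H-module X to a simple
    G-module V is injective, so the Brauer character of X is a constituent of that of V restricted
    to H; [divisible_cover H G] asks, for every X, for such a V with dim V dividing |G:H| dim X.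
    This relation is transitive in H <= K <= G, and Clifford theory gives it for H normal of prime
    index. An induction on |G| + |G:N| ([nilpotent_divisible_cover]) leaves one configuration: G =
    AH, H and A meet in N, and A/N is an elementary abelian chief factor, irreducible under H.

    If H centralises A/N, then H is normal of prime index ([chief_complement_cover]). Otherwise, H/N
    being nilpotent, X is induced from a normal subgroup K of prime index or restricts irreducibly
    to N ([nilpotent_quo_irr_induced]). In the first case induction handles K <= KA, and KA has
    prime index in G. In the second, the stabiliser in A of X restricted to N is N or A. If it is N,
    the inertia group in G is H, and a simple module above X has dimension exactly |G:H| dim X as
    soon as this is an upper bound ([free_action_cover]).

    The hard case is that of X restricted to N being A-invariant. Averaging over the p'-part of H/N,
    of order prime to |A:N|, gives a simple A-module L above X whose class is H-invariant
    ([invariant_irr_above]). The space Hom_N(X, L), of dimension e = dim L / dim X, carries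
    projective representations of A and H, and a line in it stable under H is what is needed to
    extend L to G above X ([irr_product_extension]). It remains to see that e divides |A:N| and that
    such a line exists ([quotient_stable_line]).

    Unless e = 1, passing to quotients makes A abelian of order e^2 prime to |H|, with the operators
    [w a] a basis of all matrices and the nontrivial elements of Z(H) acting freely on A - 1
    ([projective_stable_line]). By coprimality the action of H lifts to a linear one, Psi. An
    ell-group H has a fixed vector. Otherwise let y in Z(H) have prime order q <> ell, let D = O_{q,
    ell}'(H) <[y]>, and let mu be a linear character of D with kernel O_{q, ell}'(H). By freeness
    dim End_D(Psi) exceeds dim Hom_D(Psi, mu Psi) by exactly one ([hom_dim_twist]), so the
    multiplicity vectors of Psi and mu Psi are at squared distance 2; the same count over <[y]>
    yields a linear character of D whose two multiplicities differ by one. One of them is not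
    divisible by q, and it is the dimension of an eigenspace of D in Psi, which is an H-submodule.
    There O_q(H)' has nonzero fixed vectors, and on a simple H-submodule of fixed vectors H acts by
    commuting matrices, so this submodule is a line ([stable_line_of_rank]). *)

Lemma norm_memJ (gT : finGroupType) (A H : {set gT}) a h :
  H \subset 'N(A) -> h \in H -> a \in A -> (a ^ h)%g \in A.
Proof. by move=> nAH Hh Aa; rewrite memJ_norm ?(subsetP nAH). Qed.

Lemma exists_choice (I : finType) (A : {pred I}) (T : Type) (P : I -> T -> Prop) :
  (forall x, x \in A -> exists t, P x t) -> T -> exists f, forall x, x \in A -> P x (f x).
Proof.
move=> exP t0; apply: (fin_all_exists (P := fun x t => x \in A -> P x t)) => x.
by have [/exP[t Pt] | _] := boolP (x \in A); [exists t | exists t0].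
Qed.

Lemma repr_conj (R : comUnitRingType) (gT : finGroupType) (G : {group gT}) n
    (r : mx_representation R G n) : {in G &, forall x g, r x *m r g = r g *m r (x ^ g)%g}.
Proof. by move=> x g Gx Gg; rewrite -!repr_mxM ?groupJ // -conjgC. Qed.

(** * Integer vectors of squared length two *)

Lemma int_sqr_neq2 (x : int) : x * x != 2.
Proof. by apply/eqP; case: x => [[|[|n]]|[|n]]; nia. Qed.

Lemma sum_sqr_eq2 (I : finType) (delta : I -> int) :
    \sum_i delta i ^+ 2 = 2 ->
  exists i j, [/\ i != j, delta i ^+ 2 = 1, delta j ^+ 2 = 1
                & forall k, k != i -> k != j -> delta k = 0].
Proof.
move=> sum2.
have ge0 (P : pred I) : 0 <= \sum_(i | P i) delta i ^+ 2.
  by apply: sumr_ge0 => i _; apply: sqr_ge0.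
have [i nzi | z] := pickP (fun i => delta i != 0); last first.
  by move: sum2; rewrite big1 // => i _; move/eqP: (z i) => ->; rewrite expr0n.
have aux (X Y : int) : 0 <= X -> X != 0 -> X != 2 -> 0 <= Y -> X + Y = 2 -> X = 1 by lia.
have aux' (X Y : int) : 0 <= X -> X != 0 -> 0 <= Y -> X + Y = 1 -> X = 1 /\ Y = 0 by lia.
have di : delta i ^+ 2 = 1.
  apply: (aux _ _ (sqr_ge0 _) _ _ (ge0 (predC1 i))).
  - by rewrite sqrf_eq0.
  - by rewrite expr2 int_sqr_neq2.
  by rewrite -sum2 [in RHS](bigD1 i).
have [j /andP[nji nzj] | z] := pickP (fun j => (j != i) && (delta j != 0)); last first.
  move: sum2; rewrite (bigD1 i) //= di big1 // => j nji.
  by have := z j; rewrite nji => /negbFE/eqP->; rewrite expr0n.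
have sum1 : \sum_(k | k != i) delta k ^+ 2 = 1.
  by move: sum2; rewrite (bigD1 i) //= di => e; apply: (addrI 1); rewrite e.
have sumj : delta j ^+ 2 + \sum_(k | (k != i) && (k != j)) delta k ^+ 2 = 1.
  by rewrite -sum1 [in RHS](bigD1 j).
have [|dj sum0] := aux' _ _ (sqr_ge0 _) _ (ge0 _) sumj; first by rewrite sqrf_eq0.
exists i, j; split=> //; first by rewrite eq_sym.
move=> k nki nkj; apply/eqP; rewrite -sqrf_eq0.
move/eqP: sum0; rewrite psumr_eq0 => [/allP/(_ k)|? _]; last exact: sqr_ge0.
by rewrite mem_index_enum nki nkj => /(_ isT).
Qed.

(** * Intertwiners and Clifford theory *)

Section CliffordTheory.

Variables (F : closedFieldType) (gT : finGroupType).
Implicit Types (B D G H K L M N T : {group gT}).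

(** Matrices act on row vectors from the right, so [f] maps the first module to the second. Plain
    functions are allowed for [r1] and [r2], which covers restrictions, conjugates and twists
    without packaging them as representations. *)
Definition mxhom (A : {set gT}) n1 n2 (r1 : gT -> 'M[F]_n1) (r2 : gT -> 'M[F]_n2)
    (f : 'M[F]_(n1, n2)) : bool :=
  [forall x in A, r1 x *m f == f *m r2 x].

Lemma mxhomP (A : {set gT}) n1 n2 r1 r2 (f : 'M_(n1, n2)) :
  reflect {in A, forall x, r1 x *m f = f *m r2 x} (mxhom A r1 r2 f).
Proof. exact: 'forall_in_eqP. Qed.

Lemma mxhom_sub (A B : {set gT}) n1 n2 r1 r2 (f : 'M_(n1, n2)) :
  A \subset B -> mxhom B r1 r2 f -> mxhom A r1 r2 f.
Proof. by move=> sAB /mxhomP hf; apply/mxhomP=> x /(subsetP sAB)/hf. Qed.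

Lemma mxhomM (A : {set gT}) n1 n2 n3 r1 r2 r3 (f : 'M_(n1, n2)) (g : 'M_(n2, n3)) :
  mxhom A r1 r2 f -> mxhom A r2 r3 g -> mxhom A r1 r3 (f *m g).
Proof.
move=> /mxhomP hf /mxhomP hg; apply/mxhomP=> x Ax.
by rewrite mulmxA hf // -mulmxA hg // mulmxA.
Qed.

Lemma closed_abs_irr G n (rG : mx_representation F G n) :
  mx_irreducible rG -> mx_absolutely_irreducible rG.
Proof. exact: group_closure_closed_field. Qed.

Lemma mxhom_free G n1 n2 (r1 : mx_representation F G n1)
    (r2 : mx_representation F G n2) f :
  mx_irreducible r1 -> mxhom G r1 r2 f -> f != 0 -> row_free f.
Proof.
move=> /mx_irrP[_ irr1] /mxhomP hf; apply: contraR.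
rewrite -kermx_eq0 => /irr1; rewrite -sub1mx => full.
have -> : f = 0; last by [].
rewrite -[f]mul1mx; apply/sub_kermxP; apply: full.
by apply/mxmoduleP=> x Gx; apply/sub_kermxP; rewrite -mulmxA hf // mulmxA mulmx_ker mul0mx.
Qed.

Lemma mxhom_image_module G n1 n2 (r1 : mx_representation F G n1)
    (r2 : mx_representation F G n2) f :
  mxhom G r1 r2 f -> mxmodule r2 f.
Proof.
move=> /mxhomP hf; apply/mxmoduleP=> x Gx.
by rewrite -hf // submxMl.
Qed.

Lemma irr_module_full G n m (rG : mx_representation F G n) (U : 'M_(m, n)) :
  mx_irreducible rG -> mxmodule rG U -> U != 0 -> row_full U.
Proof.
move=> /mx_irrP[_ irrG] modU nzU.
rewrite -sub1mx -(genmxE U) sub1mx; apply: irrG.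
  by rewrite (eqmx_module _ (genmxE U)).
by rewrite -mxrank_eq0 genmxE mxrank_eq0.
Qed.

Lemma mxhom_full G n1 n2 (r1 : mx_representation F G n1)
    (r2 : mx_representation F G n2) f :
  mx_irreducible r2 -> mxhom G r1 r2 f -> f != 0 -> row_full f.
Proof. by move=> irr2 /mxhom_image_module; apply: irr_module_full. Qed.

Lemma mulmx_free_neq0 m n p (f : 'M[F]_(m, n)) (g : 'M[F]_(n, p)) :
  f != 0 -> row_free g -> f *m g != 0.
Proof. by move=> nzf freeg; rewrite mulmx_free_eq0. Qed.

(* An intertwiner out of an irreducible module is injective, so nonzero ones *)
(* compose along towers of subgroups. *)
Lemma mxhom_trans H K n1 n2 n3 (r1 : gT -> 'M_n1) (r2 : mx_representation F K n2)
    (r3 : mx_representation F K n3) f g :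
    H \subset K -> mx_irreducible r2 ->
    mxhom H r1 r2 f -> f != 0 -> mxhom K r2 r3 g -> g != 0 ->
  mxhom H r1 r3 (f *m g) /\ f *m g != 0.
Proof.
move=> sHK irr2 homf nzf homg nzg; split.
  exact: mxhomM homf (mxhom_sub sHK homg).
by rewrite mulmx_free_neq0 // (mxhom_free irr2 homg).
Qed.

Lemma mxhom_irr_dim G n1 n2 (r1 : mx_representation F G n1)
    (r2 : mx_representation F G n2) f :
  mx_irreducible r1 -> mx_irreducible r2 -> mxhom G r1 r2 f -> f != 0 -> n1 = n2.
Proof.
move=> irr1 irr2 homf nzf.
have /eqP e1 := mxhom_free irr1 homf nzf.
have /eqP e2 := mxhom_full irr2 homf nzf.
exact: etrans (esym e1) e2.
Qed.

Lemma mxhom_submod G n (rG : mx_representation F G n) (U : 'M_n)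
    (modU : mxmodule rG U) :
  mxhom G (submod_repr modU) rG (val_submod (1%:M : 'M_(\rank U))).
Proof.
apply/mxhomP=> x Gx; rewrite -val_submodE.
by rewrite -[_ *m rG x](val_submodJ modU) // mul1mx.
Qed.

Lemma mxhom_factmod G n (rG : mx_representation F G n) (U : 'M_n)
    (modU : mxmodule rG U) :
  mxhom G rG (factmod_repr modU) (in_factmod U 1%:M).
Proof.
apply/mxhomP=> x Gx; rewrite -in_factmodE.
by rewrite -[RHS](in_factmodJ modU) // mul1mx.
Qed.

Lemma mxhom_in_submod G H n m (rG : mx_representation F G n) (U : 'M_n)
    (modU : mxmodule rG U) (r1 : gT -> 'M_m) (f : 'M_(m, n)) :
  H \subset G -> (f <= U)%MS ->
  mxhom H r1 rG f -> mxhom H r1 (submod_repr modU) (in_submod U f).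
Proof.
move=> sHG sfU /mxhomP hf; apply/mxhomP=> x Hx.
rewrite -in_submodJ // -hf // in_submodE [RHS]in_submodE.
by rewrite mulmxA.
Qed.

(* Dividing out simple submodules one at a time until the image of [f] sits  *)
(* inside a simple submodule.                                                *)
Lemma exists_irr_quotient G H n m (rG : mx_representation F G m)
    (rH : gT -> 'M_n) (f : 'M_(n, m)) :
    H \subset G -> mxhom H rH rG f -> f != 0 ->
  exists k (rK : mx_representation F G k) (g : 'M_(n, k)),
    [/\ mx_irreducible rK, mxhom H rH rK g, g != 0 & (k <= m)%N].
Proof.
move=> sHG; have [k lek] := ubnP m.
elim: k m rG f lek => // k IHk m rG f lemk homf nzf.
have nz1 : (1%:M : 'M[F]_m) != 0.
  by apply: contra nzf => /eqP m0; rewrite -[f]mulmx1 m0 mulmx0.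
have [S simS _] := dec_mxsimple_exists (mxmodule1 rG) nz1.
have [modS nzS _] := simS.
have [sfS | nsfS] := boolP (f <= S)%MS.
  exists (\rank S), (submod_repr modS), (in_submod S f); split.
  - exact/submod_mx_irr.
  - exact: mxhom_in_submod.
  - apply: contra nzf => /eqP f0.
    by rewrite -(in_submodK sfS) f0 linear0.
  - exact: rank_leq_col.
have homf' := mxhomM homf (mxhom_sub sHG (mxhom_factmod modS)).
rewrite -in_factmodE in homf'.
have nzf' : in_factmod S f != 0 by rewrite in_factmod_eq0.
have lt : (\rank (cokermx S) < m)%N.
  by rewrite mxrank_coker ltn_subrL lt0n mxrank_eq0 nzS (leq_trans _ (rank_leq_col S)) // lt0n mxrank_eq0.
have [j [rK [g [irrK homg nzg lej]]]] := IHk _ _ _ (leq_trans lt lemk) homf' nzf'.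
by exists j, rK, g; split=> //; apply: leq_trans (ltnW lt).
Qed.

(** The space of intertwiners, as the row space of a matrix whose rows are intertwiners flattened by
    [mxvec]. *)
Definition hom_mx (A : {set gT}) n1 n2 (r1 : gT -> 'M[F]_n1) (r2 : gT -> 'M[F]_n2)
    : 'M[F]_(n1 * n2) :=
  (\bigcap_(x in A) kermx (lin_mx (mulmx (r1 x)) - lin_mx (mulmxr (r2 x))))%MS.

Lemma hom_mxE (A : {set gT}) n1 n2 (r1 : gT -> 'M_n1) (r2 : gT -> 'M_n2)
    (v : 'rV_(n1 * n2)) :
  (v <= hom_mx A r1 r2)%MS = mxhom A r1 r2 (vec_mx v).
Proof.
apply/sub_bigcapmxP/mxhomP=> hv x /hv.
  move/sub_kermxP; rewrite mulmxBr !mul_rV_lin => /eqP; rewrite subr_eq0 => /eqP.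
  by move/(can_inj mxvecK).
by move=> hx; apply/sub_kermxP; rewrite mulmxBr !mul_rV_lin /= hx subrr.
Qed.

Lemma stable_eigenvector n m (A : 'M[F]_n) (V : 'M_(m, n)) :
  V != 0 -> (V *m A <= V)%MS ->
  exists v : 'rV_n, exists c, [/\ v != 0, (v <= V)%MS & v *m A = c *: v].
Proof.
move=> nzV stV; pose B := row_base V *m A *m pinvmx (row_base V).
have rV : (0 < \rank V)%N by rewrite lt0n mxrank_eq0.
have stB : row_base V *m A = B *m row_base V.
  by rewrite mulmxKpV // !eq_row_base (eqmxMr _ (eq_row_base V)).
have [c /eigenvalueP[v hv nzv]] : exists c, eigenvalue B c.
  have [|c rc] := @closed_rootP F (char_poly B) _; last by exists c; rewrite eigenvalue_root_char.
  by rewrite size_char_poly; case: (\rank V) rV.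
exists (v *m row_base V), c; split.
- by rewrite mulmx_free_eq0 ?row_base_free.
- by rewrite (submx_trans (submxMl _ _)) ?eq_row_base.
- by rewrite -mulmxA stB mulmxA hv scalemxAl.
Qed.

(** H preserves the image of [f], so the translates by coset representatives of H already span a
    G-submodule. *)
Lemma mxhom_span H G n m (rH : gT -> 'M_n) (rG : mx_representation F G m) (f : 'M_(n, m)) :
    H \subset G -> mxhom H rH rG f ->
  exists U : 'M_m, [/\ mxmodule rG U, (f <= U)%MS & (\rank U <= #|G : H| * \rank f)%N].
Proof.
move=> sHG /mxhomP homf.
pose U := (\sum_(C in rcosets H G) <<f *m rG (repr C)>>)%MS.
have sub x : x \in G -> (f *m rG x <= <<f *m rG (repr (H :* x))>>)%MS.
  move=> Gx; case: repr_rcosetP => y Hy.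
  have Gy := subsetP sHG y Hy; rewrite genmxE repr_mxM // mulmxA.
  have {1}-> : f = rH y^-1%g *m (f *m rG y).
    by rewrite mulmxA homf ?groupV // -mulmxA -repr_mxM ?groupV // mulVg repr_mx1 mulmx1.
  by rewrite -!mulmxA submxMl.
exists U; split.
- apply/mxmoduleP=> x Gx; rewrite sumsmxMr; apply/sumsmx_subP=> _ /rcosetsP[y Gy ->].
  rewrite (eqmxMr _ (genmxE _)).
  case: repr_rcosetP => z Hz; have Gz := subsetP sHG z Hz.
  rewrite -mulmxA -repr_mxM ?groupM //.
  apply: submx_trans (sub _ _) _; first by rewrite !groupM.
  by apply: (sumsmx_sup (H :* (z * y * x))%g) => //; rewrite mem_rcosets mulSGid ?groupM.
- rewrite -{1}[f]mulmx1 -(repr_mx1 rG); apply: submx_trans (sub _ (group1 G)) _.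
  by apply: (sumsmx_sup (H :* 1)%g) => //; rewrite mem_rcosets mulSGid ?group1.
rewrite -sum_nat_const; apply: leq_trans (mxrank_sum_leqif _) _ => /=.
by apply: leq_sum => C _; rewrite genmxE mxrankM_maxl.
Qed.

(** The map sends v to the sum over h of w(v h^-1) h in the group algebra, for a coordinate
    functional [w]. Its coefficient at 1 is [w] itself, so it is nonzero. *)
Lemma regular_hom H G n (rH : mx_representation F H n) :
  H \subset G -> (0 < n)%N ->
  exists2 f : 'M_(n, gcard G), mxhom H rH (regular_repr F G) f & f != 0.
Proof.
move=> sHG n_gt0; pose w : 'cV[F]_n := \col_i (i == Ordinal n_gt0)%:R.
pose aG := regular_repr F G.
pose f := \sum_(h in H) (rH h^-1%g *m w) *m gring_row (aG h).
exists f.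
  apply/mxhomP=> x Hx; rewrite mulmx_sumr mulmx_suml.
  rewrite (reindex_inj (mulIg x)) /=; apply: eq_big => h; first by rewrite groupMr.
  rewrite groupMr // => Hh; have [Gh Gx] := (subsetP sHG h Hh, subsetP sHG x Hx).
  rewrite !mulmxA -repr_mxM ?groupV ?groupM // invMg mulKVg -!mulmxA; congr (_ *m (_ *m _)).
  by rewrite -gring_row_mul -repr_mxM.
have rowG h : h \in G -> gring_row (aG h) = delta_mx 0 (gring_index G h).
  by move=> Gh; rewrite /gring_row rowK gring_indexK // mul1g.
apply/eqP=> f0; have: f *m delta_mx (gring_index G 1%g) (0 : 'I_1) = w.
  rewrite mulmx_suml (bigD1 1%g) //= big1 ?addr0 => [|h /andP[Hh nt_h]].
    rewrite invg1 repr_mx1 mul1mx rowG // -mulmxA mul_delta_mx.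
    by rewrite [delta_mx 0 0]mx11_scalar mxE mulmx1.
  have Gh := subsetP sHG h Hh.
  rewrite rowG // -mulmxA mul_delta_mx_cond.
  rewrite (inj_in_eq (can_in_inj (@gring_indexK _ G))) //.
  by rewrite (negPf nt_h) mulr0n mulmx0.
rewrite f0 mul0mx => /matrixP/(_ (Ordinal n_gt0) 0); rewrite !mxE eqxx => /eqP.
by rewrite eq_sym oner_eq0.
Qed.

(** The image of [rH] in the regular module of G generates a submodule of dimension at most |G:H| n;
    a simple quotient on which [rH] still maps nontrivially is as required. *)
Lemma exists_irr_above H G n (rH : mx_representation F H n) :
  H \subset G -> mx_irreducible rH ->
  exists m (rG : mx_representation F G m) (f : 'M_(n, m)),
    [/\ mx_irreducible rG, mxhom H rH rG f, f != 0 & (m <= #|G : H| * n)%N].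
Proof.
move=> sHG irrH; have [n_gt0 _] := (mx_irrP rH).1 irrH.
have [f homf nzf] := regular_hom rH sHG n_gt0.
have [U [modU sfU rU]] := mxhom_span sHG homf.
have nzf' : in_submod U f != 0.
  by apply: contra nzf => /eqP f0; rewrite -(in_submodK sfU) f0 linear0.
have [m [rG [g [irrG homg nzg lem]]]] :=
  exists_irr_quotient sHG (mxhom_in_submod modU sHG sfU homf) nzf'.
exists m, rG, g; split=> //; apply: leq_trans lem (leq_trans rU _).
by rewrite leq_mul2l rank_leq_row orbT.
Qed.

(* A weak form of Frobenius reciprocity: the span of the graph of [g] over a *)
(* module that is large enough to be induced is again a graph.               *)
Lemma mxhom_of_induced H K n n1 m (rH : gT -> 'M_n1)
    (rK : mx_representation F K n) (rM : mx_representation F K m)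
    (f : 'M_(n1, n)) (g : 'M_(n1, m)) :
    H \subset K -> mx_irreducible rK -> (#|K : H| * n1 <= n)%N ->
    mxhom H rH rK f -> f != 0 -> mxhom H rH rM g -> g != 0 ->
  exists2 k : 'M_(n, m), mxhom K rK rM k & k != 0.
Proof.
move=> sHK irrK len /mxhomP homf nzf /mxhomP homg nzg.
(* In the direct sum of [rK] and [rM], the submodule [Z] generated by the image of (f, g) has
   dimension at most n and projects onto the simple module [rK]. So [p1] is injective on [Z], which
   is the graph of a K-homomorphism. *)
pose rS x := block_mx (rK x) 0 0 (rM x).
have reprS : mx_repr K rS.
  split=> [|x y Kx Ky]; first by rewrite /rS !repr_mx1 -scalar_mx_block.
  by rewrite /rS mulmx_block !mulmx0 !mul0mx !addr0 !add0r !repr_mxM.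
pose rsum := MxRepresentation reprS.
have [|Z [modZ sZ rZ]] := @mxhom_span H K _ _ rH rsum (row_mx f g) sHK.
  apply/mxhomP=> x Hx /=; rewrite mul_row_block mul_mx_row !mulmx0 addr0 add0r.
  by rewrite homf ?homg.
pose p1 : 'M[F]_(n + m, n) := col_mx 1%:M 0; pose p2 : 'M[F]_(n + m, m) := col_mx 0 1%:M.
have rS1 x : rS x *m p1 = p1 *m rK x.
  by rewrite mul_block_col mul_col_mx !mulmx0 !mul0mx mul1mx mulmx1 !addr0.
have rS2 x : rS x *m p2 = p2 *m rM x.
  by rewrite mul_block_col mul_col_mx !mulmx0 !mul0mx mul1mx mulmx1 !add0r.
have fgE : row_mx f g *m p1 = f by rewrite mul_row_col mulmx1 mulmx0 addr0.
have fgE2 : row_mx f g *m p2 = g by rewrite mul_row_col mulmx1 mulmx0 add0r.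
have full : row_full (Z *m p1).
  apply: irr_module_full irrK _ _.
    apply/mxmoduleP=> x Kx; rewrite -mulmxA -rS1 mulmxA submxMr //.
    exact: (mxmoduleP modZ).
  apply: contra nzf => /eqP Z0.
  by have /submxP[D] := submxMr p1 sZ; rewrite Z0 mulmx0 fgE => ->.
have inj0 : (Z :&: kermx p1)%MS = 0.
  apply/eqP; rewrite -mxrank_eq0 -leqn0 -(leq_add2l (\rank (Z *m p1))) mxrank_mul_ker addn0.
  rewrite (eqP full) (leq_trans rZ) // (leq_trans _ len) // leq_mul2l.
  by rewrite rank_leq_row orbT.
have inj k (W W' : 'M_(k, n + m)) :
  (W <= Z)%MS -> (W' <= Z)%MS -> W *m p1 = W' *m p1 -> W = W'.
  move=> sW sW' eW; apply/eqP; rewrite -subr_eq0 -submx0 -inj0 sub_capmx.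
  rewrite addmx_sub ?eqmx_opp //=; apply/sub_kermxP.
  by rewrite mulmxBl eW subrr.
have /submxP[D defD] : (1%:M <= Z *m p1)%MS by rewrite sub1mx.
pose W := D *m Z; have W1 : W *m p1 = 1%:M by rewrite defD mulmxA.
exists (W *m p2).
  apply/mxhomP=> x Kx; rewrite mulmxA -[RHS]mulmxA -rS2 !mulmxA; congr (_ *m _).
  have sWZ : (W <= Z)%MS by apply: submxMl.
  apply: inj.
  - exact: submxMl.
  - by apply: submx_trans (mxmoduleP modZ x Kx); apply: submxMr.
  by rewrite -[RHS]mulmxA rS1 [RHS]mulmxA W1 mul1mx -(mulmxA _ D) -mulmxA W1 mulmx1.
apply: contra nzg => /eqP W2; rewrite -fgE2.
suffices -> : row_mx f g = f *m W by rewrite -mulmxA W2 mulmx0.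
by apply: inj => //; [rewrite /W mulmxA submxMl | rewrite fgE -mulmxA -/W W1 mulmx1].
Qed.

(** * Conjugate modules, inertia groups, normal subgroups of prime index *)

Definition conj_iso (A : {set gT}) n (r : gT -> 'M[F]_n) (x : gT) : Prop :=
  exists2 U : 'M[F]_n, U \in unitmx & {in A, forall a, r a *m U = U *m r (a ^ x)%g}.

(* The eigenvectors of [f |-> U^-1 f (rM x)] on the space of [L]-morphisms   *)
(* have [M]-stable image.                                                    *)
Lemma irr_dim_cyclic_ext M L x n m (rL : mx_representation F L n)
    (rM : mx_representation F M m) (f : 'M_(n, m)) :
    L <| M -> x \in M -> M \subset L <*> <[x]> ->
    mx_irreducible rL -> mx_irreducible rM -> conj_iso L rL x ->
    mxhom L rL rM f -> f != 0 ->
  n = m.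
Proof.
move=> /andP[sLM nLM] Mx genM irrL irrM [U uU hU] homf nzf.
pose Y := hom_mx L rL rM.
pose A := lin_mx (mulmx (invmx U)) *m lin_mx (mulmxr (rM x)) : 'M_(n * m).
have AE (v : 'rV_(n * m)) : v *m A = mxvec (invmx U *m vec_mx v *m rM x).
  by rewrite mulmxA !mul_rV_lin /= mxvecK.
have homA (v : 'rV_(n * m)) : (v <= Y)%MS -> (v *m A <= Y)%MS.
  rewrite /Y !hom_mxE AE mxvecK => /mxhomP homv; apply/mxhomP=> l Ll.
  have nLx : x \in 'N(L) := subsetP nLM x Mx.
  have Ll' : (l ^ x^-1)%g \in L by rewrite memJ_norm ?groupV.
  rewrite -{1}[l](conjgKV x) !mulmxA.
  have -> : rL ((l ^ x^-1) ^ x)%g *m invmx U = invmx U *m rL (l ^ x^-1)%g.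
    by rewrite -[LHS]mul1mx -(mulVmx uU) -!mulmxA [U *m (_ *m _)]mulmxA -hU // mulmxK.
  have -> : invmx U *m rL (l ^ x^-1)%g *m vec_mx v *m rM x
            = invmx U *m (vec_mx v *m (rM (l ^ x^-1)%g *m rM x)).
    by rewrite -!mulmxA (mulmxA (rL _)) homv // !mulmxA.
  have [Ml Ml'] := (subsetP sLM l Ll, subsetP sLM _ Ll').
  by rewrite -!mulmxA -!repr_mxM // conjgE invgK -!mulgA mulVg mulg1.
have nzY : Y != 0.
  apply: contra nzf => /eqP Y0; have: (mxvec f <= Y)%MS by rewrite /Y hom_mxE mxvecK.
  by rewrite Y0 submx0 mxvec_eq0.
have stY : (Y *m A <= Y)%MS.
  by apply/row_subP=> i; rewrite row_mul; apply: homA; apply: row_sub.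
have [v [c [nzv Yv vA]]] := stable_eigenvector nzY stY.
pose g := vec_mx v; have homg : mxhom L rL rM g by rewrite -hom_mxE.
have nzg : g != 0 by rewrite vec_mx_eq0.
have gx : g *m rM x = c *: (U *m g).
  have /(congr1 (fun w => U *m vec_mx w)) : v *m A = c *: v by [].
  by rewrite AE mxvecK !mulmxA mulmxV // mul1mx linearZ /= -scalemxAr.
have stL : L \subset rstabs rM g.
  by have:= mxhom_image_module (r1 := rL) (r2 := subg_repr rM sLM) homg; rewrite /mxmodule rstabs_subg subsetI => /andP[].
have fg := mxhom_free (r2 := subg_repr rM sLM) irrL homg nzg.
have modg : mxmodule rM g.
  rewrite /mxmodule (subset_trans genM) // join_subG stL cycle_subG inE Mx gx.
  by rewrite scalemx_sub ?submxMl.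
have /eqP fullg := irr_module_full irrM modg nzg.
exact: etrans (esym (eqP fg)) fullg.
Qed.

Lemma mxsimple_hom_image G n m (r : mx_representation F G n)
    (rG : mx_representation F G m) (f : 'M_(n, m)) :
  mx_irreducible r -> mxhom G r rG f -> f != 0 -> mxsimple rG <<f>>%MS.
Proof.
move=> irrr homf nzf; have ff := mxhom_free irrr homf nzf; split.
- by rewrite (eqmx_module _ (genmxE f)) (mxhom_image_module homf).
- by rewrite -mxrank_eq0 genmxE mxrank_eq0.
move=> V modV sVf nzV; rewrite genmxE.
have /submxP[D defD]: (V <= f)%MS by rewrite -(genmxE f).
have /row_fullP[E ED] : row_full D.
  apply: (irr_module_full irrr).
    apply/mxmoduleP=> x Gx.
    rewrite -(submxMfree _ _ ff) -mulmxA (mxhomP _ _ _ _ homf) // mulmxA -defD.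
    exact: (mxmoduleP modV).
  by apply: contra nzV => /eqP D0; rewrite defD D0 mul0mx.
by rewrite -[f]mul1mx -ED -mulmxA -defD submxMl.
Qed.

(** The translate of the image of [f] by [g] affords the representation n |-> rN (n ^ g^-1). An
    isomorphism of the two submodules therefore gives an intertwiner for g^-1, whose inverse matrix
    serves for [g]. *)
Lemma iso_conj_iso G N (nsNG : N <| G) d m (rN : mx_representation F N d)
    (rG : mx_representation F G m) (f : 'M_(d, m)) g :
    mx_irreducible rN -> mxhom N rN rG f -> f != 0 -> g \in G ->
  mx_iso (subg_repr rG (normal_sub nsNG)) <<f>>%MS (<<f>>%MS *m rG g)
    <-> conj_iso N rN g.
Proof.
move=> irrN homf nzf Gg; have [sNG nNG] := andP nsNG.
set rGN := subg_repr _ _.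
have ff : row_free f := mxhom_free (r2 := rGN) irrN homf nzf.
have simf : mxsimple rGN <<f>>%MS := mxsimple_hom_image (rG := rGN) irrN homf nzf.
have nNg := subsetP nNG g Gg.
have fg : row_free (f *m rG g).
  by rewrite /row_free mxrankMfree ?repr_mx_free.
have gN n : n \in N -> rG g *m rG n = rG (n ^ g^-1)%g *m rG g.
  move=> Nn; have Nn' : (n ^ g^-1)%g \in N by rewrite memJ_norm ?groupV.
  have [Gn Gn'] := (subsetP sNG n Nn, subsetP sNG _ Nn').
  by rewrite -!repr_mxM // conjgE invgK -!mulgA mulVg mulg1.
split.
  case=> phi uphi homphi defg.
  have /submxP[U defU] : (f *m phi <= f *m rG g)%MS.
    by rewrite -(eqmxMr (rG g) (genmxE f)) -defg (eqmxMr _ (genmxE f)).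
  have freeU : row_free U.
    have : row_free (U *m (f *m rG g)).
      by rewrite -defU /row_free mxrankMfree ?row_free_unit.
    by rewrite /row_free mxrankMfree.
  have uU : U \in unitmx by rewrite -row_free_unit.
  have hU n : n \in N -> rN n *m U = U *m rN (n ^ g^-1)%g.
    move=> Nn; apply: (row_free_inj fg).
    rewrite /= -[LHS]mulmxA -defU mulmxA (mxhomP _ _ _ _ homf) //.
    have -> : f *m rG n *m phi = f *m phi *m rG n.
      have /hom_mxP hphi : (f <= dom_hom_mx rGN phi)%MS.
        by rewrite (submx_trans _ homphi) // genmxE.
      exact: hphi.
    rewrite defU -!mulmxA gN // (mulmxA f) -(mxhomP _ _ _ _ homf) ?memJ_norm ?groupV //.
    by rewrite !mulmxA.
  exists (invmx U) => [|n Nn]; first by rewrite unitmx_inv.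
  have Nng : (n ^ g)%g \in N by rewrite memJ_norm.
  have := hU _ Nng; rewrite conjgK => /(congr1 (fun A => invmx U *m A *m invmx U)).
  by rewrite mulmxA mulmxK // !mulmxA mulVmx // mul1mx => ->.
case=> U uU hU.
have hV n : n \in N -> rN n *m invmx U = invmx U *m rN (n ^ g^-1)%g.
  move=> Nn; have Nng : (n ^ g^-1)%g \in N by rewrite memJ_norm ?groupV.
  have := hU _ Nng; rewrite conjgKV => /(congr1 (fun A => invmx U *m A *m invmx U)).
  by rewrite mulmxA mulmxK // !mulmxA mulVmx // mul1mx => ->.
pose phi := pinvmx f *m invmx U *m f *m rG g.
have fphi : f *m phi = invmx U *m f *m rG g.
  pose p := pinvmx f; have fp : f *m p = 1%:M by apply: mulmxVp.
  by rewrite /phi -/p -!(mulmxA p) (mulmxA f) fp mul1mx.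
have simfg : mxsimple rGN (<<f>>%MS *m rG g) by apply: Clifford_simple.
apply: (@mx_Schur_iso _ _ _ _ rGN _ _ phi) => //.
- rewrite genmxE; apply/hom_mxP=> n Nn /=.
  have homf' := mxhomP _ _ _ _ homf.
  rewrite -homf' // -[LHS]mulmxA !fphi !mulmxA hV // -!(mulmxA (invmx U)).
  by rewrite homf' ?memJ_norm ?groupV // -!(mulmxA f) gN.
- by rewrite !(eqmxMr _ (genmxE f)) fphi -mulmxA submxMl.
have nzphi : f *m phi != 0.
  by rewrite fphi -mulmxA mulmx_free_neq0 // -mxrank_eq0 mxrank_unit ?unitmx_inv //;
     case/mx_irrP: irrN; rewrite lt0n.
by rewrite -mxrank_eq0 (eqmxMr _ (genmxE f)) mxrank_eq0.
Qed.

(** Clifford's theorem. G permutes the homogeneous components transitively, and g stabilises [W]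
    exactly when it carries the image of [f] to an isomorphic N-module, which [iso_conj_iso] turns
    into a condition on [rN] alone. *)
Lemma Clifford_inertia G N (nsNG : N <| G) d m (rN : mx_representation F N d)
    (rG : mx_representation F G m) (f : 'M_(d, m))
    (W := component_mx (subg_repr rG (normal_sub nsNG)) <<f>>%MS)
    (T := rstabs_group rG W) :
    mx_irreducible rN -> mx_irreducible rG -> mxhom N rN rG f -> f != 0 ->
  [/\ N \subset T, {in G, forall g, g \in T <-> conj_iso N rN g},
      (#|G : T| * \rank W)%N = m, (f <= W)%MS
    & mxsimple (subg_repr rG (rstabs_sub rG W)) W].
Proof.
move=> irrN irrG homf nzf; have [sNG nNG] := andP nsNG.
have simf := mxsimple_hom_image (rG := subg_repr rG (normal_sub nsNG)) irrN homf nzf.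
have sfW : (<<f>> <= W)%MS := component_mx_id simf.
have modW : mxmodule (subg_repr rG (normal_sub nsNG)) W := component_mx_module _ _.
pose sN := DecSocleType (subg_repr rG (normal_sub nsNG)).
pose W0 : sN := PackSocle (component_socle sN simf).
have defW : W0 = W :> 'M_m by apply: PackSocleK.
have stabT := Clifford_astab1 W0; rewrite defW in stabT.
split.
- by move: modW; rewrite /mxmodule rstabs_subg subsetI => /andP[].
- move=> g Gg; have [c1 c2] := iso_conj_iso nsNG irrN homf nzf Gg.
  have simfg := Clifford_simple simf Gg.
  rewrite inE Gg /=; split=> [sWg | /c2 isofg].
    apply: c1; apply: component_mx_iso => //; apply: submx_trans sWg.
    exact: submxMr.
  have /eqP eqc := introT (component_mx_isoP simf simfg) isofg; rewrite /W {2}eqc (Clifford_componentJ simf Gg).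
  exact: submx_refl.
- have := Clifford_rank_components irrG W0; rewrite defW => rkW.
  rewrite -[RHS]rkW; congr (_ * _)%N.
  have tr := Clifford_atrans irrG sN.
  rewrite -[RHS]cardsT -(atransPin (subxx G) tr (in_setT W0)) card_orbit_in // stabT.
  by rewrite (setIidPr (rstabs_sub _ _)).
- by rewrite -(genmxE f).
have := Clifford_rstabs_simple irrG W0.
by rewrite defW.
Qed.

Lemma prime_index_eq (A B C : {group gT}) :
  A \subset B -> B \subset C -> prime #|C : A| -> B :=: A \/ B :=: C.
Proof.
move=> sAB sBC; rewrite -(Lagrange_index sBC sAB).
case/primeP=> _ /(_ #|B : A| (dvdn_mull _ (dvdnn _)))/orP[]/eqP e; [left | right].
  by apply/eqP; rewrite eqEsubset sAB andbT -indexg_eq1 e.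
apply/eqP; rewrite eqEsubset sBC -indexg_eq1 -(eqn_pmul2r (indexg_gt0 B A)) mul1n.
by rewrite -e eqxx.
Qed.

Lemma irr_dim_prime_inertia M G n m (rM : mx_representation F M n)
    (rG : mx_representation F G m) (f : 'M_(n, m)) x :
    M <| G -> prime #|G : M| -> x \in G -> x \notin M ->
    mx_irreducible rM -> mx_irreducible rG -> conj_iso M rM x ->
    mxhom M rM rG f -> f != 0 ->
  n = m.
Proof.
move=> nsMG pr Gx nMx; apply: irr_dim_cyclic_ext (nsMG) (Gx) _.
have sMG := normal_sub nsMG.
have sMJ : M \subset M <*> <[x]> by rewrite joing_subl.
have sJG : M <*> <[x]> \subset G by rewrite join_subG sMG cycle_subG.
have [e|->] := prime_index_eq sMJ sJG pr; last by [].
by case/negP: nMx; rewrite -e /= mem_gen // inE cycle_id orbT.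
Qed.

(** The inertia group of [rM] is M or G. If it is M, the bound m <= |G:M| n forces the homogeneous
    component to have dimension n, so m = |G:M| n; if it is G, then m = n. *)
Lemma irr_above_prime_index M G n (rM : mx_representation F M n) :
    M <| G -> prime #|G : M| -> mx_irreducible rM ->
  exists m (rG : mx_representation F G m) (f : 'M_(n, m)),
    [/\ mx_irreducible rG, mxhom M rM rG f, f != 0 & (m %| #|G : M| * n)%N].
Proof.
move=> nsMG pr irrM; have sMG := normal_sub nsMG.
have [m [rG [f [irrG homf nzf lem]]]] := exists_irr_above sMG irrM.
exists m, rG, f; split=> //.
have [sMT inT rkW sfW _] := Clifford_inertia nsMG irrM irrG homf nzf.
set T := rstabs_group _ _ in sMT inT rkW; set W := component_mx _ _ in rkW sfW.
have rf : \rank f = n.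
  exact/eqP/(mxhom_free (r2 := subg_repr rG sMG) irrM homf nzf).
have lenW : (n <= \rank W)%N by rewrite -{1}rf mxrankS.
have [eT | eT] := prime_index_eq sMT (rstabs_sub _ _) pr.
  rewrite eT in rkW; move: lem; rewrite -{1}rkW leq_pmul2l ?indexg_gt0 // => leW.
  have {leW lenW}eW : \rank W = n by apply/eqP; rewrite eqn_leq leW.
  by rewrite -{1}rkW eW.
have /subsetPn[x Gx nMx] : ~~ (G \subset M).
  by apply: contraL pr; rewrite -indexg_eq1 => /eqP->.
have isox : conj_iso M rM x by apply/inT => //; rewrite eT.
rewrite -(irr_dim_prime_inertia nsMG pr Gx nMx irrM irrG isox homf nzf).
exact: dvdn_mull.
Qed.

(** * Nilpotent quotients: irreducible restriction or induction *)

Lemma nilpotent_quo_prime_index_normal N H K :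
    N <| H -> nilpotent (H / N) -> N \subset K -> K \subset H -> prime #|H : K| ->
  K <| H.
Proof.
move=> nsNH nilHN sNK sKH pr; have [sNH nNH] := andP nsNH.
rewrite /normal sKH; pose R := 'N_H(K)%G.
have sKR : K \subset R by rewrite subsetI sKH normG.
have [eR | eR] := prime_index_eq sKR (subsetIl _ _) pr; last first.
  by have eR' : 'N_H(K) = H := eR; rewrite -{1}eR' subsetIr.
have nsNK : N <| K := normalS sNK sKH nsNH.
have eKH : (H / N)%g = (K / N)%g.
  apply: nilpotent_sub_norm => //; first exact: quotientS.
  by have eR' : 'N_H(K) = K := eR; rewrite -quotient_subnormG // eR'.
have : H \subset K by rewrite -(quotientSGK nNH sNK) eKH.
by rewrite -indexg_eq1 => /eqP e1; rewrite e1 in pr.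
Qed.

Lemma nilpotent_quo_comm_proper N H L M :
    N <| H -> nilpotent (H / N) -> N \subset L -> L <| H -> M <| H -> L \proper M ->
  [~: M, H] <*> L \proper M.
Proof.
move=> nsNH nilHN sNL nsLH nsMH prLM.
have [sLH nLH] := andP nsLH; have [sMH nMH] := andP nsMH; have [sLM nsML] := andP prLM.
have nilHL : nilpotent (H / L).
  have := quotient_nil (L / N) nilHN.
  by rewrite (isog_nil (third_isog sNL nsNH nsLH)).
have nLM := subset_trans sMH nLH.
have nt : (M / L)%G :!=: 1%g.
  by rewrite -subG1 quotient_sub1.
have := nil_comm_properl nilHL (quotientS L sMH) nt.
move/(_ (H / L)%g); rewrite subsetI subxx quotient_norms // => /(_ isT).
rewrite -quotientR // => prop.
have sR : [~: M, H] \subset M by rewrite commg_subl.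
rewrite properE join_subG sR sLM /=; apply: contraL prop => sM.
rewrite properE negb_and negbK; apply/orP; right; rewrite quotientSK //.
have nLR : [~: M, H] \subset 'N(L) := subset_trans sR nLM.
by rewrite -norm_joinEr // joingC.
Qed.

(** A homogeneous component depends only on the matrices. This identifies the component found by
    restricting directly from H with the one found through an intermediate M. *)
Lemma eq_component_mx G n (r1 r2 : mx_representation F G n) (U : 'M_n) :
  r1 =1 r2 -> component_mx r1 U = component_mx r2 U.
Proof.
move=> eq_r; rewrite [in LHS]unlock [in RHS]unlock.
rewrite /component_mx_expr /row_hom_mx /annihilator_mx /cyclic_mx.
suff -> : enveloping_algebra_mx r1 = enveloping_algebra_mx r2 by [].
by apply/row_matrixP=> i; rewrite !rowK eq_r.
Qed.

Lemma exists_prime_index_between L M :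
  L <| M -> L \proper M ->
  exists K : {group gT}, [/\ L \subset K, K \subset M & prime #|K : L|].
Proof.
move=> nsLM /andP[sLM nsML]; have nLM := normal_norm nsLM.
have gt1 : (1 < #|(M / L)%g|)%N.
  by rewrite card_quotient // ltn_neqAle eq_sym indexg_eq1 nsML indexg_gt0.
have [x Mx ox] := Cauchy (pdiv_prime gt1) (pdiv_dvd _).
have sxM : (<[x]> \subset M / L)%g by rewrite cycle_subG.
have [K eK sLK sKM] := inv_quotientS nsLM sxM.
exists K; split=> //; rewrite -card_quotient ?(subset_trans sKM) // -eK -orderE ox.
exact: pdiv_prime.
Qed.

(* Take [M] normal in [H], minimal subject to [rH] being irreducible on [M]: *)
(* by Clifford theory, if [N < M] then [rH] is induced from the inertia      *)
(* group of a constituent of its restriction to a maximal [L < M], [L <| H]. *)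
Lemma nilpotent_quo_irr_induced N H n (rH : mx_representation F H n)
    (sNH : N \subset H) :
    N <| H -> nilpotent (H / N) -> mx_irreducible rH ->
    mx_irreducible (subg_repr rH sNH) \/
  exists (K : {group gT}) k (rK : mx_representation F K k) (f : 'M_(k, n)),
    [/\ [/\ N \subset K, K <| H, prime #|H : K| & (#|H : K| * k)%N = n],
        mx_irreducible rK, mxhom K rK rH f & f != 0].
Proof.
move=> nsNH nilHN irrH.
suff main (M : {group gT}) (sMH : M \subset H) : N \subset M -> M <| H ->
    mx_irreducible (subg_repr rH sMH) ->
    mx_irreducible (subg_repr rH sNH) \/
    exists (K : {group gT}) k (rK : mx_representation F K k) (f : 'M_(k, n)),
      [/\ [/\ N \subset K, K <| H, prime #|H : K| & (#|H : K| * k)%N = n],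
        mx_irreducible rK, mxhom K rK rH f & f != 0].
  by apply: (main H (subxx H)) (normal_refl H) _ => //.
have [k leMk] := ubnP #|M|; elim: k M sMH leMk => // k IHk M sMH leMk sNM nsMH irrM.
have [sMN | nsMN] := boolP (M \subset N).
  left; have eMN : M = N by apply/group_inj/eqP; rewrite eqEsubset sMN.
  by subst N; rewrite (_ : sNH = sMH) //; apply: bool_irrelevance.
have prNM : N \proper M by rewrite properE sNM.
have [L maxL sNL] : {L : {group gT} | [max L | (L <| H) && (L \proper M)] & N \subset L}.
  by apply: maxgroup_exists; rewrite nsNH.
have [/andP[nsLH prLM] maxL'] := maxgroupP maxL.
have [sLM nsML] := andP prLM.
have prR := nilpotent_quo_comm_proper nsNH nilHN sNL nsLH nsMH prLM.
have [sLH nLH] := andP nsLH.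
(* [M, H] L is normal in H and proper in M, so maximality of [L] makes it equal to [L]. Hence every
   subgroup between [L] and [M] is normal in H, and |M:L| is prime. *)
have sRL : [~: M, H] \subset L.
  have nsR : [~: M, H] <*> L <| H.
    have sRM : [~: M, H] \subset M by rewrite commg_subl normal_norm.
    rewrite /normal join_subG sLH (subset_trans sRM) //=.
    by apply: normsY => //; apply: normsR; [apply: normal_norm | apply: normG].
  have := maxL' ([~: M, H] <*> L)%G.
  by rewrite nsR prR joing_subr => /(_ isT isT) <-; rewrite joing_subl.
have nLM : M \subset 'N(L) := subset_trans sMH nLH.
have nsLM : L <| M by rewrite /normal sLM.
have pr : prime #|M : L|.
  have [K [sLK sKM prK]] := exists_prime_index_between nsLM prLM.
  have nsKH : K <| H.
    rewrite /normal (subset_trans sKM sMH) -commg_subl.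
    by rewrite (subset_trans (commSg _ sKM)) // (subset_trans sRL).
  have [eKM | neKM] := eqVneq (K : {set gT}) M; first by rewrite -eKM.
  have := maxL' K; rewrite nsKH properEneq neKM sKM sLK => /(_ isT isT) eK.
  by move: prK; rewrite eK indexgg.
pose rL := subg_repr rH sLH.
have nz1 : (1%:M : 'M[F]_n) != 0.
  by have [n_gt0 _] := (mx_irrP rH).1 irrH; rewrite -mxrank_eq0 mxrank1 -lt0n.
have [S simS _] := dec_mxsimple_exists (mxmodule1 rL) nz1.
have [modS nzS _] := simS.
pose f := val_submod (1%:M : 'M_(\rank S)).
have irrS : mx_irreducible (submod_repr modS) by apply/submod_mx_irr.
have homf : mxhom L (submod_repr modS) rH f := mxhom_submod modS.
have nzf : f != 0 by rewrite -mxrank_eq0 val_submod1 mxrank_eq0.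
have [sLT inT rkT sfT simT] := Clifford_inertia nsLH irrS irrH homf nzf.
have [sLT' inT' rkT' _ _] := Clifford_inertia nsLM irrS irrM homf nzf.
(* One and the same [W] serves for H and for M, so in both groups the index of its stabiliser times
   its rank is n. *)
have eW : component_mx (subg_repr rH (normal_sub nsLH)) <<f>>%MS
        = component_mx (subg_repr (subg_repr rH sMH) (normal_sub nsLM)) <<f>>%MS.
  exact: eq_component_mx.
rewrite -eW in rkT' sLT' inT'.
move: eW => _.
set W := component_mx _ _ in rkT rkT' sLT sLT' inT inT' simT sfT.
have sTM : rstabs_group (subg_repr rH sMH) W \subset M by apply: rstabs_sub.
(* If M stabilises [W], the restriction to [L] is still irreducible and the induction descends to
   [L]. If the stabiliser in M is [L], the stabiliser of [W] in H has index |M:L|, and [rH] is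
   induced from it. *)
have [eT | eT] := prime_index_eq sLT' sTM pr; last first.
  have /subsetPn[x Mx nLx] := nsML.
  have isox : conj_iso L (submod_repr modS) x by apply/inT' => //; rewrite eT.
  have en := irr_dim_prime_inertia nsLM pr Mx nLx irrS irrM isox homf nzf.
  apply: (IHk L sLH) => //; first exact: leq_trans (proper_card prLM) leMk.
  have fullS : (S :=: 1%:M)%MS.
    by apply/eqmxP; rewrite submx1 sub1mx; apply/eqP.
  have rs : mx_rsim (submod_repr modS) rL by apply: rsim_submod1.
  exact: mx_rsim_irr rs irrS.
right; exists (rstabs_group rH W), (\rank W).
have [modW nzW _] := simT.
have irrW : mx_irreducible (submod_repr modW) by apply/submod_mx_irr.
exists (submod_repr modW), (val_submod (1%:M : 'M_(\rank W))).
have eidx : #|H : rstabs_group rH W| = #|M : L|.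
  apply/eqP; rewrite -(eqn_pmul2r (_ : 0 < \rank W)%N) ?lt0n ?mxrank_eq0 //.
  by rewrite rkT -{1}rkT' eT.
have sNT := subset_trans sNL sLT.
split=> //; last first.
- by rewrite -mxrank_eq0 val_submod1 mxrank_eq0.
- exact: (mxhom_submod modW).
rewrite eidx; split=> //; last by rewrite -eidx.
by apply: nilpotent_quo_prime_index_normal nsNH nilHN sNT (rstabs_sub _ _) _; rewrite eidx.
Qed.

(** * Dimensions of Hom spaces and multiplicities *)

Definition hom_dim (A : {set gT}) n1 n2 (r1 : gT -> 'M[F]_n1) (r2 : gT -> 'M[F]_n2) :=
  \rank (hom_mx A r1 r2).

Lemma mxrank_biproduct a b c (X : 'M[F]_a) (X1 : 'M[F]_b) (X2 : 'M[F]_c)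
    (I1 : 'M_(a, b)) (I2 : 'M_(a, c)) (P1 : 'M_(b, a)) (P2 : 'M_(c, a)) :
    P1 *m I1 = 1%:M -> P2 *m I2 = 1%:M -> P1 *m I2 = 0 -> P2 *m I1 = 0 ->
    I1 *m P1 + I2 *m P2 = 1%:M ->
    (X *m I1 <= X1)%MS -> (X *m I2 <= X2)%MS ->
    (X1 *m P1 <= X)%MS -> (X2 *m P2 <= X)%MS ->
  \rank X = (\rank X1 + \rank X2)%N.
Proof.
move=> P11 P22 P12 P21 PI /submxP[D1 e1] /submxP[D2 e2] s1 s2.
rewrite -rank_diag_block_mx; apply/eqP; rewrite eqn_leq; apply/andP; split.
  have -> : X = row_mx D1 D2 *m block_mx X1 0 0 X2 *m col_mx P1 P2.
    rewrite mul_row_block !mulmx0 addr0 add0r -e1 -e2 mul_row_col -!mulmxA.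
    by rewrite -mulmxDr PI mulmx1.
  exact: leq_trans (mxrankM_maxl _ _) (mxrankM_maxr _ _).
have -> : block_mx X1 0 0 X2 = block_mx X1 0 0 X2 *m col_mx P1 P2 *m row_mx I1 I2.
  rewrite mul_block_col !mul0mx addr0 add0r mul_col_row -!mulmxA.
  by rewrite P11 P12 P21 P22 !mulmx0 !mulmx1.
apply: leq_trans (mxrankM_maxl _ _) _; apply: mxrankS.
by rewrite mul_block_col !mul0mx addr0 add0r col_mx_sub s1.
Qed.

Lemma hom_mxS (A : {set gT}) n1 n2 n3 n4 (r1 : gT -> 'M[F]_n1) (r2 : gT -> 'M_n2)
    (r3 : gT -> 'M_n3) (r4 : gT -> 'M_n4) (L : 'M_(n1 * n2, n3 * n4)) :
    (forall f, mxhom A r1 r2 f -> mxhom A r3 r4 (vec_mx (mxvec f *m L))) ->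
  (hom_mx A r1 r2 *m L <= hom_mx A r3 r4)%MS.
Proof.
move=> hL; apply/row_subP=> i; rewrite row_mul hom_mxE.
by rewrite -[row i _]vec_mxK hL // -hom_mxE row_sub.
Qed.

(** A direct sum given by injections and projections, which avoids any cast between [n] and
    [n1 + n2]. *)
Definition biproduct (A : {set gT}) n n1 n2 (r : gT -> 'M[F]_n) (s1 : gT -> 'M[F]_n1)
    (s2 : gT -> 'M[F]_n2) : Prop :=
  exists i1 i2 p1 p2,
    [/\ [/\ mxhom A s1 r i1, mxhom A s2 r i2, mxhom A r s1 p1 & mxhom A r s2 p2],
        i1 *m p1 = 1%:M, i2 *m p2 = 1%:M, i1 *m p2 = 0 /\ i2 *m p1 = 0
      & p1 *m i1 + p2 *m i2 = 1%:M].

Lemma lin_mulmx_comp m n p q (X : 'M[F]_(m, n)) (Y : 'M[F]_(n, p)) :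
  lin_mx (mulmx Y) *m lin_mx (mulmx X) = lin_mx (mulmx (X *m Y)) :> 'M_(p * q, m * q).
Proof.
by apply/row_matrixP=> i; rewrite !rowE -[delta_mx 0 i]vec_mxK mulmxA !mul_vec_lin /= mulmxA.
Qed.

Lemma lin_mulmxr_comp m n p q (X : 'M[F]_(m, n)) (Y : 'M[F]_(n, p)) :
  lin_mx (mulmxr X) *m lin_mx (mulmxr Y) = lin_mx (mulmxr (X *m Y)) :> 'M_(q * m, q * p).
Proof.
by apply/row_matrixP=> i; rewrite !rowE -[delta_mx 0 i]vec_mxK mulmxA !mul_vec_lin /= mulmxA.
Qed.

Lemma lin_mulmx1 m n : lin_mx (mulmx (1%:M : 'M[F]_m)) = 1%:M :> 'M_(m * n).
Proof.
by apply/row_matrixP=> i; rewrite !rowE -[delta_mx 0 i]vec_mxK !mul_vec_lin /= mul1mx mulmx1.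
Qed.

Lemma lin_mulmxr1 m n : lin_mx (mulmxr (1%:M : 'M[F]_n)) = 1%:M :> 'M_(m * n).
Proof.
by apply/row_matrixP=> i; rewrite !rowE -[delta_mx 0 i]vec_mxK !mul_vec_lin /= !mulmx1.
Qed.

Lemma hom_dim_biproductl (A B : {set gT}) n n1 n2 m (r : gT -> 'M_n) (s1 : gT -> 'M_n1)
    (s2 : gT -> 'M_n2) (t : gT -> 'M_m) :
    B \subset A -> biproduct A r s1 s2 ->
  hom_dim B r t = (hom_dim B s1 t + hom_dim B s2 t)%N.
Proof.
move=> sBA [i1 [i2 [p1 [p2 [[hi1 hi2 hp1 hp2] e11 e22 [e12 e21] e1]]]]].
apply: (mxrank_biproduct (I1 := lin_mx (mulmx i1)) (I2 := lin_mx (mulmx i2))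
                         (P1 := lin_mx (mulmx p1)) (P2 := lin_mx (mulmx p2))).
- by rewrite lin_mulmx_comp e11 lin_mulmx1.
- by rewrite lin_mulmx_comp e22 lin_mulmx1.
- by rewrite lin_mulmx_comp e21; apply: (linear0 (@lin_mulmx F _ _ _)).
- by rewrite lin_mulmx_comp e12; apply: (linear0 (@lin_mulmx F _ _ _)).
- by rewrite !lin_mulmx_comp -(linearD (@lin_mulmx F _ _ _)) /= e1; apply: lin_mulmx1.
all: apply: hom_mxS => f hf; rewrite mul_vec_lin mxvecK /=; apply: mxhomM hf; exact: mxhom_sub sBA _.
Qed.

Lemma hom_dim_biproductr (A B : {set gT}) n n1 n2 m (r : gT -> 'M_n) (s1 : gT -> 'M_n1)
    (s2 : gT -> 'M_n2) (t : gT -> 'M_m) :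
    B \subset A -> biproduct A r s1 s2 ->
  hom_dim B t r = (hom_dim B t s1 + hom_dim B t s2)%N.
Proof.
move=> sBA [i1 [i2 [p1 [p2 [[hi1 hi2 hp1 hp2] e11 e22 [e12 e21] e1]]]]].
apply: (mxrank_biproduct (I1 := lin_mx (mulmxr p1)) (I2 := lin_mx (mulmxr p2))
                         (P1 := lin_mx (mulmxr i1)) (P2 := lin_mx (mulmxr i2))).
- by rewrite lin_mulmxr_comp e11 lin_mulmxr1.
- by rewrite lin_mulmxr_comp e22 lin_mulmxr1.
- by rewrite lin_mulmxr_comp e12; apply: (linear0 (@lin_mulmxr F _ _ _)).
- by rewrite lin_mulmxr_comp e21; apply: (linear0 (@lin_mulmxr F _ _ _)).
- by rewrite !lin_mulmxr_comp -(linearD (@lin_mulmxr F _ _ _)) /= e1; apply: lin_mulmxr1.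
all: apply: hom_mxS => f hf; rewrite mul_vec_lin mxvecK /=; apply: (mxhomM hf); exact: mxhom_sub sBA _.
Qed.

Lemma irr_split D (sD : irrType F D) n (r : mx_representation F D n) :
    [pchar F]^'.-group D -> (0 < n)%N ->
  exists (i : sD) n2 (s2 : mx_representation F D n2),
    (n2 < n)%N /\ biproduct D r (irr_repr i) s2.
Proof.
move=> F'D n_gt0.
have nz1 : (1%:M : 'M[F]_n) != 0 by rewrite -mxrank_eq0 mxrank1 -lt0n.
have [S simS _] := dec_mxsimple_exists (mxmodule1 r) nz1.
have [modS nzS _] := simS.
have [W modW defSW dxSW] := mx_Maschke_pchar r F'D modS (submx1 _).
have tiSW := mxdirect_addsP dxSW.
have irrS : mx_irreducible (submod_repr modS) by apply/submod_mx_irr.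
have rs := rsim_irr_comp_pchar sD F'D irrS; set i := irr_comp _ _ in rs.
have [B [B' B'B hB]] := mx_rsim_def rs.
have BB' : B *m B' = 1%:M.
  by move: B B' B'B {hB}; case: _ / (mxrank_rsim rs) => B B' /mulmx1C.
exists i, (\rank W), (submod_repr modW); split.
  have : (\rank S + \rank W = n)%N by rewrite -(mxdirectP dxSW) /= defSW mxrank1.
  move=> en; rewrite -[X in (_ < X)%N]en -addn1 addnC leq_add2r.
  by rewrite lt0n mxrank_eq0.
have full1 : (1%:M <= S + W)%MS by rewrite defSW.
have homS : mxhom D r (submod_repr modS) (in_submod S (proj_mx S W)).
  apply: mxhom_in_submod => //; first by rewrite -[proj_mx S W]mul1mx proj_mx_sub.
  apply/mxhomP=> x Dx.
  have /hom_mxP h : (1%:M <= dom_hom_mx r (proj_mx S W))%MS.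
    by apply: submx_trans (proj_mx_hom tiSW modS modW).
  by have := h x Dx; rewrite !mul1mx.
have tiWS : (W :&: S = 0)%MS by rewrite capmxC.
have homW : mxhom D r (submod_repr modW) (in_submod W (proj_mx W S)).
  apply: mxhom_in_submod => //; first by rewrite -[proj_mx W S]mul1mx proj_mx_sub.
  apply/mxhomP=> x Dx.
  have /hom_mxP h : (1%:M <= dom_hom_mx r (proj_mx W S))%MS.
    by apply: submx_trans (proj_mx_hom tiWS modW modS); rewrite addsmxC.
  by have := h x Dx; rewrite !mul1mx.
have homB : mxhom D (submod_repr modS) (irr_repr i) B.
  apply/mxhomP=> x Dx; rewrite hB //; move: (irr_repr i x) => X.
  by rewrite -!mulmxA B'B mulmx1.
have homB' : mxhom D (irr_repr i) (submod_repr modS) B'.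
  apply/mxhomP=> x Dx; rewrite hB //; move: (irr_repr i x) => X.
  by rewrite !mulmxA B'B mul1mx.
exists (B' *m val_submod 1%:M), (val_submod 1%:M).
exists (in_submod S (proj_mx S W) *m B), (in_submod W (proj_mx W S)).
split.
- split=> //; [| exact: mxhom_submod | exact: mxhomM homS homB].
  exact: mxhomM homB' (mxhom_submod modS).
- rewrite -mulmxA (mulmxA (val_submod _)) in_submodE (mulmxA (val_submod _)) -in_submodE.
  by rewrite proj_mx_id ?val_submodP // val_submodK mul1mx B'B.
- by rewrite in_submodE mulmxA -in_submodE proj_mx_id ?val_submodP // val_submodK.
- split; first by rewrite -mulmxA in_submodE (mulmxA (val_submod _)) proj_mx_0 ?val_submodP // mul0mx mulmx0.
  by rewrite mulmxA in_submodE (mulmxA (val_submod _)) proj_mx_0 ?val_submodP // !mul0mx.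
rewrite -mulmxA (mulmxA B) BB' mul1mx -!val_submodE !in_submodK.
- by rewrite -[RHS](@add_proj_mx _ _ _ S W 1%:M) // !mul1mx.
- by rewrite -[proj_mx S W]mul1mx proj_mx_sub.
- by rewrite -[proj_mx W S]mul1mx proj_mx_sub.
Qed.

Lemma hom_dim_irr D (sD : irrType F D) (i j : sD) :
  [pchar F]^'.-group D -> hom_dim D (irr_repr i) (irr_repr j) = (i == j) :> nat.
Proof.
move=> F'D; have irri := socle_irr i; have irrj := socle_irr j.
have [<- | nij] := eqVneq i j.
  have [n_gt0 _] := (mx_irrP _).1 irri.
  have -> : hom_dim D (irr_repr i) (irr_repr i) = \rank (mxvec (1%:M : 'M[F]_(irr_degree i))).
    apply: eqmx_rank; apply/andP; split; last first.
      by rewrite hom_mxE mxvecK; apply/mxhomP=> x _; rewrite mulmx1 mul1mx.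
    apply/row_subP=> k; set v := row k _.
    have /mxhomP homv : mxhom D (irr_repr i) (irr_repr i) (vec_mx v) by rewrite -hom_mxE row_sub.
    have /is_scalar_mxP[c ec] : is_scalar_mx (vec_mx v).
      apply: (mx_abs_irr_cent_scalar (closed_abs_irr irri)).
      by apply/centgmxP=> x Dx; rewrite homv.
    by rewrite -[v]vec_mxK ec -[c%:M]scalemx1 linearZ /= scalemx_sub.
  by apply/eqP; rewrite rank_rV mxvec_eq0 -mxrank_eq0 mxrank1 -lt0n n_gt0.
apply/eqP; rewrite mxrank_eq0; apply: contraNT nij => /rowV0Pn[v].
rewrite hom_mxE => homv nzv.
have nzf : vec_mx v != 0 by rewrite vec_mx_eq0.
apply/socle_rsimP; exists (vec_mx v).
- exact: mxhom_irr_dim irri irrj homv nzf.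
- exact: mxhom_free irri homv nzf.
exact/mxhomP.
Qed.

(** Only [r] is decomposed, over [D]; [t] is any family of matrices and [B] any subset. So
    D-multiplicities compute Hom dimensions over smaller sets, even over the empty set, where
    [hom_dim] is n * m. *)
Lemma hom_dim_suml D (sD : irrType F D) (B : {set gT}) n m (r : mx_representation F D n)
    (t : gT -> 'M_m) :
    [pchar F]^'.-group D -> B \subset D ->
  hom_dim B r t = (\sum_(i : sD) hom_dim D (irr_repr i) r * hom_dim B (irr_repr i) t)%N.
Proof.
move=> F'D sBD; have [k lek] := ubnP n.
elim: k n r lek => // k IHk n r lek; have [n0 | n_gt0] := posnP n.
  subst n; have h0 (a : nat) (x : 'M[F]_(a * 0)) : \rank x = 0%N.
    by apply/eqP; rewrite -leqn0 (leq_trans (rank_leq_col _)) ?muln0.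
  rewrite /hom_dim big1 => [|i _]; last by rewrite h0.
  by apply/eqP; rewrite -leqn0 (leq_trans (rank_leq_col _)).
have [j [n2 [s2 [lt2 bip]]]] := irr_split sD r F'D n_gt0.
rewrite (hom_dim_biproductl _ sBD bip) (IHk _ s2) ?(leq_trans lt2) //.
under [RHS]eq_bigr do rewrite (hom_dim_biproductr _ (subxx D) bip) hom_dim_irr // mulnDl.
rewrite big_split /=; congr (_ + _)%N.
rewrite (bigD1 j) //= eqxx mul1n big1 ?addn0 // => i /negPf nij.
by rewrite nij mul0n.
Qed.

Lemma hom_dim_sumr D (sD : irrType F D) (B : {set gT}) n m (r : mx_representation F D n)
    (t : gT -> 'M_m) :
    [pchar F]^'.-group D -> B \subset D ->
  hom_dim B t r = (\sum_(i : sD) hom_dim D (irr_repr i) r * hom_dim B t (irr_repr i))%N.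
Proof.
move=> F'D sBD; have [k lek] := ubnP n.
elim: k n r lek => // k IHk n r lek; have [n0 | n_gt0] := posnP n.
  subst n; have h0 (a : nat) (x : 'M[F]_(a * 0)) : \rank x = 0%N.
    by apply/eqP; rewrite -leqn0 (leq_trans (rank_leq_col _)) ?muln0.
  by rewrite /hom_dim big1 ?h0 // => i _; rewrite h0.
have [j [n2 [s2 [lt2 bip]]]] := irr_split sD r F'D n_gt0.
rewrite (hom_dim_biproductr _ sBD bip) (IHk _ s2) ?(leq_trans lt2) //.
under [RHS]eq_bigr do rewrite (hom_dim_biproductr _ (subxx D) bip) hom_dim_irr // mulnDl.
rewrite big_split /=; congr (_ + _)%N.
rewrite (bigD1 j) //= eqxx mul1n big1 ?addn0 // => i /negPf nij.
by rewrite nij mul0n.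
Qed.

Lemma hom_dim_scalar (B : {set gT}) n1 n2 (r1 : gT -> 'M[F]_n1) (r2 : gT -> 'M[F]_n2)
    (c1 c2 : gT -> F) :
    {in B, forall x, r1 x = (c1 x)%:M} -> {in B, forall x, r2 x = (c2 x)%:M} ->
  hom_dim B r1 r2 = if [forall x in B, c1 x == c2 x] then (n1 * n2)%N else 0%N.
Proof.
move=> e1 e2; case: ifPn => [/forall_inP eqc | /forall_inPn[x Bx nc]].
  apply/eqP; rewrite eqn_leq rank_leq_row -{1}(mxrank1 F (n1 * n2)) mxrankS //.
  apply/row_subP=> i; rewrite hom_mxE; apply/mxhomP=> x Bx.
  by rewrite e1 // e2 // (eqP (eqc x Bx)) mul_scalar_mx mul_mx_scalar.
apply/eqP; rewrite mxrank_eq0; apply/negPn/negP=> /rowV0Pn[v].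
rewrite hom_mxE => /mxhomP/(_ x Bx); rewrite e1 // e2 // mul_scalar_mx mul_mx_scalar.
move/eqP; rewrite -subr_eq0 -scalerBl scaler_eq0 subr_eq0 (negPf nc) /=.
by rewrite vec_mx_eq0 => /eqP-> /eqP.
Qed.

(* With [delta i] the difference of the multiplicities of the i-th           *)
(* irreducible in [U] and [U'], the hypotheses on [D] say that the squares   *)
(* of the [delta i] sum to 2, and those on [B] that the nonzero [delta i]    *)
(* belong to irreducibles of degree 1.                                       *)
Lemma linear_of_hom_defect D B (sD : irrType F D) e (U U' : mx_representation F D e) :
    [pchar F]^'.-group D -> B \subset D ->
    (forall i : sD, {in B, forall x, is_scalar_mx (irr_repr i x)}) ->
    hom_dim D U' U' = hom_dim D U U -> hom_dim D U U = (hom_dim D U U').+1 ->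
    hom_dim B U' U' = hom_dim B U U -> hom_dim B U U = (hom_dim B U U').+1 ->
  exists i : sD, irr_degree i = 1%N /\
    (hom_dim D (irr_repr i) U = (hom_dim D (irr_repr i) U').+1 \/
     hom_dim D (irr_repr i) U' = (hom_dim D (irr_repr i) U).+1).
Proof.
move=> F'D sBD scal eD1 eD2 eB1 eB2.
pose n (i : sD) := hom_dim D (irr_repr i) U.
pose n' (i : sD) := hom_dim D (irr_repr i) U'.
pose delta (i : sD) : int := (n i)%:Z - (n' i)%:Z.
have sqE : \sum_i delta i ^+ 2 = 2.
  have e1 := hom_dim_suml sD U U F'D (subxx D).
  have e2 := hom_dim_suml sD U' U' F'D (subxx D).
  have e3 := hom_dim_suml sD U U' F'D (subxx D).
  have -> : \sum_i delta i ^+ 2 = (hom_dim D U U)%:Z + (hom_dim D U' U')%:Z - (hom_dim D U U')%:Z *+ 2.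
    rewrite e1 e2 e3 !(big_morph Posz PoszD (erefl _)) -sumrMnl -big_split -sumrB /=.
    by apply: eq_bigr => i _; rewrite /delta /n /n' !PoszM; ring.
  by rewrite eD1 eD2; lia.
have [i [j [nij di dj dk]]] := sum_sqr_eq2 sqE.
have irr_gt0 (k : sD) : (0 < irr_degree k)%N := irr_degree_gt0 k.
pose c (k : sD) x := irr_repr k x (Ordinal (irr_gt0 k)) (Ordinal (irr_gt0 k)).
have cE (k : sD) : {in B, forall x, irr_repr k x = (c k x)%:M}.
  move=> x Bx; have /is_scalar_mxP[a ea] := scal k x Bx.
  by rewrite /c ea mxE eqxx.
pose h (k l : sD) := hom_dim B (irr_repr k) (irr_repr l).
have hE (k l : sD) : h k l = if [forall x in B, c k x == c l x] then (irr_degree k * irr_degree l)%N else 0%N.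
  exact: hom_dim_scalar.
have hC (k l : sD) : h l k = h k l.
  rewrite !hE mulnC (_ : [forall x in B, c l x == c k x] = [forall x in B, c k x == c l x]) //.
  by apply: eq_forallb => x; rewrite eq_sym.
(* Over [B], [hom_dim] is the bilinear form with Gram matrix [h] in the D-multiplicities. *)
have formE (V V' : mx_representation F D e) :
    hom_dim B V V' = (\sum_k \sum_l hom_dim D (irr_repr k) V * (hom_dim D (irr_repr l) V' * h k l))%N.
  rewrite (hom_dim_suml sD) //; apply: eq_bigr => k _.
  by rewrite (hom_dim_sumr sD V' (irr_repr k) F'D sBD) big_distrr.
have sumh : \sum_k \sum_l delta k * delta l * (h k l)%:Z = 2.
  have -> : \sum_k \sum_l delta k * delta l * (h k l)%:Z
      = (hom_dim B U U)%:Z + (hom_dim B U' U')%:Z - (hom_dim B U U')%:Z - (hom_dim B U' U)%:Z.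
    rewrite !formE !(big_morph Posz PoszD (erefl _)) -big_split -!sumrB /=.
    apply: eq_bigr => k _; rewrite !(big_morph Posz PoszD (erefl _)) -big_split -!sumrB /=.
    by apply: eq_bigr => l _; rewrite /delta /n /n' !PoszM; ring.
  have -> : hom_dim B U' U = hom_dim B U U'.
    rewrite !formE exchange_big /=; apply: eq_bigr => k _; apply: eq_bigr => l _.
    by rewrite hC mulnCA.
  by rewrite eB1 eB2; lia.
have sum4 : delta i ^+ 2 * (h i i)%:Z + delta j ^+ 2 * (h j j)%:Z + (delta i * delta j * (h i j)%:Z) *+ 2 = 2.
  rewrite -[RHS]sumh (bigD1 i) // (bigD1 j) /=; last by rewrite eq_sym.
  rewrite [X in _ + (_ + X)]big1 ?addr0 => [|k /andP[ki kj]]; last first.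
    by apply: big1 => l _; rewrite (dk k) // !mul0r.
  have row k : \sum_l delta k * delta l * (h k l)%:Z = delta k * delta i * (h k i)%:Z + delta k * delta j * (h k j)%:Z.
    rewrite (bigD1 i) // (bigD1 j) /=; last by rewrite eq_sym.
    rewrite big1 ?addr0 // => l /andP[li lj].
    by rewrite (dk l) // mulr0 mul0r.
  rewrite !row (hC j i); ring.
have di' : delta i = 1 \/ delta i = -1.
  by move/eqP: di; rewrite sqrf_eq1 => /orP[]/eqP->; [left | right].
have dj' : delta j = 1 \/ delta j = -1.
  by move/eqP: dj; rewrite sqrf_eq1 => /orP[]/eqP->; [left | right].
(* With a and b the degrees of i and j: if the two agree on [B], [sum4] says that (a + b)^2 or (a -
   b)^2 is 2, which is impossible; otherwise a^2 + b^2 = 2. *)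
have di1 : irr_degree i = 1%N.
  move: sum4; rewrite di dj !hE !mul1r.
  have t (k : sD) : [forall x in B, c k x == c k x] by apply/forall_inP.
  rewrite !t; case: ifP => _; last first.
    rewrite mulr0 mul0rn addr0 => e2.
    by have := irr_gt0 i; have := irr_gt0 j; nia.
  move: (irr_degree i) (irr_degree j) => a b.
  have [n1 n2] := (elimN eqP (int_sqr_neq2 (a%:Z + b%:Z)), elimN eqP (int_sqr_neq2 (a%:Z - b%:Z))).
  case: di' dj' => -> [] -> e2; [case: n1 | case: n2 | case: n2 | case: n1];
    by rewrite -[RHS]e2 !PoszM; ring.
exists i; split=> //; move: di'; rewrite /delta /n /n'.
by move: (hom_dim _ _ _) (hom_dim _ _ _) => a b [|] e2; [left | right]; lia.
Qed.
End CliffordTheory.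

(** * Projective representations of abelian groups *)

Section TwistedGroupAlgebra.

Variables (F : closedFieldType) (gT : finGroupType).

Definition projective (A : {set gT}) e (w : gT -> 'M[F]_e) : Prop :=
  {in A, forall a, w a \in unitmx} /\
  {in A &, forall a b, exists c, w a *m w b = c *: w (a * b)%g}.

Definition projective_action (A H : {set gT}) e (w u : gT -> 'M[F]_e) : Prop :=
  {in H & A, forall h a, exists c, w a *m u h = c *: (u h *m w (a ^ h)%g)}.

(** The conclusion of Schur's lemma, used in place of irreducibility. *)
Definition scalar_commutant (A : {set gT}) e (w : gT -> 'M[F]_e) : Prop :=
  forall f, {in A, forall a, f *m w a = w a *m f} -> is_scalar_mx f.

Definition stable_line (H : {set gT}) e (u : gT -> 'M[F]_e) : Prop :=
  exists2 v : 'rV[F]_e, v != 0 & {in H, forall h, exists c, v *m u h = c *: v}.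

Lemma sum_nontrivial_char (A : {group gT}) (chi : gT -> F) x :
    {in A &, {morph chi : a b / (a * b)%g >-> a * b}} -> x \in A -> chi x != 1 ->
  \sum_(a in A) chi a = 0.
Proof.
move=> chiM Ax nt; apply: contraNeq nt => nz.
rewrite -(inj_eq (mulIf nz)) mul1r mulr_sumr; apply/eqP.
rewrite [RHS](reindex_inj (mulgI x)) /=; apply: eq_big => [a | a Aa].
  by rewrite groupMl.
by rewrite chiM.
Qed.

Lemma unitmx_neq0 n (M : 'M[F]_n) : (0 < n)%N -> M \in unitmx -> M != 0.
Proof. by move=> n_gt0 uM; rewrite -mxrank_eq0 mxrank_unit // -lt0n. Qed.

Variables (A : {group gT}) (e : nat) (w : gT -> 'M[F]_e).
Hypotheses (e_gt0 : (0 < e)%N) (projw : projective A w).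

Lemma projective_coef_neq0 (a b : gT) c :
  a \in A -> b \in A -> w a *m w b = c *: w (a * b)%g -> c != 0.
Proof.
move=> Aa Ab ec; have: w a *m w b != 0.
  by apply: unitmx_neq0; rewrite // unitmx_mul !projw.1.
by rewrite ec; apply: contraNneq => ->; rewrite scale0r.
Qed.

Lemma projective1 : is_scalar_mx (w 1%g).
Proof.
have [c] := projw.2 _ _ (group1 A) (group1 A); rewrite mulg1 => ec.
apply/is_scalar_mxP; exists c.
by rewrite -[w 1%g](mulKmx (projw.1 _ (group1 A))) ec -scalemxAr mulVmx ?projw.1 // scalemx1.
Qed.

Hypothesis abelA : abelian A.

(** The cocycle itself is not symmetric, but its antisymmetrisation [c] is a bicharacter of A
    ([formM], [formC], [formMr]) and records how the operators fail to commute. *)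
Lemma commutator_form :
  exists c : gT -> gT -> F,
    {in A &, forall a b, w a *m w b = c a b *: (w b *m w a)} /\
    {in A &, forall a b, c a b != 0}.
Proof.
have ex (ab : gT * gT) : exists c : F, ab.1 \in A -> ab.2 \in A ->
    w ab.1 *m w ab.2 = c *: (w ab.2 *m w ab.1) /\ c != 0.
  have [Aa | _] := boolP (ab.1 \in A); last by exists 0.
  have [Ab | _] := boolP (ab.2 \in A); last by exists 0.
  have [c ec] := projw.2 _ _ Aa Ab; have [d ed] := projw.2 _ _ Ab Aa.
  have nzc := projective_coef_neq0 Aa Ab ec; have nzd := projective_coef_neq0 Ab Aa ed.
  exists (c / d) => _ _; rewrite mulf_neq0 ?invr_eq0 //; split=> //.
  by rewrite ec ed (centsP abelA _ Ab _ Aa) scalerA mulfVK.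
have [c hc] := fin_all_exists ex.
by exists (fun a b => c (a, b)); split=> a b Aa Ab; have [] := hc (a, b) Aa Ab.
Qed.

Section Form.

Variable c : gT -> gT -> F.
Hypotheses (cE : {in A &, forall a b, w a *m w b = c a b *: (w b *m w a)})
           (c_neq0 : {in A &, forall a b, c a b != 0}).

Lemma unit_scale_inj (M : 'M[F]_e) (x y : F) : M \in unitmx -> x *: M = y *: M -> x = y.
Proof.
move=> uM /eqP; rewrite -subr_eq0 -scalerBl scaler_eq0 subr_eq0 => /orP[/eqP // |].
by rewrite (negPf (unitmx_neq0 e_gt0 uM)).
Qed.

Lemma formM a a' b : a \in A -> a' \in A -> b \in A -> c (a * a')%g b = c a b * c a' b.
Proof.
move=> Aa Aa' Ab; have [d ed] := projw.2 _ _ Aa Aa'.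
have nzd := projective_coef_neq0 Aa Aa' ed.
apply: (@unit_scale_inj (w b *m w (a * a')%g)); first by rewrite unitmx_mul !projw.1 ?groupM.
apply: (scalerI nzd); transitivity (w a *m w a' *m w b).
  by rewrite -cE ?groupM // ed scalemxAl.
rewrite -mulmxA (cE Aa' Ab) -scalemxAr mulmxA (cE Aa Ab) -scalemxAl -mulmxA ed -scalemxAr !scalerA.
by congr (_ *: _); rewrite mulrC [c a' b * _]mulrC.
Qed.

Lemma formC a b : a \in A -> b \in A -> c b a = (c a b)^-1.
Proof.
move=> Aa Ab; apply: (mulfI (c_neq0 Aa Ab)); rewrite divff ?c_neq0 //.
apply: (@unit_scale_inj (w a *m w b)); first by rewrite unitmx_mul !projw.1.
by rewrite scale1r -scalerA -cE // -cE.
Qed.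

Lemma formMr a b b' : a \in A -> b \in A -> b' \in A -> c a (b * b')%g = c a b * c a b'.
Proof. by move=> Aa Ab Ab'; rewrite formC ?groupM // formM // invfM -!formC. Qed.

Lemma conj_form a b : a \in A -> b \in A -> invmx (w b) *m w a *m w b = c a b *: w a.
Proof.
by move=> Aa Ab; rewrite -mulmxA cE // -scalemxAr mulKmx // projw.1.
Qed.

End Form.

Hypotheses (centw : forall f, {in A, forall a, f *m w a = w a *m f} -> is_scalar_mx f)
           (nondeg : {in A, forall a, is_scalar_mx (w a) -> a = 1%g})
           (nzA : #|A|%:R != 0 :> F).

(** For a <> 1 the character [c a] is nontrivial: otherwise [w a] would commute with every operator,
    hence be scalar. Its sum over A then vanishes. *)
Lemma form_sum c : {in A &, forall a b, w a *m w b = c a b *: (w b *m w a)} ->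
    {in A &, forall a b, c a b != 0} ->
  {in A, forall a, \sum_(b in A) c a b = #|A|%:R *+ (a == 1%g)}.
Proof.
move=> cE nzc a Aa; case: eqP => [-> | nta].
  rewrite mulr1n -sumr_const; apply: eq_bigr => b Ab.
  have /is_scalar_mxP[x ex] := projective1.
  apply: (@unit_scale_inj (w b *m w 1%g)); first by rewrite unitmx_mul !projw.1.
  by rewrite -cE // scale1r ex scalar_mxC.
have [b Ab ntb] : exists2 b, b \in A & c a b != 1.
  have [/exists_inP[b Ab ?] | /exists_inPn all1] := boolP [exists b in A, c a b != 1].
    by exists b.
  case: nta; apply: nondeg => //; apply: centw => b Ab.
  by rewrite cE // (eqP (negbNE (all1 b Ab))) scale1r.
rewrite mulr0n; apply: (sum_nontrivial_char _ Ab ntb) => b1 b2 Ab1 Ab2.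
exact: formMr.
Qed.

(** Conjugation by [w b] multiplies [w a] by [c a b], so Fourier inversion over b isolates the
    coefficient at [a0]. *)
Lemma twisted_basis_free (x : gT -> F) :
  \sum_(a in A) x a *: w a = 0 -> {in A, forall a, x a = 0}.
Proof.
move=> sum0 a0 Aa0; have [c [cE nzc]] := commutator_form.
have h b : b \in A -> \sum_(a in A) (x a * c a b) *: w a = 0.
  move=> Ab; rewrite -[RHS](mul0mx _ (w b)) -[X in X *m _](mulmx0 _ (invmx (w b))) -{2}sum0.
  rewrite mulmx_sumr mulmx_suml; apply: eq_bigr => a Aa.
  by rewrite -scalemxAr -scalemxAl (conj_form cE) // scalerA.
have : \sum_(b in A) c a0^-1%g b *: (\sum_(a in A) (x a * c a b) *: w a) = (x a0 * #|A|%:R) *: w a0.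
  transitivity (\sum_(a in A) (x a * (\sum_(b in A) c (a0^-1 * a)%g b)) *: w a).
    under eq_bigr do rewrite scaler_sumr.
    rewrite exchange_big /=; apply: eq_bigr => a Aa.
    rewrite mulr_sumr scaler_suml; apply: eq_bigr => b Ab.
    by rewrite scalerA (formM cE) ?groupV // mulrCA.
  rewrite (bigD1 a0) //= mulVg form_sum // eqxx mulr1n big1 ?addr0 // => a /andP[Aa na].
  by rewrite form_sum ?groupM ?groupV // -eq_mulVg1 eq_sym (negPf na) mulr0n mulr0 scale0r.
rewrite big1 => [/esym/eqP | b Ab]; last by rewrite h // scaler0.
rewrite scaler_eq0 mulf_eq0 (negPf nzA) orbF (negPf (unitmx_neq0 e_gt0 (projw.1 _ Aa0))) orbF.
by move/eqP.
Qed.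

(** Fourier inversion splits [f] into components [f_ a] that every [w d] conjugates by the same
    scalar as [w a]. Then [f_ a] times the inverse of [w a] commutes with all operators and is
    scalar. *)
Lemma twisted_basis_full (f : 'M[F]_e) :
  exists x : gT -> F, f = \sum_(a in A) x a *: w a.
Proof.
have [c [cE nzc]] := commutator_form.
pose cj b := invmx (w b) *m f *m w b.
pose f_ a := #|A|%:R^-1 *: \sum_(b in A) c b a *: cj b.
have sumf : f = \sum_(a in A) f_ a.
  rewrite -scaler_sumr exchange_big /=.
  transitivity (#|A|%:R^-1 *: \sum_(b in A) (\sum_(a in A) c b a) *: cj b); last first.
    by congr (_ *: _); apply: eq_bigr => b Ab; rewrite scaler_suml.
  rewrite (bigD1 1%g) //= form_sum // eqxx mulr1n big1 ?addr0 => [|b /andP[Ab ntb]].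
    rewrite scalerA mulVf // scale1r /cj; have /is_scalar_mxP[x ex] := projective1.
    by rewrite -mulmxA {2}ex scalar_mxC -ex mulKmx ?projw.1.
  by rewrite form_sum // (negPf ntb) mulr0n scale0r.
have fd a d : a \in A -> d \in A -> f_ a *m w d = c a d *: (w d *m f_ a).
  move=> Aa Ad.
  rewrite -!scalemxAl -!scalemxAr scalerA mulrC -scalerA; congr (_ *: _).
  rewrite mulmx_suml mulmx_sumr scaler_sumr [RHS](reindex_inj (mulIg d)) /=.
  apply: eq_big => [b | b Ab]; first by rewrite groupMr.
  have [y ey] := projw.2 _ _ Ab Ad; have nzy := projective_coef_neq0 Ab Ad ey.
  rewrite -scalemxAl -scalemxAr scalerA.
  have -> : cj b *m w d = w d *m cj (b * d)%g.
    have ->: w d *m cj (b * d)%g = w d *m invmx (w (b * d)%g) *m (f *m w (b * d)%g).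
      by rewrite /cj !mulmxA.
    have -> : w d *m invmx (w (b * d)%g) = y *: invmx (w b).
      apply: (can_inj (mulKmx (projw.1 _ Ab))).
      by rewrite /= mulmxA ey -scalemxAl -scalemxAr !mulmxV ?projw.1 ?groupM.
    by rewrite -scalemxAl !scalemxAr -ey /cj !mulmxA.
  have Aba : (b * d)%g \in A by rewrite groupM.
  by rewrite (formM cE) // [c d a](formC cE nzc) // mulrCA divff ?nzc // mulr1.
clearbody f_.
have ex a : a \in A -> exists x, f_ a = x *: w a.
  move=> Aa.
  have /is_scalar_mxP[x ex] : is_scalar_mx (f_ a *m invmx (w a)).
    apply: centw => d Ad.
    apply: (can_inj (mulmxK (projw.1 _ Aa))); rewrite -[LHS]mulmxA.
    apply: (scalerI (nzc _ _ Aa Ad)).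
    rewrite /= scalemxAr -cE // [LHS]mulmxA mulmxKV ?projw.1 // fd //; congr (_ *: _).
    by rewrite mulmxA mulmxKV ?projw.1.
  exists x ; by rewrite -mul_scalar_mx -ex mulmxKV ?projw.1.
have [x hx] := exists_choice ex 0.
by exists x; rewrite {1}sumf; apply: eq_bigr => a Aa; apply: hx.
Qed.

End TwistedGroupAlgebra.

(** * Endomorphisms of a module against homomorphisms into its twist *)

Section HomDefect.

Variables (F : closedFieldType) (gT : finGroupType) (A : {group gT}) (e : nat).
Variable w : gT -> 'M[F]_e.
Hypotheses (e_gt0 : (0 < e)%N) (projw : projective A w).
Hypothesis freew : forall x : gT -> F,
  \sum_(a in A) x a *: w a = 0 -> {in A, forall a, x a = 0}.
Hypothesis fullw : forall f : 'M[F]_e, exists x : gT -> F, f = \sum_(a in A) x a *: w a.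

Lemma twisted_dim : (e * e)%N = #|A|.
Proof.
pose W : 'M[F]_(#|A|, e * e) := \matrix_i mxvec (w (enum_val i)).
have sumE (x : gT -> F) : mxvec (\sum_(a in A) x a *: w a) = (\row_i x (enum_val i)) *m W.
  rewrite mulmx_sum_row linear_sum /= [LHS](reindex_onto enum_val (enum_rank_in (group1 A))) /=; last first.
    by move=> a Aa; rewrite enum_rankK_in.
  apply: eq_big => i; first by rewrite enum_valP enum_valK_in eqxx.
  by rewrite linearZ /= rowK mxE.
have Wfull : row_full W.
  rewrite -sub1mx; apply/row_subP=> k; rewrite -[row k _]vec_mxK.
  by have [x ->] := fullw (vec_mx (row k 1%:M)); rewrite sumE submxMl.
have Wfree : row_free W.
  rewrite -kermx_eq0; apply/rowV0P=> v /sub_kermxP vW.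
  pose x a := v 0 (enum_rank_in (group1 A) a).
  have vx : v = \row_i x (enum_val i) by apply/rowP=> i; rewrite mxE /x enum_valK_in.
  have /freew x0 : \sum_(a in A) x a *: w a = 0.
    by apply: (can_inj mxvecK); rewrite sumE -vx vW linear0.
  by rewrite vx; apply/rowP=> i; rewrite !mxE x0 ?enum_valP.
exact: etrans (esym (eqP Wfull)) (eqP Wfree).
Qed.

Lemma twisted_eq_lin m (X Y : 'M[F]_(e * e, m)) :
  {in A, forall a, mxvec (w a) *m X = mxvec (w a) *m Y} -> X = Y.
Proof.
move=> eqXY; apply/row_matrixP=> i; rewrite !rowE -[delta_mx 0 i]vec_mxK.
have [x ->] := fullw (vec_mx (delta_mx 0 i)).
rewrite linear_sum !mulmx_suml; apply: eq_bigr => a Aa.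
by rewrite linearZ /= -!scalemxAl eqXY.
Qed.

Lemma twisted_diag (tau : gT -> F) :
  exists T : 'M[F]_(e * e), {in A, forall a, mxvec (w a) *m T = tau a *: mxvec (w a)}.
Proof.
have exx (k : 'I_(e * e)) : exists x : gT -> F, vec_mx (delta_mx 0 k) = \sum_(a in A) x a *: w a.
  exact: fullw.
have [x xE] := fin_all_exists exx.
exists (\matrix_k mxvec (\sum_(a in A) (tau a * x k a) *: w a)) => a Aa.
pose y b := \sum_k mxvec (w a) 0 k * x k b.
have wa : w a = \sum_(b in A) y b *: w b.
  rewrite -[LHS]mxvecK (row_sum_delta (mxvec (w a))) linear_sum /=.
  under eq_bigr do rewrite linearZ /= xE scaler_sumr.
  rewrite exchange_big /=; apply: eq_bigr => b Ab.
  by rewrite scaler_suml; apply: eq_bigr => k _; rewrite scalerA.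
have ya b : b \in A -> y b = (b == a)%:R.
  move=> Ab; apply/eqP; rewrite -subr_eq0; apply/eqP.
  apply: (freew (x := fun b => y b - (b == a)%:R)) => //.
  under eq_bigr do rewrite scalerBl.
  rewrite sumrB -wa (bigD1 a) //= eqxx scale1r big1 ?addr0 ?subrr // => b' /andP[_ /negPf->].
  by rewrite scale0r.
rewrite mulmx_sum_row -linearZ /=.
transitivity (mxvec (\sum_(b in A) (tau b * y b) *: w b)).
  under eq_bigr do rewrite rowK -linearZ /= scaler_sumr.
  rewrite -linear_sum exchange_big /=; congr mxvec; apply: eq_bigr => b Ab.
  rewrite mulr_sumr scaler_suml; apply: eq_bigr => k _.
  by rewrite scalerA mulrCA.
rewrite (bigD1 a) //= ya // eqxx mulr1 big1 ?addr0 // => b /andP[Ab nba].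
by rewrite ya // (negPf nba) mulr0 scale0r.
Qed.

(* Multiplying the coordinate of [w a] by [tau a] identifies the endomorphisms *)
(* without component along [w 1] with the homomorphisms into the twist by mu. *)
Lemma hom_dim_twist (B : {set gT}) (Psi : gT -> 'M[F]_e) (mu tau : gT -> F) :
    B \subset 'N(A) ->
    {in B, forall x, Psi x \in unitmx} ->
    {in B & A, forall x a, exists c, w a *m Psi x = c *: (Psi x *m w (a ^ x)%g)} ->
    {in B, forall x, mu x != 0} -> (exists2 x, x \in B & mu x != 1) ->
    {in A, forall a, a != 1%g -> tau a != 0} ->
    {in B & A, forall x a, a != 1%g -> tau (a ^ x)%g = mu x * tau a} ->
  hom_dim B Psi Psi = (hom_dim B Psi (fun x => mu x *: Psi x)).+1.
Proof.
move=> nAB uPsi actw nzmu [x0 Bx0 ntmu] nztau tauM.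
pose C x := lin_mx (mulmx (invmx (Psi x))) *m lin_mx (mulmxr (Psi x)) : 'M[F]_(e * e).
have CE x f : mxvec f *m C x = mxvec (invmx (Psi x) *m f *m Psi x).
  by rewrite mulmxA !mul_vec_lin.
clearbody C.
have Cw x a : x \in B -> a \in A -> exists c, mxvec (w a) *m C x = c *: mxvec (w (a ^ x)%g).
  move=> Bx Aa; have [c ec] := actw x a Bx Aa; exists c.
  by rewrite CE -mulmxA ec -scalemxAr mulKmx ?uPsi // linearZ.
(* [T] scales the coordinate of [w a] by [tau a] and kills [w 1]; [T'] inverts it on the other
   coordinates. Semi-invariance of [tau] makes [T] carry [X1], the fixed space of the conjugations
   [C x], into [Xm]. *)
have [T TE] := twisted_diag (fun a => if a == 1%g then 0 else tau a).
have [T' T'E] := twisted_diag (fun a => if a == 1%g then 0 else (tau a)^-1).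
have CT x : x \in B -> C x *m T = mu x *: (T *m C x).
  move=> Bx; apply: twisted_eq_lin => a Aa.
  have Aax := norm_memJ nAB Bx Aa.
  have [c ec] := Cw x a Bx Aa.
  rewrite mulmxA ec -scalemxAl TE // -scalemxAr mulmxA TE // -scalemxAl ec.
  have -> : ((a ^ x)%g == 1%g) = (a == 1%g) by rewrite -[X in _ == X](conj1g x) (inj_eq (conjg_inj x)).
  case: eqP => [_ | /eqP nta]; first by rewrite !scale0r !scaler0.
  by rewrite tauM // !scalerA mulrC.
have CT' x : x \in B -> C x *m T' = (mu x)^-1 *: (T' *m C x).
  move=> Bx; apply: twisted_eq_lin => a Aa.
  have Aax := norm_memJ nAB Bx Aa.
  have [c ec] := Cw x a Bx Aa.
  rewrite mulmxA ec -scalemxAl T'E // -scalemxAr mulmxA T'E // -scalemxAl ec.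
  have -> : ((a ^ x)%g == 1%g) = (a == 1%g) by rewrite -[X in _ == X](conj1g x) (inj_eq (conjg_inj x)).
  case: eqP => [_ | /eqP nta]; first by rewrite !scale0r !scaler0.
  by rewrite tauM // invfM !scalerA mulrC.
have [s es] := is_scalar_mxP (projective1 projw).
have nzs : s != 0.
  by have := unitmx_neq0 e_gt0 (projw.1 _ (group1 A)); rewrite es; apply: contraNneq => ->; rewrite raddf0.
have SE v : v *m (1%:M - T' *m T) = v *m (1%:M - T *m T').
  congr (_ *m (_ - _)); apply: twisted_eq_lin => a Aa.
  by rewrite !mulmxA TE // T'E // -!scalemxAl TE // T'E // !scalerA mulrC.
have Sscal (v : 'rV_(e * e)) : exists k, v *m (1%:M - T' *m T) = k *: mxvec 1%:M.
  have [x ex] := fullw (vec_mx v); exists (x 1%g * s).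
  rewrite -[v]vec_mxK ex linear_sum mulmx_suml (bigD1 1%g) //= big1 ?addr0.
    rewrite mulmxBr mulmx1 mulmxA linearZ /= -scalemxAl T'E // eqxx scale0r scaler0 mul0mx subr0.
    by rewrite es -[s%:M]scalemx1 linearZ /= scalerA.
  move=> a /andP[Aa nta]; rewrite linearZ /= -scalemxAl mulmxBr mulmx1 mulmxA T'E //.
  by rewrite (negPf nta) -scalemxAl TE // (negPf nta) scalerA mulVf ?nztau // scale1r subrr scaler0.
rewrite /hom_dim; set X1 := hom_mx B Psi Psi; set Xm := hom_mx B Psi _.
have X1P (v : 'rV_(e * e)) : reflect {in B, forall x, v *m C x = v} (v <= X1)%MS.
  rewrite hom_mxE; apply: (iffP (mxhomP _ _ _ _)) => h x Bx.
    by rewrite -{1}[v]vec_mxK CE -mulmxA -h // mulKmx ?uPsi // vec_mxK.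
  have := h x Bx; rewrite -{1}[v]vec_mxK CE => /(congr1 vec_mx); rewrite mxvecK => ef.
  by rewrite -{1}ef -!mulmxA mulKVmx ?uPsi.
have XmP (v : 'rV_(e * e)) : reflect {in B, forall x, mu x *: (v *m C x) = v} (v <= Xm)%MS.
  rewrite hom_mxE; apply: (iffP (mxhomP _ _ _ _)) => h x Bx.
    rewrite -{1}[v]vec_mxK CE -linearZ /= -mulmxA !scalemxAr -h //.
    by rewrite mulKmx ?uPsi // vec_mxK.
  have := h x Bx; rewrite -{1}[v]vec_mxK CE => /(congr1 vec_mx).
  rewrite linearZ /= mxvecK => ef.
  by rewrite -{1}ef -!scalemxAr -!mulmxA mulKVmx ?uPsi.
have sX1T : (X1 *m T <= Xm)%MS.
  apply/row_subP=> i; rewrite row_mul; have := row_sub i X1; move: (row i X1) => v /X1P hv.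
  apply/XmP=> x Bx; rewrite -mulmxA scalemxAr -CT // mulmxA hv //.
have sXmT' : (Xm *m T' <= X1)%MS.
  apply/row_subP=> i; rewrite row_mul; have := row_sub i Xm; move: (row i Xm) => v /XmP hv.
  apply/X1P=> x Bx; rewrite -{2}(hv x Bx) -scalemxAl -!mulmxA CT' // -scalemxAr scalerA.
  by rewrite divff ?nzmu // scale1r.
have C1 x : x \in B -> mxvec 1%:M *m C x = mxvec 1%:M.
  by move=> Bx; rewrite CE mulmx1 mulVmx ?uPsi.
(* An element of [Xm] has no identity component, since [C x0] fixes the identity and [mu x0] is not
   1. So [T] maps [X1] onto [Xm]; its kernel there is the line of the identity, which accounts for
   the successor. *)
have sXmX1T : (Xm <= X1 *m T)%MS.
  apply/row_subP=> i; have := row_sub i Xm; move: (row i Xm) => v Xmv.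
  suff -> : v = v *m T' *m T by rewrite submxMr // (submx_trans _ sXmT') ?submxMr.
  apply/eqP; rewrite -subr_eq0 -mulmxA -{1}[v]mulmx1 -mulmxBr.
  have [k ek] := Sscal v.
  have : (v *m (1%:M - T' *m T) <= Xm)%MS.
    rewrite mulmxBr mulmx1 addmx_sub ?eqmx_opp // mulmxA.
    by rewrite (submx_trans _ sX1T) // submxMr // (submx_trans _ sXmT') // submxMr.
  move/XmP/(_ x0 Bx0); rewrite ek -scalemxAl C1 // => /eqP.
  rewrite scalerA -subr_eq0 -scalerBl scaler_eq0 -{2}[k]mul1r -mulrBl mulf_eq0.
  rewrite subr_eq0 (negPf ntmu) /=; case/orP=> /eqP->; first by rewrite scale0r.
  by rewrite scaler0.
rewrite -(mxrank_mul_ker X1 T) -addn1; congr (_ + _)%N.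
  by apply: eqmx_rank; apply/andP.
have nz1 : mxvec (1%:M : 'M[F]_e) != 0 by rewrite mxvec_eq0 -mxrank_eq0 mxrank1 -lt0n.
transitivity (\rank (mxvec (1%:M : 'M[F]_e))); last by rewrite rank_rV nz1.
apply: eqmx_rank; apply/andP; split.
  apply/rV_subP=> v; rewrite sub_capmx => /andP[_ /sub_kermxP vT0].
  have [k ek] := Sscal v; rewrite SE mulmxBr mulmx1 mulmxA vT0 mul0mx subr0 in ek.
  by rewrite ek scalemx_sub.
rewrite sub_capmx; apply/andP; split; first by apply/X1P.
apply/sub_kermxP; apply: (scalerI nzs).
by rewrite scalemxAl -linearZ /= scalemx1 -es TE // eqxx scale0r scaler0.
Qed.

End HomDefect.

(** * Coprime lifting, semi-invariants, fixed vectors of q-groups *)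

Section CoprimeLift.

Variables (F : closedFieldType) (gT : finGroupType).

Lemma closed_root_exp (n : nat) (a : F) : (0 < n)%N -> exists x : F, x ^+ n = a.
Proof.
move=> n_gt0; have [|x] := @closed_rootP F ('X^n - a%:P) _.
  by rewrite size_XnsubC // gtn_eqF.
by rewrite rootE !hornerE subr_eq0 => /eqP; exists x.
Qed.

Lemma projective_scale (H : {group gT}) e (u u' : gT -> 'M[F]_e) (k : gT -> F) :
    (0 < e)%N -> projective H u -> {in H, forall h, k h != 0} ->
    {in H, forall h, u' h = k h *: u h} -> projective H u'.
Proof.
move=> e_gt0 [uu pu] nzk eu'; split=> [h Hh | h h' Hh Hh'].
  by rewrite eu' // unitmxZ ?unitfE ?nzk ?uu.
have [c ec] := pu h h' Hh Hh'; exists (k h * k h' * c / k (h * h')%g).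
rewrite !eu' ?groupM // -scalemxAl -scalemxAr ec !scalerA divfK //.
by rewrite nzk ?groupM.
Qed.

(* The cohomology class of the cocycle [alpha] is killed by both |H| and e: *)
(* the first by the averages [c h], the second by normalising determinants. *)
Lemma projective_coprime_lift (H : {group gT}) e (u : gT -> 'M[F]_e) :
    (0 < e)%N -> coprime e #|H| -> projective H u ->
  exists Psi : mx_representation F H e,
    {in H, forall h, exists2 c, c != 0 & Psi h = c *: u h}.
Proof.
move=> e_gt0 coeH proju.
(* With all determinants equal to 1, the cocycle takes values in the e-th roots of unity. *)
have exk (h : gT) : h \in H -> exists k : F, k != 0 /\ \det (k *: u h) = 1.
  move=> Hh.
  have nzd : \det (u h) != 0 by rewrite -unitfE -unitmxE proju.1.
  have [k ek] := closed_root_exp (\det (u h))^-1 e_gt0; exists k .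
  split; last by rewrite detZ ek mulVf.
  by apply: contraNneq nzd => k0; rewrite -invr_eq0 -ek k0 expr0n gtn_eqF.
have [k hk] := exists_choice exk 0.
pose v h := k h *: u h.
have nzk : {in H, forall h, k h != 0} by move=> h /hk[].
have projv : projective H v by apply: (projective_scale e_gt0 proju nzk).
have detv h : h \in H -> \det (v h) = 1 by move=> /hk[].
have ev h : v h = k h *: u h by [].
clearbody v.
have exa (hl : gT * gT) : exists a : F, hl.1 \in H -> hl.2 \in H ->
    v hl.1 *m v hl.2 = a *: v (hl.1 * hl.2)%g.
  have [Hh | _] := boolP (hl.1 \in H); last by exists 0.
  have [Hl | _] := boolP (hl.2 \in H); last by exists 0.
  by have [a ea] := projv.2 _ _ Hh Hl; exists a.
have [a0 ha0] := fin_all_exists exa.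
pose a h l := a0 (h, l).
have ha h l : h \in H -> l \in H -> v h *m v l = a h l *: v (h * l)%g.
  by move=> Hh Hl; apply: (ha0 (h, l)).
have ae h l : h \in H -> l \in H -> a h l ^+ e = 1.
  move=> Hh Hl; have := congr1 determinant (ha h l Hh Hl).
  by rewrite det_mulmx detZ !detv ?groupM // !mulr1 => <-.
have nza h l : h \in H -> l \in H -> a h l != 0.
  by move=> Hh Hl; apply: (projective_coef_neq0 e_gt0 projv _ _ (ha h l Hh Hl)).
have aA h l m : h \in H -> l \in H -> m \in H -> a h l * a (h * l)%g m = a h (l * m)%g * a l m.
  move=> Hh Hl Hm; have uv : v (h * l * m)%g \in unitmx by rewrite projv.1 ?groupM.
  apply: (unit_scale_inj e_gt0 uv).
  rewrite -scalerA -ha ?groupM // scalemxAl -ha // -mulmxA ha // -scalemxAr ha ?groupM //.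
  by rewrite scalerA mulrC mulgA.
pose c h := \prod_(m in H) a h m.
have nzc h : h \in H -> c h != 0 by move=> Hh; apply/prodf_neq0 => m Hm; apply: nza.
(* The product of the cocycle identity over its last argument: the |H|-th power of [a] is a
   coboundary. *)
have cM h l : h \in H -> l \in H -> c h * c l = a h l ^+ #|H| * c (h * l)%g.
  move=> Hh Hl; have -> : c h = \prod_(m in H) a h (l * m)%g.
    by rewrite /c (reindex_inj (mulgI l)) /=; apply: eq_bigl => m; rewrite groupMl.
  rewrite /c -prodr_const -!big_split /=; apply: eq_bigr => m Hm.
  by rewrite aA.
have /coprimeP : coprime #|H| e by rewrite coprime_sym.
rewrite cardG_gt0 => /(_ isT)[[s t] /= est].
(* Since [a] has e-th power 1, raising [cM] to the power s leaves [a] itself as the coboundary of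
   c^s. *)
have {}est : (s * #|H| = (t * e).+1)%N by rewrite -addn1 -est addnC subnK // ltnW // -subn_gt0 est.
pose psi h := (c h ^+ s)^-1 *: v h.
have psiM : {in H &, {morph psi : h l / (h * l)%g >-> h *m l}}.
  move=> h l Hh Hl; have [nz1 nz2] := (expf_neq0 s (nzc h Hh), expf_neq0 s (nzc l Hl)).
  have nz3 := expf_neq0 s (nzc _ (groupM Hh Hl)).
  have key : c h ^+ s * c l ^+ s = a h l * c (h * l)%g ^+ s.
    rewrite -exprMn cM // exprMn -exprM mulnC est exprS mulnC exprM ae //.
    by rewrite expr1n mulr1.
  rewrite /psi -scalemxAl -scalemxAr ha // !scalerA; congr (_ *: _).
  apply: (mulIf nz3); rewrite mulVf // -!mulrA -key [_ * c l ^+ s]mulrC.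
  by rewrite mulKf // mulVf.
have upsi h : h \in H -> psi h \in unitmx.
  by move=> Hh; rewrite unitmxZ ?projv.1 // unitfE invr_eq0 expf_neq0 ?nzc.
have reprpsi : mx_repr H psi.
  split=> //; have := psiM _ _ (group1 H) (group1 H); rewrite mulg1 => e1.
  by rewrite -[psi 1%g](mulKmx (upsi _ (group1 H))) -e1 mulVmx ?upsi.
exists (MxRepresentation reprpsi) => // h Hh.
exists ((c h ^+ s)^-1 * k h); first by rewrite mulf_neq0 ?invr_eq0 ?expf_neq0 ?nzc ?nzk.
by rewrite /= /psi ev scalerA.
Qed.

(** On the orbit of a representative r, put tau (r ^ g) = mu g; the last hypothesis says that
    stabilisers of nontrivial elements lie in the kernel of [mu], so the choice of g does not
    matter. *)
Lemma exists_semi_invariant (A D : {group gT}) (mu : gT -> F) :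
    D \subset 'N(A) -> {in D &, {morph mu : x y / (x * y)%g >-> x * y}} ->
    {in D, forall x, mu x != 0} ->
    {in A & D, forall a x, a != 1%g -> (a ^ x)%g = a -> mu x = 1} ->
  exists tau : gT -> F,
    {in A, forall a, a != 1%g -> tau a != 0} /\
    {in D & A, forall x a, a != 1%g -> tau (a ^ x)%g = mu x * tau a}.
Proof.
move=> nAD muM nzmu stab.
have exg (a : gT) : exists2 g, g \in D & (repr (a ^: D) ^ g)%g = a.
  have /imsetP[g Dg eg] := mem_repr a (class_refl D a).
  by exists g^-1%g; rewrite ?groupV // eg conjgK.
have [g Dg eg] := fin_all_exists2 exg.
exists (fun a => mu (g a)); split=> [a _ _ | x a Dx Aa nta]; first exact: nzmu.
have Dgx : (g a * x * (g (a ^ x))^-1)%g \in D by rewrite !groupM ?groupV ?Dg.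
have Ar : repr (a ^: D) \in A.
  have /imsetP[h Dh ->] := mem_repr a (class_refl D a).
  by rewrite memJ_norm // (subsetP nAD).
have ntr : repr (a ^: D) != 1%g.
  by apply: contraNneq nta => r1; rewrite -(eg a) r1 conj1g.
have := stab _ _ Ar Dgx ntr; rewrite !conjgM eg.
have er : repr (a ^: D) = repr ((a ^ x)%g ^: D) by rewrite classGidl.
rewrite er -{1}(eg (a ^ x)%g) conjgK => /(_ (erefl _)) mu1.
have : mu (g a * x * (g (a ^ x))^-1 * g (a ^ x))%g = mu (g (a ^ x)%g).
  by rewrite muM ?Dg // mu1 mul1r.
by rewrite mulgKV muM ?Dg // mulrC => <-.
Qed.

(** Some irreducible constituent has degree not divisible by q. An irreducible that is not linear is
    induced from a subgroup of index q, so this one is linear and Q' acts trivially on it. *)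
Lemma pgroup_der1_fixed (q : nat) (Q : {group gT}) n (r : mx_representation F Q n) :
    q.-group Q -> [pchar F]^'.-group Q -> prime q -> ~~ (q %| n)%N ->
  rfix_mx r Q^`(1)%g != 0.
Proof.
move=> qQ F'Q prq nqn; pose sQ := DecSocleType (regular_repr F Q).
(* Over the empty set every matrix intertwines, so [hom_dim] into a one-dimensional target is the
   dimension, and [hom_dim_suml] becomes the degree count for [r]. *)
pose t (x : gT) : 'M[F]_1 := 0.
have hd0 k (s : gT -> 'M[F]_k) : hom_dim set0 s t = k.
  have -> : hom_dim set0 s t = (k * 1)%N; last by rewrite muln1.
  by apply/eqP; apply/eqP; rewrite /hom_dim /hom_mx big_set0 mxrank1.
have := hom_dim_suml sQ r t F'Q (sub0set _); rewrite hd0 => en.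
have [i nzi nqi] : exists2 i : sQ, hom_dim Q (irr_repr i) r != 0%N & ~~ (q %| irr_degree i)%N.
  have [/existsP[i /andP[? ?]] | /existsPn h] := boolP [exists i : sQ, (hom_dim Q (irr_repr i) r != 0%N) && ~~ (q %| irr_degree i)%N].
    by exists i.
  case/negP: nqn; rewrite en; apply: dvdn_sum => i _; rewrite hd0.
  by have := h i; rewrite negb_and !negbK => /orP[/eqP->|]; [rewrite mul0n dvdn0 | apply: dvdn_mull].
have d1 : irr_degree i = 1%N.
  have irri := socle_irr i.
  have nil1 : nilpotent (Q / 1) by rewrite quotient_nil ?(pgroup_nil qQ).
  have [irr1 | [K [k [rK [f [[_ _ pr eK] _ _ _]]]]]] :=
      nilpotent_quo_irr_induced (sub1G Q) (normal1 Q) nil1 irri.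
    by apply: mx_irr_abelian_linear irr1 (abelian1 _); apply: group_closure_closed_field.
  case/negP: nqi; have <- : (#|Q : K| * k)%N = irr_degree i := eK; rewrite dvdn_mulr //.
  have := pgroupP qQ _ pr (dvdn_indexg _ _).
  by rewrite inE => /eqP->.
have /rowV0Pn[v] : hom_mx Q (irr_repr i) r != 0 by rewrite -mxrank_eq0.
rewrite hom_mxE => /mxhomP homf nzv.
have nzf : vec_mx v != 0 by rewrite vec_mx_eq0.
apply: contra nzf => /eqP fix0; rewrite -submx0 -fix0; apply/rfix_mxP=> x Q'x.
have /rkerP[Qx ex] := subsetP (rker_linear (irr_repr i) d1) x Q'x.
by rewrite -homf // ex mul1mx.
Qed.

End CoprimeLift.

(** * Stable lines under nilpotent groups *)

Section NilpotentActions.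

Variable gT : finGroupType.
Implicit Types (A H P N : {group gT}) (p : nat).

Definition irreducible_section N A H : Prop :=
  forall D : {group gT}, N \subset D -> D \subset A -> H \subset 'N(D) -> D :=: N \/ D :=: A.

Lemma nilpotent_pcore_neq1 H p : nilpotent H -> prime p -> (p %| #|H|)%N -> 'O_p(H) != 1%g.
Proof.
move=> nilH prp pH; rewrite trivg_card1; apply/negP=> /eqP O1.
have := card_Hall (nilpotent_pcore_Hall p nilH); rewrite O1 => /esym/eqP.
by rewrite p_part_eq1 mem_primes prp cardG_gt0 pH.
Qed.

(** A is a nontrivial normal subgroup of the p-group PA, so it meets the centre of PA. *)
Lemma pgroup_cent_neq1 A P p :
  p.-group A -> p.-group P -> P \subset 'N(A) -> A :!=: 1%g -> 'C_A(P) != 1%g.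
Proof.
move=> pA pP nAP ntA; have pPA : p.-group (P <*> A) by rewrite norm_joinEl // pgroupM pP.
have := @meet_center_nil _ _ A (pgroup_nil pPA) _ ntA.
rewrite /normal joing_subr join_subG nAP normG => /(_ isT).
apply: contraNneq => C1; rewrite -subG1 -C1.
by apply: setIS; rewrite subIset // orbC centS // joing_subl.
Qed.

Lemma coset_pre_group H N (C : {group coset_of N}) : N <| H -> C \subset (H / N)%g ->
  [/\ N \subset (H :&: coset N @*^-1 C)%g, (H :&: coset N @*^-1 C) / N = C
    & forall K : {group gT}, K \subset 'N(H) -> K \subset 'N(N) -> (K / N)%g \subset 'N(C) ->
      K \subset 'N(H :&: coset N @*^-1 C)]%g.
Proof.
case/andP=> sNH nNH sCH; split.
- by rewrite subsetI sNH -{1}(ker_coset N) kerE morphpreS // sub1G.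
- by rewrite [LHS]morphim_setIpre; apply/setIidPr.
move=> K nHK nNK nCK; rewrite normsI //; apply: subset_trans (morphpre_norm _ _).
by rewrite -sub_quotient_pre.
Qed.

End NilpotentActions.

(** * The coprime faithful case *)

Section StableLine.

Variables (F : closedFieldType) (ell : nat) (charF : ell \in [pchar F]).
Variable gT : finGroupType.

Lemma exists_root_of_unity_neq1 q : prime q -> q != ell ->
  exists2 eta : F, eta ^+ q = 1 & eta != 1.
Proof.
move=> prq nql; pose p := \sum_(i < q) 'X^i : {poly F}.
have q_gt1 := prime_gt1 prq.
have [|x rx] := @closed_rootP F p _.
  rewrite (_ : p = \poly_(i < q) 1); last by rewrite poly_def; apply: eq_bigr => i _; rewrite scale1r.
  by rewrite size_poly_eq ?oner_neq0 // gtn_eqF.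
have pE y : p.[y] = \sum_(i < q) y ^+ i.
  by rewrite /p horner_sum; apply: eq_bigr => i _; rewrite hornerXn.
exists x; first by have px0 := rootP rx; apply/eqP; rewrite -subr_eq0 subrX1 -pE px0 mulr0.
apply: contraNneq nql => x1; have := rx; rewrite x1 rootE pE.
under eq_bigr do rewrite expr1n.
rewrite sumr_const card_ord => /eqP q0.
have : (ell %| q)%N by rewrite (dvdn_pcharf charF) q0.
by rewrite dvdn_prime2 ?(pcharf_prime charF) // eq_sym.
Qed.

(** O_q(H)' fixes a nonzero H-submodule of [E]. On a simple submodule [S] of it, O_ell(H) acts
    trivially, the {q, ell}'-core by scalars and O_q(H) through an abelian quotient. So H acts on
    [S] by commuting matrices, and [S] is a line. *)
Lemma stable_line_of_rank (H : {group gT}) q e (Psi : mx_representation F H e)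
    (E : 'M[F]_e) (s : gT -> F) :
    nilpotent H -> prime q -> q != ell -> mxmodule Psi E -> ~~ (q %| \rank E)%N ->
    {in 'O_[pred r | (r != q) && (r != ell)](H), forall x, E *m Psi x = s x *: E} ->
  stable_line H Psi.
Proof.
move=> nilH prq nql modE nqE sE.
pose Q := 'O_q(H)%G; have sQH : Q \subset H := pcore_sub _ _.
have qQ : q.-group Q := pcore_pgroup _ _.
have F'Q : [pchar F]^'.-group Q.
  apply: sub_in_pnat qQ => r _; rewrite inE /= => /eqP ->.
  by have := pcharf_eq charF q; rewrite !inE (negPf nql) => ->.
pose rQ := subg_repr Psi sQH.
have modEQ : mxmodule rQ E := mxmodule_subg sQH modE.
have nzfix := pgroup_der1_fixed (submod_repr modEQ) qQ F'Q prq nqE.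
have nsQ'H : Q^`(1)%g <| H.
  by apply: char_normal_trans (der_char 1 _) (pcore_normal _ _).
pose W := (E :&: rfix_mx Psi Q^`(1)%g)%MS.
have modW : mxmodule Psi W by rewrite capmx_module ?normal_rfix_mx_module.
have nzW : W != 0.
  apply: contra nzfix => /eqP W0; rewrite -mxrank_eq0 (rfix_submod _ (der_sub 1 Q)).
  by rewrite rfix_subg -/W W0 linear0 mxrank0.
have [S simS sSW] := dec_mxsimple_exists modW nzW.
have [modS nzS _] := simS.
have irrS : mx_irreducible (submod_repr modS) by apply/submod_mx_irr.
set rS := submod_repr modS in irrS.
have sSE : (S <= E)%MS := submx_trans sSW (capmxSl _ _).
have SK x : x \in 'O_[pred r | (r != q) && (r != ell)](H) -> S *m Psi x = s x *: S.
  by move=> Kx; have /submxP[D ->] := sSE; rewrite -mulmxA sE // scalemxAr.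
have rSK x : x \in 'O_[pred r | (r != q) && (r != ell)](H) -> rS x = (s x)%:M.
  move=> Kx; have Hx := subsetP (pcore_sub _ _) x Kx.
  apply: val_submod_inj; rewrite -[rS x]mul1mx val_submodJ //.
  have /submxP[D eD] := val_submodP (1%:M : 'M_(\rank S)).
  rewrite eD -mulmxA SK // -scalemxAr -eD.
  by rewrite -[(s x)%:M]scalemx1 linearZ.
have rSL x : x \in 'O_ell(H) -> rS x = 1%:M.
  move=> Lx; have sL := pcore_sub_rker_mx_irr_pchar charF irrS.
  by have /rkerP[] := subsetP sL x Lx.
have rSQ' x : x \in Q^`(1)%g -> rS x = 1%:M.
  move=> Q'x; have Hx := subsetP (normal_sub nsQ'H) x Q'x.
  apply: val_submod_inj; rewrite -[rS x]mul1mx val_submodJ //.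
  have /rfix_mxP hfix : (val_submod (1%:M : 'M_(\rank S)) <= rfix_mx Psi Q^`(1)%g)%MS.
    apply: submx_trans (val_submodP _) _.
    exact: submx_trans sSW (capmxSr _ _).
  exact: hfix.
have memO (pi : nat_pred) x : x \in H -> pi.-elt x -> x \in 'O_pi(H).
  move=> Hx pix; rewrite (mem_normal_Hall (nilpotent_pcore_Hall pi nilH)) //.
  exact: pcore_normal.
have dec h : h \in H -> exists2 z, z \in Q & exists c, rS h = c *: rS z.
  move=> Hh; pose g := (h.`_q^')%g; have Hg : g \in H by rewrite groupX.
  have Hz : (h.`_q)%g \in H by rewrite groupX.
  have Hl : (g.`_ell)%g \in H by rewrite groupX.
  have Hk : (g.`_ell^')%g \in H by rewrite groupX.
  exists (h.`_q)%g; first by rewrite memO ?p_elt_constt.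
  exists (s (g.`_ell^')%g); rewrite -{1}(consttC q h) repr_mxM //.
  rewrite -/g -{1}(consttC ell g) repr_mxM // (rSL (g.`_ell)%g) ?memO ?p_elt_constt // mul1mx.
  rewrite (rSK (g.`_ell^')%g) ?mul_mx_scalar // memO // /p_elt.
  have q'g : q^'.-nat #[(g.`_ell^')%g].
    have : q^'.-elt g by apply: p_elt_constt.
    apply: pnat_dvd; exact: orderXdvd.
  have l'g : ell^'.-nat #[(g.`_ell^')%g] by apply: p_elt_constt.
  apply/pnatP => // r prr rd; rewrite inE /=.
  have := pnatPpi q'g (_ : r \in \pi(#[g.`_ell^'])%g); rewrite mem_primes prr order_gt0 rd => /(_ isT).
  have := pnatPpi l'g (_ : r \in \pi(#[g.`_ell^'])%g); rewrite mem_primes prr order_gt0 rd => /(_ isT).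
  by rewrite !inE => -> ->.
have com h h' : h \in H -> h' \in H -> rS h *m rS h' = rS h' *m rS h.
  move=> /dec[z Qz [c ->]] /dec[z' Qz' [c' ->]].
  rewrite -!scalemxAl -!scalemxAr !scalerA mulrC; congr (_ *: _).
  have [Hz Hz'] := (subsetP sQH z Qz, subsetP sQH z' Qz').
  have eM := repr_mxM rS (groupM Hz' Hz) (groupR Hz Hz').
  rewrite -!repr_mxM // (commgC z z') eM.
  by rewrite (rSQ' [~ z, z']%g) ?mulmx1 // derg1 mem_commg.
have rank1 : \rank S = 1%N.
  apply/eqP; rewrite -(der1_sub_rker (@group_closure_closed_field F gT H) irrS).
  rewrite gen_subG; apply/subsetP=> _ /imset2P[h h' Hh Hh' ->].
  apply/rkerP; split; first by rewrite groupR.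
  have Hr : [~ h, h']%g \in H by rewrite groupR.
  have e1 : rS (h' * h)%g *m rS [~ h, h']%g = rS (h' * h)%g.
    by rewrite -(repr_mxM rS (groupM Hh' Hh) Hr) -commgC !repr_mxM // com.
  have uh : rS (h' * h)%g \in unitmx by rewrite repr_mx_unit ?groupM.
  by rewrite -[rS [~ h, h']%g](mulKmx uh) e1 mulVmx.
have nzv : nz_row S != 0 by rewrite nz_row_eq0.
exists (nz_row S) => // h Hh.
have vS : (nz_row S <= S)%MS := nz_row_sub S.
have Sv : (S <= nz_row S)%MS.
  by rewrite -(geq_leqif (mxrank_leqif_sup vS)) rank1 rank_rV nzv.
have : (nz_row S *m Psi h <= nz_row S)%MS.
  by apply: submx_trans Sv; apply: submx_trans (mxmoduleP modS h Hh); apply: submxMr.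
by case/sub_rVP=> c ->; exists c.
Qed.

(* [mu] is a faithful linear character of <[y]>, extended trivially to K. *)
Lemma exists_twist_char (K : {group gT}) y q :
    prime q -> q != ell -> #[y]%g = q -> y \in 'C(K)%g -> coprime #|K| q ->
  exists mu : gT -> F,
    [/\ {in K <*> <[y]> &, {morph mu : a b / (a * b)%g >-> a * b}},
        {in K <*> <[y]>, forall x, mu x != 0}, mu y != 1
      & {in K <*> <[y]>, forall x, mu x != 1 ->
           exists j, (x ^+ #|K| = y ^+ j)%g /\ ~~ (q %| j)%N}].
Proof.
move=> prq nql oy cKy coKq.
have [eta etaq eta1] := exists_root_of_unity_neq1 prq nql.
have KyE : (K <*> <[y]> = K * <[y]>)%g.
  by rewrite norm_joinEr // cents_norm // cycle_subG.
have ex (x : gT) : exists kj : gT * nat, x \in K <*> <[y]> -> kj.1 \in K /\ x = (kj.1 * y ^+ kj.2)%g.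
  have [| _] := boolP (x \in K <*> <[y]>); last by exists (1%g, 0%N).
  by rewrite KyE => /mulsgP[k _ Kk /cycleP[j ->] ->]; exists (k, j).
have [f hf] := fin_all_exists ex.
have tiK j : (y ^+ j)%g \in K -> (q %| j)%N.
  move=> Kyj; have tiKy : K :&: <[y]> = 1%g by rewrite coprime_TIg // -orderE oy.
  have : (y ^+ j)%g \in K :&: <[y]> by rewrite inE Kyj mem_cycle.
  by rewrite tiKy inE -order_dvdn oy.
have etaE i j : (i = j %[mod q])%N -> eta ^+ i = eta ^+ j.
  by move=> eij; rewrite -(expr_mod i etaq) eij expr_mod.
have cy k j : k \in K -> commute k (y ^+ j)%g.
  by move=> Kk; apply/commuteX/commute_sym/(centP cKy).
have uniqj k k' i j : k \in K -> k' \in K -> (k * y ^+ i = k' * y ^+ j)%g -> eta ^+ i = eta ^+ j.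
  move=> Kk Kk' e; wlog leij : i j k k' Kk Kk' e / (i <= j)%N.
    by move=> th; case: (leqP i j) => [| /ltnW] le; [apply: (th _ _ k k') | apply/esym/(th _ _ k' k)].
  have : (y ^+ (j - i))%g \in K.
    have -> : (y ^+ (j - i) = k'^-1 * k)%g.
      by apply: (mulIg (y ^+ i)%g); rewrite -expgD subnK // -mulgA e mulKg.
    by rewrite groupM ?groupV.
  by move/tiK => d; apply/etaE/eqP; rewrite eq_sym eqn_mod_dvd.
pose mu x := eta ^+ (f x).2.
have muE k j : k \in K -> mu (k * y ^+ j)%g = eta ^+ j.
  move=> Kk; have Kykj : (k * y ^+ j)%g \in K <*> <[y]>.
    by rewrite KyE mem_mulg ?mem_cycle.
  by have [Kf ef] := hf _ Kykj; apply: uniqj Kf Kk _; rewrite -ef.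
exists mu; split.
- move=> a b Da Db; have [Ka ea] := hf a Da; have [Kb eb] := hf b Db.
  have eab : (a * b = (f a).1 * (f b).1 * y ^+ ((f a).2 + (f b).2))%g.
    rewrite {1}ea {1}eb expgD !mulgA; congr (_ * _)%g.
    by rewrite -!mulgA; congr (_ * _)%g; rewrite -(cy _ _ Kb).
  by rewrite eab muE ?groupM // exprD.
- move=> x _; rewrite expf_neq0 //; apply: contra_eq_neq etaq => ->.
  by rewrite expr0n gtn_eqF ?prime_gt0 // eq_sym oner_eq0.
- by rewrite -[y]mul1g -[y]expg1 muE ?group1 // expr1.
move=> x Kyx ntmu; have [Kf ef] := hf x Kyx.
exists ((f x).2 * #|K|)%N; split.
  by rewrite {1}ef expgMn; [rewrite expg_cardG // mul1g expgM | apply: cy].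
apply: contra ntmu; rewrite Euclid_dvdM // => /orP[/dvdnP[i ei] | ].
  by rewrite /mu ei mulnC exprM etaq expr1n.
by move: coKq; rewrite coprime_sym prime_coprime // => /negPf->.
Qed.

Definition eigen_mx (D : {set gT}) e (t : gT -> 'M[F]_e) (s : gT -> F) : 'M[F]_e :=
  (\bigcap_(x in D) kermx (t x - (s x)%:M))%MS.

Lemma eigen_mxP (D : {set gT}) e (t : gT -> 'M[F]_e) (s : gT -> F) m (V : 'M_(m, e)) :
  reflect {in D, forall x, V *m t x = s x *: V} (V <= eigen_mx D t s)%MS.
Proof.
apply: (iffP sub_bigcapmxP) => hV x Dx.
  have := hV x Dx; move/sub_kermxP; rewrite mulmxBr mul_mx_scalar => /eqP.
  by rewrite subr_eq0 => /eqP.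
by apply/sub_kermxP; rewrite mulmxBr mul_mx_scalar hV // subrr.
Qed.

Lemma hom_dim_linear (D : {set gT}) n1 e (r : gT -> 'M[F]_n1) (t : gT -> 'M[F]_e) (s : gT -> F) :
    n1 = 1%N -> {in D, forall x, r x = (s x)%:M} ->
  hom_dim D r t = \rank (eigen_mx D t s).
Proof.
move=> n1E; move: r; rewrite n1E => r rE; rewrite /hom_dim.
pose L : 'M[F]_(1 * e, e) := lin1_mx vec_mx; pose L' : 'M[F]_(e, 1 * e) := lin1_mx mxvec.
have LL' : L *m L' = 1%:M.
  by apply/row_matrixP=> i; rewrite !rowE mulmxA !mul_rV_lin1 /= vec_mxK mulmx1.
have L'L : L' *m L = 1%:M.
  by apply/row_matrixP=> i; rewrite !rowE mulmxA !mul_rV_lin1 /= mxvecK mulmx1.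
have s1 : (hom_mx D r t *m L <= eigen_mx D t s)%MS.
  apply/row_subP=> i; rewrite row_mul mul_rV_lin1 /=; apply/eigen_mxP=> x Dx.
  have := row_sub i (hom_mx D r t); rewrite hom_mxE => /mxhomP/(_ x Dx) <-.
  by rewrite rE // mul_scalar_mx.
have s2 : (eigen_mx D t s *m L' <= hom_mx D r t)%MS.
  apply/row_subP=> i; rewrite row_mul mul_rV_lin1 /= hom_mxE mxvecK; apply/mxhomP=> x Dx.
  have /eigen_mxP/(_ x Dx) -> := row_sub i (eigen_mx D t s).
  by rewrite rE // mul_scalar_mx.
apply/eqP; rewrite eqn_leq; apply/andP; split.
  rewrite -[X in (\rank X <= _)%N]mulmx1 -LL' mulmxA.
  exact: leq_trans (mxrankM_maxl _ _) (mxrankS s1).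
rewrite -[X in (\rank X <= _)%N]mulmx1 -L'L mulmxA.
exact: leq_trans (mxrankM_maxl _ _) (mxrankS s2).
Qed.

Lemma projective_stable_line (A H : {group gT}) e (w u : gT -> 'M[F]_e) :
    abelian A -> H \subset 'N(A) -> nilpotent H -> coprime #|A| #|H| ->
    (0 < e)%N -> #|A|%:R != 0 :> F -> projective A w -> projective H u ->
    projective_action A H w u ->
    scalar_commutant A w ->
    {in A, forall a, is_scalar_mx (w a) -> a = 1%g} ->
    {in 'Z(H) & A, forall y a, y != 1%g -> (a ^ y)%g = a -> a = 1%g} ->
  (e * e)%N = #|A| /\
  stable_line H u.
Proof.
move=> abelA nAH nilH coAH e_gt0 nzA projw proju actu centw nondeg freeZ.
have freew := twisted_basis_free e_gt0 projw abelA centw nondeg nzA.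
have fullw := twisted_basis_full e_gt0 projw abelA centw nondeg nzA.
have dimE := twisted_dim freew fullw; split=> //.
have coeH : coprime e #|H| by move: coAH; rewrite -dimE coprimeMl => /andP[].
have [Psi PsiE] := projective_coprime_lift e_gt0 coeH proju.
suff [v nzv hv] : stable_line H Psi.
  exists v => // h Hh; have [k nzk ek] := PsiE h Hh; have [c ec] := hv h Hh.
  by exists (k^-1 * c); rewrite -scalerA -ec ek -scalemxAr scalerA mulVf // scale1r.
have actPsi : {in H & A, forall h a, exists c, w a *m Psi h = c *: (Psi h *m w (a ^ h)%g)}.
  move=> h a Hh Aa; have [k _ ->] := PsiE h Hh; have [c ec] := actu h a Hh Aa.
  by exists c; rewrite -scalemxAr ec -scalemxAl !scalerA mulrC.
have [ellH | nellH] := boolP (ell.-group H).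
  have := rfix_pgroup_pchar charF Psi e_gt0 ellH (subxx H).
  case/rowV0Pn=> v /rfix_mxP hv nzv; exists v => // h Hh; exists 1.
  by rewrite scale1r hv.
have [q [prq qH nql]] : exists q, [/\ prime q, (q %| #|H|)%N & q != ell].
  have [/hasP[q] | /hasPn hq] := boolP (has (fun r => r != ell) (primes #|H|)).
    by rewrite mem_primes => /and3P[prq _ qH] nql; exists q.
  case/negP: nellH; apply/pgroupP=> r prr rH; rewrite inE /=.
  by have := hq r; rewrite mem_primes prr cardG_gt0 rH negbK => ->.
have [y Zy oy] : exists2 y, y \in 'Z(H) & #[y]%g = q.
  have ntQ := nilpotent_pcore_neq1 nilH prq qH.
  have ntZ := meet_center_nil nilH (pcore_normal q H) ntQ.
  have qZ : q.-group ('O_q(H) :&: 'Z(H)) := pgroupS (subsetIl _ _) (pcore_pgroup _ _).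
  have [_ qdZ _] := pgroup_pdiv qZ ntZ.
  by have [y /setIP[_ Zy] oy] := Cauchy prq qdZ; exists y.
pose pi : nat_pred := [pred r | (r != q) && (r != ell)].
pose K := 'O_pi(H)%G; pose D := (K <*> <[y]>)%G.
have sKH : K \subset H := pcore_sub _ _.
have [Hy cHy] := setIP Zy.
have sYH : <[y]> \subset H by rewrite cycle_subG.
have cKy : y \in 'C(K)%g by apply: subsetP (centS sKH) y cHy.
have piK : pi.-group K := pcore_pgroup _ _.
have coKq : coprime #|K| q.
  apply: pnat_coprime piK _; by rewrite pnatE // !inE /= eqxx.
have sDH : D \subset H by rewrite join_subG sKH.
have sYD : <[y]> \subset D by rewrite joing_subr.
have [mu [muM nzmu muy mustab]] := exists_twist_char prq nql oy cKy coKq.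
have F'D : [pchar F]^'.-group D.
  rewrite /= norm_joinEr; last by rewrite cents_norm // cycle_subG.
  rewrite pgroupM; apply/andP; split.
    apply: sub_in_pnat piK => r _; rewrite !inE => /andP[_ nr]; apply: contra nr => cr.
    by have := pcharf_eq charF r; rewrite inE cr => /esym/eqP->.
  rewrite /pgroup -orderE oy pnatE // inE /=; apply: contra nql => cr.
  by move: cr; rewrite (pcharf_eq charF) inE.
have nAD := subset_trans sDH nAH.
(* If mu x <> 1, the power of [x] of exponent |K| is a nontrivial power of [y], which fixes no
   nontrivial element of A. *)
have stab : {in A & D, forall a x, a != 1%g -> (a ^ x)%g = a -> mu x = 1}.
  move=> a x Aa Dx nta fixa; apply/eqP/negPn/negP=> /(mustab x Dx)[j [ej nqj]].
  case/eqP: nta; apply: (freeZ (y ^+ j)%g a) => //; first by rewrite groupX.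
    by rewrite -order_dvdn oy.
  rewrite -ej; elim: #|K| => [|k IHk]; first by rewrite expg0 conjg1.
  by rewrite expgS conjgM fixa.
have [tau [nztau tauM]] := exists_semi_invariant nAD muM nzmu stab.
have uPsi : {in H, forall x, Psi x \in unitmx} by move=> x Hx; apply: repr_mx_unit.
have twist (B : {set gT}) : B \subset D -> y \in B ->
    hom_dim B Psi Psi = (hom_dim B Psi (fun x => mu x *: Psi x)).+1.
  move=> sBD By; have sBH := subset_trans sBD sDH.
  apply: (hom_dim_twist e_gt0 projw freew fullw (tau := tau)) => //.
  - exact: subset_trans sBD nAD.
  - by move=> x Bx; rewrite uPsi ?(subsetP sBH).
  - by move=> x a Bx; apply: actPsi; apply: (subsetP sBH).
  - by move=> x Bx; rewrite nzmu ?(subsetP sBD).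
  - by exists y.
  by move=> x a Bx Aa; apply: tauM => //; apply: (subsetP sBD).
pose t' x := mu x *: Psi x.
have Dy : y \in D by rewrite (subsetP sYD) ?cycle_id.
have mu1 : mu 1%g = 1.
  apply: (mulfI (nzmu _ (group1 D))); rewrite mulr1 -muM ?group1 //.
  by rewrite mulg1.
have repr' : mx_repr D t'.
  split=> [|x z Dx Dz]; first by rewrite /t' mu1 repr_mx1 scale1r.
  by rewrite /t' muM // repr_mxM ?(subsetP sDH) // -scalemxAl -scalemxAr scalerA.
pose U' := MxRepresentation repr'; pose U := subg_repr Psi sDH.
have same (B : {set gT}) : B \subset D -> hom_dim B U' U' = hom_dim B U U.
  move=> sBD; rewrite /hom_dim; apply: eqmx_rank.
  have e12 (v : 'rV_(e * e)) : (v <= hom_mx B U' U')%MS = (v <= hom_mx B U U)%MS.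
    rewrite !hom_mxE; apply/mxhomP/mxhomP => h x Bx; have := h x Bx; rewrite /= /t'.
      rewrite -scalemxAl -scalemxAr => /scalerI; apply.
      by rewrite nzmu // (subsetP sBD).
    by move=> ex; rewrite -scalemxAl ex -scalemxAr.
  by apply/andP; split; apply/rV_subP=> v; rewrite e12.
pose sD := DecSocleType (regular_repr F D).
have scalY (i : sD) : {in <[y]>, forall x, is_scalar_mx (irr_repr i x)}.
  move=> x Yx; have ZDx : x \in 'Z(D).
    apply: subsetP x Yx; rewrite cycle_subG inE Dy /=.
    exact: subsetP (centS sDH) y cHy.
  apply/is_scalar_mxP; exists (irr_mode i x).
  by apply: irr_center_scalar ZDx; apply: group_closure_closed_field.
have twD : hom_dim D U U = (hom_dim D U U').+1 := twist D (subxx D) Dy.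
have twY : hom_dim <[y]> U U = (hom_dim <[y]> U U').+1 := twist <[y]> sYD (cycle_id y).
have [i [di1 hi]] := linear_of_hom_defect F'D sYD scalY (same D (subxx D)) twD (same _ sYD) twY.
pose i0 : 'I_(irr_degree i) := Ordinal (irr_degree_gt0 i).
have sE x : irr_repr i x = (irr_repr i x i0 i0)%:M.
  move: i0 (irr_repr i x); rewrite di1 => j M.
  by rewrite [M]mx11_scalar !ord1 mxE eqxx.
pose s x := irr_repr i x i0 i0.
have {}sE x : irr_repr i x = (s x)%:M by apply: sE.
have sM : {in D &, {morph s : a b / (a * b)%g >-> a * b}}.
  move=> a b Da Db; have := repr_mxM (irr_repr i) Da Db.
  rewrite !sE -scalar_mxM => /matrixP/(_ i0 i0).
  by rewrite !mxE eqxx.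
(* Multiplicities that differ by one are not both divisible by q. An eigenspace of the twist [U']
   for [s] is an eigenspace of [Psi] for mu^-1 s, so either case gives one for [Psi]. *)
have [s' s'M [E nqE EP]] : exists2 s' : gT -> F, {in D &, {morph s' : a b / (a * b)%g >-> a * b}} &
    exists2 E : 'M[F]_e, ~~ (q %| \rank E)%N &
      forall m (V : 'M_(m, e)), (V <= E)%MS <-> {in D, forall x, V *m Psi x = s' x *: V}.
  have d1 := hom_dim_linear U di1 (in1W sE).
  have d2 := hom_dim_linear U' di1 (in1W sE).
  have [nq | nq] : ~~ (q %| \rank (eigen_mx D U s))%N \/ ~~ (q %| \rank (eigen_mx D U' s))%N.
    have [qd | ] := boolP (q %| \rank (eigen_mx D U s))%N; last by left.
    have ndvd k : (q %| k)%N -> (q %| k.+1)%N -> False.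
      by move=> qk; rewrite -addn1 dvdn_addr // dvdn1 => /eqP q1; rewrite q1 in prq.
    right; apply/negP=> qd'; move: hi; rewrite d1 d2.
    by case=> hi; [apply: (ndvd _ qd'); rewrite -hi | apply: (ndvd _ qd); rewrite -hi].
  - exists s => //; exists (eigen_mx D U s) => // m V; by split=> /eigen_mxP.
  exists (fun x => (mu x)^-1 * s x).
    by move=> a b Da Db /=; rewrite muM // sM // invfM mulrACA.
  exists (eigen_mx D U' s) => // m V; split.
    move/eigen_mxP=> h x Dx; rewrite -scalerA -(h x Dx) /= /t' -scalemxAr scalerA.
    by rewrite mulVf ?nzmu // scale1r.
  move=> h; apply/eigen_mxP=> x Dx; rewrite /= /t' -scalemxAr h // !scalerA.
  by rewrite mulrA divff ?nzmu // mul1r.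
have EPsi : {in D, forall x, E *m Psi x = s' x *: E} by apply/EP.
(* H is the product of K, which is scalar on [E], and of O_pi'(H), which centralises D and so
   preserves its eigenspaces. *)
have modE : mxmodule Psi E.
  have DE : ('O_pi(H) * 'O_pi^'(H))%g = H := dprodW (nilpotent_pcoreC pi nilH).
  have cKM : 'O_pi^'(H) \subset 'C(K).
    by have [_ _ cKM _] := dprodP (nilpotent_pcoreC pi nilH).
  apply/mxmoduleP=> h Hh; have : h \in ('O_pi(H) * 'O_pi^'(H))%g by rewrite DE.
  case/mulsgP=> k m Kk Mm -> {h Hh}.
  have Hk := subsetP sKH k Kk; have Hm := subsetP (pcore_sub _ _) m Mm.
  have cDm : m \in 'C(D)%g.
    rewrite /= centY inE (subsetP cKM) //= cent_cycle; apply/cent1P.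
    by apply/commute_sym/(centP cHy).
  rewrite repr_mxM // mulmxA EPsi ?(subsetP (joing_subl _ _)) // -scalemxAl.
  apply: scalemx_sub; apply/EP=> x Dx; have Hx := subsetP sDH x Dx.
  have eM := repr_mxM Psi Hm Hx; have eM' := repr_mxM Psi Hx Hm.
  rewrite -mulmxA -eM (centP cDm x Dx) eM' mulmxA EPsi // scalemxAl //.
apply: (stable_line_of_rank (q := q) (E := E) (s := s')) => // x Kx.
by apply: EPsi; rewrite (subsetP (joing_subl _ _)).
Qed.

(** In characteristic p the commutator form takes p-power roots of unity as values, that is, only 1.
    Every [w a] would then commute with all the others and be scalar, forcing A = 1. *)
Lemma pgroup_card_unit (A : {group gT}) (p e : nat) (w : gT -> 'M[F]_e) :
    abelian A -> p.-group A -> prime p -> (0 < e)%N -> projective A w ->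
    scalar_commutant A w ->
    {in A, forall a, is_scalar_mx (w a) -> a = 1%g} ->
    A :!=: 1%g ->
  #|A|%:R != 0 :> F.
Proof.
move=> abelA pA prp e_gt0 projw centw nondeg; apply: contraNneq => A0.
have [n cA] := p_natP pA.
have pF : p \in [pchar F].
  rewrite inE prp /=; move/eqP: A0; rewrite cA natrX expf_eq0.
  by case/andP.
have [c [cE c_neq0]] := commutator_form e_gt0 projw abelA.
have cM := formM e_gt0 projw cE.
have c1 b : b \in A -> c 1%g b = 1.
  move=> Ab; apply: (mulfI (c_neq0 1%g b (group1 A) Ab)).
  by rewrite -cM ?group1 // mulg1 mulr1.
apply/eqP/trivgP/subsetP=> a Aa; apply/set1P/nondeg => //; apply: centw => b Ab.
rewrite cE //; suff -> : c a b = 1 by rewrite scale1r.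
have cX k : c (a ^+ k)%g b = c a b ^+ k.
  elim: k => [|k IHk]; first by rewrite expg0 c1.
  by rewrite expgS cM ?groupX // IHk exprS.
have : c a b ^+ #|A| = 1 by rewrite -cX expg_cardG // c1.
rewrite cA; elim: n {A0 cA} => [|n IHn]; first by rewrite expr1.
rewrite expnSr exprM => e1; apply: IHn.
have : ((c a b ^+ (p ^ n)) - 1) ^+ p = 0.
  by rewrite -(pFrobenius_autE pF) pFrobenius_autB_comm ?pFrobenius_aut1 ?pFrobenius_autE ?e1 ?subrr //; apply: commr1.
by move/eqP; rewrite expf_eq0 => /andP[_]; rewrite subr_eq0 => /eqP.
Qed.

(** Irreducibility and faithfulness supply coprimality and freeness. If p divided |H|, then O_p(H)
    would centralise a nontrivial H-invariant subgroup of A, hence A. The fixed points of a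
    nontrivial central y form an H-invariant subgroup different from A, hence trivial. *)
Lemma faithful_stable_line (A H : {group gT}) (p e : nat) (w u : gT -> 'M[F]_e) :
    abelian A -> p.-group A -> prime p -> A :!=: 1%g ->
    H \subset 'N(A) -> nilpotent H -> 'C_H(A) = 1%g ->
    (forall D : {group gT}, D \subset A -> H \subset 'N(D) -> D :=: 1%g \/ D :=: A) ->
    (0 < e)%N -> projective A w -> projective H u ->
    projective_action A H w u ->
    scalar_commutant A w ->
    {in A, forall a, is_scalar_mx (w a) -> a = 1%g} ->
  (e %| #|A|)%N /\
  stable_line H u.
Proof.
move=> abelA pA prp ntA nAH nilH faithH irrA e_gt0 projw proju actu centw nondeg.
have nzA := pgroup_card_unit abelA pA prp e_gt0 projw centw nondeg ntA.
have coAH : coprime #|A| #|H|.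
  apply: (pnat_coprime pA); apply/pgroupP=> r prr rH; rewrite inE /=.
  apply/negP=> /eqP er; rewrite {}er in prr rH.
  have ntP := nilpotent_pcore_neq1 nilH prr rH.
  have sPH : 'O_p(H) \subset H := pcore_sub _ _.
  have nAP := subset_trans sPH nAH.
  have ntC := pgroup_cent_neq1 pA (pcore_pgroup p H) nAP ntA.
  have nCH : H \subset 'N('C_A('O_p(H))).
    by rewrite normsI // norms_cent // gFnorm.
  have [C1 | CA] := irrA _ (subsetIl A _) nCH; first by rewrite C1 eqxx in ntC.
  case/negP: ntP; rewrite -subG1 -faithH subsetI sPH centsC -{1}CA; exact: subsetIr.
have [|dimE ex] := projective_stable_line abelA nAH nilH coAH e_gt0 nzA projw proju actu centw nondeg.
  move=> y a /setIP[Hy cHy] Aa nty fixa.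
  have nCH : H \subset 'N('C_A[y]).
    rewrite normsI // -cent_cycle norms_cent //.
    by rewrite cents_norm // centsC cycle_subG.
  have Ca : a \in 'C_A[y].
    by rewrite inE Aa; apply/cent1P/commgP/conjg_fixP.
  have [C1 | CA] := irrA _ (subsetIl A _) nCH.
    by move: Ca; rewrite /= C1 => /set1P.
  have : y \in 'C_H(A).
    rewrite inE Hy /=; apply/centP=> b; rewrite -{1}CA => /setIP[_ /cent1P cyb].
    exact/commute_sym.
  by rewrite faithH => /set1P y1; rewrite y1 eqxx in nty.
by split=> //; rewrite -dimE dvdn_mulr.
Qed.

End StableLine.

(** * Scalar elements and projective representations of quotients *)

Section ProjectiveScalars.

Variables (F : closedFieldType) (gT : finGroupType).

Lemma unit_scalar_neq0 e (x : F) : (0 < e)%N -> (x%:M : 'M[F]_e) \in unitmx -> x != 0.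
Proof.
move=> e_gt0 ux; have := unitmx_neq0 e_gt0 ux; apply: contraNneq => ->.
by rewrite raddf0.
Qed.

Lemma scalar_conj e (M1 M2 U : 'M[F]_e) c : (0 < e)%N ->
    M1 \in unitmx -> U \in unitmx -> is_scalar_mx M1 -> M1 *m U = c *: (U *m M2) ->
  is_scalar_mx M2.
Proof.
move=> e_gt0 uM uU /is_scalar_mxP[x e1]; rewrite {}e1 in uM *.
have nzx := unit_scalar_neq0 e_gt0 uM.
rewrite mul_scalar_mx => e2; have nzc : c != 0.
  apply: contraTneq nzx => c0; move: e2; rewrite c0 scale0r => /eqP.
  by rewrite scaler_eq0 (negPf (unitmx_neq0 e_gt0 uU)) orbF negbK.
apply/is_scalar_mxP; exists (c^-1 * x).
have /(congr1 (fun X => c^-1 *: (invmx U *m X))) := e2.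
rewrite -!scalemxAr mulVmx // mulKmx // !scalerA mulVf // scale1r => <-.
by rewrite scalemx1.
Qed.

Lemma projective_conj (H : {group gT}) e (u : gT -> 'M[F]_e) :
    (0 < e)%N -> projective H u ->
  {in H &, forall h a, exists c, u a *m u h = c *: (u h *m u (a ^ h)%g)}.
Proof.
move=> e_gt0 proju h a Hh Ha; have [_ uM] := proju.
have [c ec] := uM a h Ha Hh; have [c' ec'] := uM h (a ^ h)%g Hh (groupJ Ha Hh).
have nzc' := projective_coef_neq0 e_gt0 proju Hh (groupJ Ha Hh) ec'.
exists (c / c'); rewrite ec ec' -conjgC scalerA.
by rewrite -mulrA mulVf // mulr1.
Qed.

Lemma scal_ker_group_set (H : {group gT}) e (u : gT -> 'M[F]_e) :
  (0 < e)%N -> projective H u -> group_set [set a in H | is_scalar_mx (u a)].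
Proof.
move=> e_gt0 proju; apply/group_setP; split.
  by rewrite inE group1 (projective1 proju).
move=> a b; rewrite !inE => /andP[Ha /is_scalar_mxP[x ea]] /andP[Hb /is_scalar_mxP[y eb]].
have [_ uM] := proju; rewrite groupM //=; have [c ec] := uM a b Ha Hb.
have nzc := projective_coef_neq0 e_gt0 proju Ha Hb ec.
apply/is_scalar_mxP; exists (c^-1 * (x * y)).
move: ec; rewrite ea eb -scalar_mxM => /(congr1 ( *:%R c^-1)).
by rewrite scalerA mulVf // scale1r => <-; rewrite scale_scalar_mx.
Qed.

Lemma scal_ker_norm (A H : {group gT}) e (w u : gT -> 'M[F]_e) : (0 < e)%N ->
    H \subset 'N(A) -> projective A w -> projective H u -> projective_action A H w u ->
  H \subset 'N([set a in A | is_scalar_mx (w a)]).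
Proof.
move=> e_gt0 nAH projw proju actu; apply/subsetP=> h Hh; rewrite inE.
apply/subsetP=> _ /imsetP[a + ->]; rewrite !inE => /andP[Aa sa].
rewrite memJ_norm ?(subsetP nAH) // Aa /=; have [c ec] := actu h a Hh Aa.
exact: scalar_conj e_gt0 (projw.1 a Aa) (proju.1 h Hh) sa ec.
Qed.

Lemma exists_section (B M : {group gT}) :
    B \subset 'N(M) ->
  exists r : coset_of M -> gT, {in (B / M)%g, forall x, r x \in B /\ coset M (r x) = x}.
Proof.
move=> nMB; have ex (x : coset_of M) : exists b, x \in (B / M)%g -> b \in B /\ coset M b = x.
  have [/morphimP[b _ Bb ->] | _] := boolP (x \in (B / M)%g); last by exists 1%g.
  by exists b.
by have [r hr] := fin_all_exists ex; exists r.
Qed.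

(** Two representatives in B of a coset of M differ by an element of B and M, where [w] is
    scalar. *)
Lemma projective_section (B M : {group gT}) e (w : gT -> 'M[F]_e) (r : coset_of M -> gT) :
    (0 < e)%N -> B \subset 'N(M) -> projective B w ->
    {in B :&: M, forall n, is_scalar_mx (w n)} ->
    {in (B / M)%g, forall x, r x \in B /\ coset M (r x) = x} ->
  {in B, forall a, exists2 c, c != 0 & w (r (coset M a)) = c *: w a}.
Proof.
move=> e_gt0 nMB projw scalw hr a Ba; have [uw wM] := projw.
have BMa : coset M a \in (B / M)%g by apply: mem_quotient.
have [Br er] := hr _ BMa; set b := r _ in Br er *.
have Mab : (a^-1 * b)%g \in M.
  have [nMa nMb] := (subsetP nMB a Ba, subsetP nMB b Br).
  apply: coset_idr; first by rewrite groupM ?groupV.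
  by rewrite morphM ?groupV //= morphV //= er mulVg.
have Bab : (a^-1 * b)%g \in B by rewrite groupM ?groupV.
have [|x ex] := is_scalar_mxP (scalw (a^-1 * b)%g _); first by rewrite inE Bab.
have [c ec] := wM a (a^-1 * b)%g Ba Bab.
have nzc := projective_coef_neq0 e_gt0 projw Ba Bab ec.
have nzx : x != 0 by apply: (unit_scalar_neq0 e_gt0); rewrite -ex uw.
move: ec; rewrite ex mulKVg mul_mx_scalar => /(congr1 ( *:%R c^-1)).
rewrite !scalerA mulVf // scale1r => <-; exists (c^-1 * x) => //.
by rewrite mulf_neq0 // invr_eq0.
Qed.

Lemma projective_quotient (B M : {group gT}) e (w : gT -> 'M[F]_e) (r : coset_of M -> gT) :
    (0 < e)%N -> B \subset 'N(M) -> projective B w ->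
    {in B :&: M, forall n, is_scalar_mx (w n)} ->
    {in (B / M)%g, forall x, r x \in B /\ coset M (r x) = x} ->
  projective (B / M)%g (fun x => w (r x)).
Proof.
move=> e_gt0 nMB projw scalw hr; have [uw wM] := projw; split=> [x BMx | x y BMx BMy].
  by have [Br _] := hr x BMx; apply: uw.
have [[Bx ex] [By ey]] := (hr x BMx, hr y BMy).
have [c ec] := wM _ _ Bx By.
have [k nzk ek] := projective_section e_gt0 nMB projw scalw hr (groupM Bx By).
have exy : coset M (r x * r y)%g = (x * y)%g.
  by rewrite morphM ?(subsetP nMB) //= ex ey.
exists (c / k); rewrite ec -exy ek scalerA -mulrA mulVf ?mulr1 //.
Qed.

End ProjectiveScalars.

(** * Removing the kernel of the action on the chief factor *)

Section QuotientAction.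

Variables (F : closedFieldType) (ell : nat) (charF : ell \in [pchar F]).
Variable gT : finGroupType.

(* H acts on A / N with kernel N1 / N, and u is scalar on N1: otherwise pick *)
(* M > Z minimal among the normal subgroups of H between the scalar part Z   *)
(* of N1 and N1; then [M, H] <= Z, so the character of A / N by which u x    *)
(* commutes with w is H-invariant for x in M, hence trivial.                 *)
Lemma scalar_on_kernel (N A H N1 : {group gT}) e (w u : gT -> 'M[F]_e) :
    N \subset A -> N <| H -> H \subset 'N(A) -> nilpotent (H / N) ->
    irreducible_section N A H ->
    ~~ ([~: A, H] \subset N) ->
    (0 < e)%N -> projective A w -> projective H u ->
    projective_action A H w u ->
    {in N, forall n, is_scalar_mx (w n)} -> {in N, forall n, is_scalar_mx (u n)} ->
    scalar_commutant A w ->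
    N \subset N1 -> N1 <| H -> [~: A, N1] \subset N ->
  {in N1, forall x, is_scalar_mx (u x)}.
Proof.
move=> sNA nsNH nAH nilHN irrA ntAH e_gt0 projw proju actu scalw scalu centw sNN1 nsN1H cAN1.
have [[uw wM] [uu uM]] := (projw, proju).
pose Z0 := Group (scal_ker_group_set e_gt0 proju).
have [sN1H nN1H] := andP nsN1H; have [sNH _] := andP nsNH.
have nZ0H : H \subset 'N(Z0).
  exact: (scal_ker_norm e_gt0 (normG H) proju proju (projective_conj e_gt0 proju)).
pose Z := (N1 :&: Z0)%G.
have nsZH : Z <| H by rewrite /normal (subset_trans (subsetIl _ _)) //= normsI.
have sNZ : N \subset Z.
  by rewrite subsetI sNN1; apply/subsetP=> x Nx; rewrite inE (subsetP sNH) ?scalu.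
suff <- : Z :=: N1 by move=> x /setIP[_]; rewrite inE => /andP[].
apply/eqP/negPn/negP=> nZN1.
have pZN1 : Z \proper N1 by rewrite properEneq nZN1 subsetIl.
pose P (M : {set gT}) := [&& group_set M, Z \proper M, M \subset N1 & H \subset 'N(M)].
have PN1 : P N1 by rewrite /P groupP pZN1 subxx nN1H.
have [M0 /minsetP[/and4P[gM pZM sMN1 nMH] minM] _] := minset_exists PN1.
pose M := Group gM; have nsMH : M <| H by rewrite /normal (subset_trans sMN1).
have pL := nilpotent_quo_comm_proper nsNH nilHN sNZ nsZH nsMH pZM.
have cMZ : [~: M, H] \subset Z.
  suff -> : Z :=: [~: M, H] <*> Z by apply: joing_subl.
  apply/eqP; rewrite eqEsubset joing_subr /=; apply/negPn/negP=> nsub.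
  have := minM ([~: M, H] <*> Z) _ (proper_sub pL).
  suff PL : P ([~: M, H] <*> Z) by move=> /(_ PL) eL; rewrite eL properxx in pL.
  rewrite /P groupP /= (subset_trans (proper_sub pL)) // properE joing_subr nsub /=.
  by rewrite normsY ?(normal_norm nsZH) // normsR // normG.
case/negP: (proper_subn pZM); apply/subsetP=> x Mx.
have N1x := subsetP sMN1 x Mx; have Hx := subsetP sN1H x N1x.
rewrite inE N1x inE Hx /=; apply: centw => a0 Aa0.
(* As [A, N1] lies in N, [w (a ^ x)] is a multiple of [w a], so [u x] commutes with [w a] up to a
   scalar. *)
have xi a : a \in A -> exists2 k, k != 0 & w a *m u x = k *: (u x *m w a).
  move=> Aa; have [c ec] := actu x a Hx Aa.
  have Ax := norm_memJ nAH Hx Aa.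
  have Nax : (a^-1 * a ^ x)%g \in N by apply: subsetP cAN1 _ (mem_commg Aa N1x).
  have Aax := subsetP sNA _ Nax.
  have [y ey] := is_scalar_mxP (scalw _ Nax).
  have [c' ec'] := wM _ _ Aa Aax.
  have nzc' := projective_coef_neq0 e_gt0 projw Aa Aax ec'.
  rewrite mulKVg ey mul_mx_scalar in ec'.
  have e1 : w a *m u x = (c * (c'^-1 * y)) *: (u x *m w a).
    have ewx : w (a ^ x)%g = (c'^-1 * y) *: w a.
      by rewrite -scalerA ec' scalerA mulVf // scale1r.
    by rewrite ec ewx -scalemxAr scalerA.
  exists (c * (c'^-1 * y)) => //; apply: contraTneq (uw a Aa) => k0.
  move: e1; rewrite k0 scale0r => /(congr1 (fun X => X *m invmx (u x))).
  rewrite mulmxK ?uu // mul0mx => ->; apply/negP=> /(unitmx_neq0 e_gt0).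
  by rewrite eqxx.
pose D := [set a in A | w a *m u x == u x *m w a].
have gD : group_set D.
  apply/group_setP; split.
    rewrite inE group1; have /is_scalar_mxP[y ->] := projective1 projw.
    by rewrite scalar_mxC eqxx.
  move=> a b; rewrite !inE => /andP[Aa /eqP ca] /andP[Ab /eqP cb].
  have [c ec] := wM a b Aa Ab; have nzc := projective_coef_neq0 e_gt0 projw Aa Ab ec.
  rewrite groupM //=; apply/eqP/(scalerI nzc).
  by rewrite scalemxAl -ec -mulmxA cb mulmxA ca -mulmxA ec -scalemxAr.
(* As [M, H] lies in [Z], where [u] is scalar, conjugation by [u h] shows that [a] and [a ^ h] have
   the same scalar. *)
have key h a : h \in H -> a \in A -> exists2 k, w a *m u x = k *: (u x *m w a) &
    w (a ^ h)%g *m u x = k *: (u x *m w (a ^ h)%g).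
  move=> Hh Aa; have [k nzk ek] := xi a Aa; exists k => //.
  have Ax := norm_memJ nAH Hh Aa.
  have [c ec] := actu h a Hh Aa; have [c' ec'] := projective_conj e_gt0 proju Hh Hx.
  have Zxx : (x^-1 * x ^ h)%g \in Z by apply: subsetP cMZ _ (mem_commg Mx Hh).
  have := Zxx; rewrite inE => /andP[_]; rewrite inE => /andP[Hxx /is_scalar_mxP[y ey]].
  have [d ed] := uM _ _ Hx Hxx; have nzd := projective_coef_neq0 e_gt0 proju Hx Hxx ed.
  rewrite mulKVg ey mul_mx_scalar in ed.
  have nz (b g : gT) (c0 : F) (X : 'M[F]_e) (uX : u g \in unitmx) (Y : 'M_e) : Y \in unitmx ->
      Y *m u g = c0 *: X -> c0 != 0.
    move=> uY; apply: contra_eq_neq => ->; rewrite scale0r.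
    by apply: (unitmx_neq0 e_gt0); rewrite unitmx_mul uY.
  have nzc := nz a h _ _ (uu h Hh) _ (uw a Aa) ec.
  have nzc' := nz a h _ _ (uu h Hh) _ (uu x Hx) ec'.
  have nzy : y != 0 by apply: (unit_scalar_neq0 e_gt0); rewrite -ey uu.
  pose z := c' * (d^-1 * y).
  have nzz : z != 0 by rewrite !mulf_neq0 ?invr_eq0.
  have ez : u x *m u h = z *: (u h *m u x).
    have -> : u x *m u h = c' *: (u h *m u (x ^ h)%g) by [].
    have -> : u (x ^ h)%g = (d^-1 * y) *: u x.
      by rewrite -scalerA ed scalerA mulVf // scale1r.
    by rewrite -scalemxAr scalerA.
  have e1 : w a *m u x *m u h = (z * c) *: (u h *m (w (a ^ h)%g *m u x)).
    rewrite -mulmxA ez -scalemxAr (mulmxA (w a)) ec -scalemxAl scalerA.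
    by rewrite -!mulmxA.
  have e2 : (u x *m w a) *m u h = (z * c) *: (u h *m (u x *m w (a ^ h)%g)).
    rewrite -mulmxA ec -scalemxAr (mulmxA (u x)) ez -scalemxAl scalerA mulrC.
    by rewrite -!mulmxA.
  move: (congr1 (fun X => X *m u h) ek); rewrite -scalemxAl e1 e2 scalerA [k * _]mulrC -[(z * c * k) *: _]scalerA.
  have nzzc : z * c != 0 by rewrite mulf_neq0.
  move/(scalerI nzzc); rewrite scalemxAr => /(congr1 (mulmx (invmx (u h)))).
  by rewrite !mulKmx ?uu.
have nDH : H \subset 'N(Group gD).
  apply/subsetP=> h Hh; rewrite inE; apply/subsetP=> _ /imsetP[a Da ->].
  move: Da; rewrite !inE => /andP[Aa /eqP ca]; have [k ek ekh] := key h a Hh Aa.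
  rewrite memJ_norm ?(subsetP nAH) // Aa /= ekh.
  suff -> : k = 1 by rewrite scale1r.
  have uxa : u x *m w a \in unitmx by rewrite unitmx_mul uu ?uw.
  apply: (unit_scale_inj e_gt0 uxa).
  by rewrite scale1r -ek.
have sND : N \subset Group gD.
  apply/subsetP=> n Nn; rewrite inE (subsetP sNA) //=.
  by have /is_scalar_mxP[y ->] := scalw n Nn; rewrite scalar_mxC eqxx.
have sDA : Group gD \subset A by apply/subsetP=> a; rewrite inE => /andP[].
(* The scalar is thus 1 on [A, H]. Since [D] contains N and [A, H] does not lie in N, irreducibility
   makes [D] all of A. *)
have cD : [~: A, H] \subset Group gD.
  rewrite gen_subG; apply/subsetP=> _ /imset2P[a h Aa Hh ->].
  have Ax := norm_memJ nAH Hh Aa.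
  have Aax : [~ a, h]%g \in A by rewrite commgEl groupM ?groupV.
  have [k ek ekh] := key h a Hh Aa; rewrite inE Aax /=; apply/eqP.
  have [c ec] := wM a _ Aa Aax; have nzc := projective_coef_neq0 e_gt0 projw Aa Aax ec.
  have eah : (a * [~ a, h])%g = (a ^ h)%g by rewrite commgEl mulKVg.
  rewrite eah in ec; apply: (can_inj (mulKmx (uw a Aa))).
  rewrite !mulmxA ec -scalemxAl ekh ek -scalemxAl -mulmxA ec -scalemxAr.
  by rewrite !scalerA mulrC.
have [DN | DA] := irrA _ sND sDA nDH; first by rewrite DN (negPf ntAH) in cD.
have : a0 \in Group gD by rewrite DA.
by rewrite inE => /andP[_ /eqP].
Qed.

(** The scalar part [Rad] of A is N or A. If it is A, every matrix commutes with the action, so e =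
    1. If it is N, dividing by the kernel [N1] of H on A/N leads to the faithful case, since [u] is
    scalar on [N1] and A meets [N1] in N. *)
Lemma quotient_stable_line (N A H : {group gT}) (p e : nat) (w u : gT -> 'M[F]_e) :
    N <| A -> N <| H -> H \subset 'N(A) -> H :&: A \subset N ->
    abelian (A / N) -> p.-group (A / N) -> prime p -> nilpotent (H / N) ->
    irreducible_section N A H ->
    ~~ ([~: A, H] \subset N) ->
    (0 < e)%N -> projective A w -> projective H u ->
    projective_action A H w u ->
    {in N, forall n, is_scalar_mx (w n)} -> {in N, forall n, is_scalar_mx (u n)} ->
    scalar_commutant A w ->
  (e %| #|A : N|)%N /\
  stable_line H u.
Proof.
move=> nsNA nsNH nAH tiHA abAN pAN prp nilHN irrA ntAH e_gt0 projw proju actu scalw scalu centw.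
have [[uw wM] [uu uM]] := (projw, proju).
have [[sNA nNA] [sNH nNH]] := (andP nsNA, andP nsNH).
have gR := scal_ker_group_set e_gt0 projw; pose Rad := Group gR.
have sRA : Rad \subset A by apply/subsetP=> a; rewrite inE => /andP[].
have sNR : N \subset Rad by apply/subsetP=> n Nn; rewrite inE (subsetP sNA) ?scalw.
have nRH : H \subset 'N(Rad) := scal_ker_norm e_gt0 nAH projw proju actu.
have [RN | RA] := irrA _ sNR sRA nRH; last first.
  have sc (f : 'M[F]_e) : is_scalar_mx f.
    apply: centw => a; rewrite -RA inE => /andP[_ /is_scalar_mxP[x ->]].
    by rewrite scalar_mxC.
  have e1 : e = 1%N.
    case: (e) e_gt0 sc => // -[|k] _ // sc.
    have /is_scalar_mxP[x /matrixP/(_ ord0 ord_max)] := sc (delta_mx ord0 ord_max).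
    by rewrite !mxE !eqxx /= => /eqP; rewrite oner_eq0.
  split; first by rewrite e1 dvd1n.
  exists (const_mx 1).
    apply/eqP=> /rowP/(_ (Ordinal e_gt0)); rewrite !mxE => /eqP.
    by rewrite oner_eq0.
  by move=> h Hh; have /is_scalar_mxP[x ->] := sc (u h); exists x; rewrite mul_mx_scalar.
pose N1 := (H :&: coset N @*^-1 'C(A / N))%G.
have sN1H : N1 \subset H := subsetIl _ _.
have sNN1 : N \subset N1.
  by rewrite subsetI sNH -{1}(ker_coset N) kerE morphpreS // sub1G.
have nsN1H : N1 <| H.
  rewrite /normal sN1H normsI ?normG //.
  apply: subset_trans (morphpre_norm _ _); rewrite -sub_quotient_pre //.
  by rewrite norms_cent // quotient_norms.
have cAN1 : [~: A, N1] \subset N.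
  have nN1 := subset_trans sN1H nNH.
  rewrite -quotient_cents2 // centsC sub_quotient_pre // /N1 /=.
  exact: subsetIr.
have scal1 := scalar_on_kernel sNA nsNH nAH nilHN irrA ntAH e_gt0 projw proju actu scalw scalu centw sNN1 nsN1H cAN1.
have nN1A : A \subset 'N(N1) by rewrite -commg_subr (subset_trans cAN1).
have nN1H := normal_norm nsN1H.
have tiAN1 : A :&: N1 = N.
  apply/eqP; rewrite eqEsubset subsetI sNA sNN1 !andbT; apply: subset_trans tiHA.
  by rewrite setIC setSI.
have tiHN1 : H :&: N1 = N1 by apply/setIidPr.
have cardA : #|A / N1|%g = #|A : N| by rewrite card_quotient // -indexgI tiAN1.
have [ra hra] := exists_section nN1A; have [rh hrh] := exists_section nN1H.
have scalwI : {in A :&: N1, forall n, is_scalar_mx (w n)} by rewrite tiAN1.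
have scaluI : {in H :&: N1, forall n, is_scalar_mx (u n)} by rewrite tiHN1.
have projw' := projective_quotient e_gt0 nN1A projw scalwI hra.
have proju' := projective_quotient e_gt0 nN1H proju scaluI hrh.
have secw := projective_section e_gt0 nN1A projw scalwI hra.
have secu := projective_section e_gt0 nN1H proju scaluI hrh.
have ntAN1 : (A / N1)%G :!=: 1%g.
  rewrite trivg_card1 /= cardA -card_quotient // -trivg_card1 -subG1 quotient_sub1 //.
  by apply: contra ntAH => sAN; rewrite (subset_trans _ sAN) // commg_subl.
have [] := @faithful_stable_line F ell charF _ (A / N1)%G (H / N1)%G p e
  (fun x => w (ra x)) (fun x => u (rh x)) _ _ prp ntAN1 _ _ _ _ e_gt0 projw' proju' _ _ _.
- apply: sub_der1_abelian; apply: subset_trans sNN1; exact: der1_min.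
- by rewrite /pgroup /= cardA -card_quotient.
- exact: quotient_norms.
- by rewrite -(isog_nil (third_isog sNN1 nsNH nsN1H)) quotient_nil.
- apply/trivgP/subsetP=> _ /setIP[/morphimP[h nN1h Hh ->] cAh]; apply/set1P/coset_id.
  apply/setIP; split=> //; apply/morphpreP; split; first exact: subsetP nNH h Hh.
  apply/centP=> _ /morphimP[a nNa Aa ->].
  have nNh := subsetP nNH h Hh; have nN1a := subsetP nN1A a Aa.
  have /commgP/eqP cha := centP cAh _ (mem_quotient N1 Aa).
  have N1ha : [~ h, a]%g \in N1 by apply: coset_idr; rewrite ?groupR // morphR.
  have Nha : [~ h, a]%g \in N.
    rewrite -tiAN1 inE N1ha andbT commgEr groupM // memJ_norm ?groupV //.
    by rewrite (subsetP nAH).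
  by apply/commgP/eqP; rewrite -morphR //= coset_id.
- move=> D sDA nDH; pose D0 := (A :&: coset N1 @*^-1 D)%G.
  have sND0 : N \subset D0.
    rewrite subsetI sNA; apply: (subset_trans sNN1).
    by rewrite -{1}(ker_coset N1) kerE morphpreS // sub1G.
  have nD0H : H \subset 'N(D0).
    rewrite normsI //; apply: subset_trans (morphpre_norm _ _).
    by rewrite -sub_quotient_pre.
  have D0E : (D0 / N1)%g = D.
    rewrite [LHS]morphim_setIpre.
    exact/setIidPr.
  case: (irrA _ sND0 (subsetIl _ _) nD0H) => e0; [left | right].
    by apply/trivgP; rewrite -D0E e0 quotient_sub1 // (subset_trans sNN1) ?normG.
  by rewrite -D0E e0.
- move=> _ _ /morphimP[h nh Hh ->] /morphimP[a na Aa ->] /=.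
  rewrite -morphJ //; have Aah := norm_memJ nAH Hh Aa.
  have [k1 nzk1 ->] := secw a Aa; have [k2 nzk2 ->] := secu h Hh.
  have [k3 nzk3 ->] := secw _ Aah; have [c ec] := actu h a Hh Aa.
  exists (k1 * k2 * c / (k2 * k3)).
  rewrite -!scalemxAl -!scalemxAr !scalerA ec scalerA; congr (_ *: _).
  by field; rewrite ?nzk2 ?nzk3.
- move=> f hf; apply: centw => a Aa; have [k nzk ek] := secw a Aa.
  have := hf _ (mem_quotient N1 Aa); rewrite ek -scalemxAr -scalemxAl.
  exact: scalerI.
- move=> _ /morphimP[a na Aa ->] /=; have [k nzk ->] := secw a Aa.
  case/is_scalar_mxP=> x ex; have : a \in Rad.
    rewrite inE Aa; apply/is_scalar_mxP; exists (k^-1 * x).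
    by rewrite -scale_scalar_mx -ex scalerA mulVf // scale1r.
  by rewrite RN => Na; rewrite coset_id // (subsetP sNN1).
rewrite /= cardA => de [v nzv hv]; split=> //; exists v => // h Hh.
have [c ec] := hv _ (mem_quotient N1 Hh); have [k nzk ek] := secu h Hh.
exists (k^-1 * c); rewrite -scalerA -ec ek -scalemxAr scalerA mulVf // scale1r //.
Qed.

End QuotientAction.

(** * Invariant constituents and their extension *)

Section HomogeneousCoordinates.

Variables (F : closedFieldType) (gT : finGroupType).
Implicit Types (A N : {group gT}).

Lemma common_eigenvector (I : eqType) (s : seq I) n (T : I -> 'M[F]_n) m (V : 'M_(m, n)) :
    V != 0 -> {in s, forall x, (V *m T x <= V)%MS} ->
    {in s &, forall x y, V *m T x *m T y = V *m T y *m T x} ->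
  exists2 v : 'rV_n, v != 0 & (v <= V)%MS /\ {in s, forall x, exists c, v *m T x = c *: v}.
Proof.
elim: s m V => [|x s IHs] m V nzV stV comV.
  exists (nz_row V); first by rewrite nz_row_eq0.
  by split; [apply: nz_row_sub | move=> x; rewrite in_nil].
have xs : x \in x :: s by rewrite inE eqxx.
have ss y : y \in s -> y \in x :: s by move=> sy; rewrite inE sy orbT.
have [v [c [nzv sv ev]]] := stable_eigenvector nzV (stV x xs).
pose V' := (V :&: kermx (T x - c%:M))%MS.
have V'E k (w : 'M_(k, n)) : (w <= V')%MS <-> (w <= V)%MS /\ w *m T x = c *: w.
  rewrite sub_capmx; split.
    case/andP=> -> /sub_kermxP; rewrite mulmxBr mul_mx_scalar => /eqP.
    by rewrite subr_eq0 => /eqP.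
  by case=> -> ex /=; apply/sub_kermxP; rewrite mulmxBr mul_mx_scalar ex subrr.
have [sV'V eV'] : (V' <= V)%MS /\ V' *m T x = c *: V' by apply/V'E.
have nzV' : V' != 0.
  have : (v <= V')%MS by apply/V'E.
  by apply: contraTneq => ->; rewrite submx0.
have comV' y z k (w : 'M_(k, n)) : y \in x :: s -> z \in x :: s -> (w <= V)%MS ->
    w *m T y *m T z = w *m T z *m T y.
  by move=> sy sz /submxP[D ->]; rewrite -!mulmxA (mulmxA V) comV // !mulmxA.
have [| |w nzw [sw hw]] := IHs _ V' nzV'.
- move=> y sy; apply/V'E; split.
    by apply: submx_trans (submxMr _ sV'V) (stV y (ss y sy)).
  by rewrite (comV' _ _ _ _ (ss y sy) xs) // eV' -scalemxAl.
- by move=> y z sy sz; apply: comV'; rewrite ?ss.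
exists w => //; split; first exact: submx_trans sw sV'V.
move=> y; rewrite inE => /predU1P[-> | /hw//].
by have /V'E[_] := sw; exists c.
Qed.

(** The homomorphism with coordinates [v] in the basis of Hom_N(X, L) formed by the rows of [Y]. *)
Definition combi d m e (Y : 'M[F]_(e, d * m)) (v : 'rV_e) : 'M_(d, m) := vec_mx (v *m Y).

Lemma irr_span (N : {group gT}) d (X : mx_representation F N d) (M : 'M_d) :
  mx_irreducible X -> exists a : gT -> F, M = \sum_(x in N) a x *: X x.
Proof.
move/closed_abs_irr; rewrite /mx_absolutely_irreducible => /andP[_ full].
exact/envelop_mxP/submx_full.
Qed.

(** Evaluation from the tensor product of Hom_N(X, L) with X to L is bijective, so over N the module
    L is a sum of e copies of X. Through it any linear map [M] of Hom_N(X, L) is induced by some [g]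
    on L, and a coordinate gives a projection of L onto X. *)
Lemma homogeneous_coords (N A : {group gT}) d m (X : mx_representation F N d)
    (L : mx_representation F A m) (f0 : 'M_(d, m)) :
    N <| A -> mx_irreducible X -> mx_irreducible L ->
    {in A, forall a, conj_iso N X a} -> mxhom N X L f0 -> f0 != 0 ->
  exists e (Y : 'M[F]_(e, d * m)),
    [/\ [/\ m = (e * d)%N, (0 < e)%N & row_free Y],
        forall f, mxhom N X L f <-> exists v, f = combi Y v,
        forall k (Q : 'M_(m, k)), (forall v, combi Y v *m Q = 0) -> Q = 0,
        forall M : 'M_e, exists g : 'M_m, forall v, combi Y v *m g = combi Y (v *m M)
      & exists2 p : 'M_(m, d), mxhom N L X p & p != 0].
Proof.
move=> nsNA irrX irrL invX homf0 nzf0; have [sNA nNA] := andP nsNA.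
pose Y := row_base (hom_mx N X L); pose e := \rank (hom_mx N X L).
have freeY : row_free Y := row_base_free _.
have imY f : mxhom N X L f <-> exists v, f = combi Y v.
  rewrite -[f]mxvecK -hom_mxE -(eq_row_base (hom_mx N X L)) mxvecK.
  split=> [/submxP[v ev] | [v ->]]; first by exists v; rewrite /combi -ev mxvecK.
  by rewrite /combi vec_mxK submxMl.
have e_gt0 : (0 < e)%N.
  rewrite lt0n mxrank_eq0; apply: contraNneq nzf0 => Y0.
  by rewrite -(mxvec_eq0 f0) -submx0 -Y0 hom_mxE mxvecK.
have d_gt0 : (0 < d)%N by case/mx_irrP: irrX.
pose f i := combi Y (delta_mx 0 i).
pose B : 'M_(e * d, m) := \sum_(i < e) lin1_mx (mulmxr (f i) \o row i \o vec_mx).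
have BE (Z : 'M_(e, d)) : mxvec Z *m B = \sum_i row i Z *m f i.
  by rewrite /B mulmx_sumr; apply: eq_bigr => i _; rewrite mul_rV_lin1 /= mxvecK.
clearbody B.
have combiE v : combi Y v = \sum_i v 0 i *: f i.
  rewrite {1}[v]row_sum_delta /combi mulmx_suml linear_sum /=; apply: eq_bigr => i _.
  by rewrite -scalemxAl linearZ.
have B1 (v : 'rV_e) (y : 'rV_d) : mxvec (v^T *m y) *m B = y *m combi Y v.
  rewrite BE combiE mulmx_sumr; apply: eq_bigr => i _; rewrite -scalemxAr scalemxAl.
  congr (_ *m _); apply/rowP=> j; rewrite !mxE big_ord1 !mxE //.
have homf i : {in N, forall n, X n *m f i = f i *m L n}.
  by apply/mxhomP/imY; exists (delta_mx 0 i).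
have fE i : f i = combi Y (delta_mx 0 i) by [].
clearbody f.
have BX n Z : n \in N -> mxvec (Z *m X n) *m B = mxvec Z *m B *m L n.
  move=> Nn; rewrite !BE mulmx_suml; apply: eq_bigr => i _.
  by rewrite row_mul -!mulmxA homf.
have span_d (M : 'M_d) Z : mxvec Z *m B = 0 -> mxvec (Z *m M) *m B = 0.
  move=> Z0; have [a ->] := irr_span M irrX.
  rewrite mulmx_sumr [mxvec _]linear_sum /= mulmx_suml big1 // => n Nn.
  by rewrite -scalemxAr linearZ /= -scalemxAl BX // Z0 mul0mx scaler0.
(* The kernel is stable under right multiplication by all d by d matrices, by Burnside's theorem for
   X. This isolates each column of [Z], which is then a relation between the rows of [Y]. *)
have freeB : row_free B.
  rewrite -kermx_eq0; apply/rowV0P=> z /sub_kermxP.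
  rewrite -[z]vec_mxK; set Z := vec_mx z => Z0; apply/eqP; rewrite mxvec_eq0; apply/eqP.
  suff colZ j : (col j Z)^T = 0.
    by apply/matrixP=> i j; have /rowP/(_ i) := colZ j; rewrite !mxE.
  apply: (row_free_inj freeY); rewrite mul0mx; apply: (can_inj vec_mxK).
  rewrite linear0 -/(combi Y _); apply/row_matrixP=> k; rewrite row0 rowE -B1.
  rewrite trmxK colE -mulmxA mul_delta_mx; exact: span_d.
(* The image is an A-submodule: [f i *m L a], corrected by an intertwiner [W] from X to its
   conjugate, is again in Hom_N(X, L). *)
have fullB : row_full B.
  apply: (irr_module_full irrL); last first.
    have [v ev] := (imY f0).1 homf0; apply: contraNneq nzf0 => B0.
    apply/eqP/row_matrixP=> k; rewrite row0 rowE ev -B1 B0 mulmx0 //.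
  apply/mxmoduleP=> a Aa; apply/row_subP=> k; rewrite row_mul rowE -[delta_mx _ _]vec_mxK BE.
  rewrite mulmx_suml; apply: summx_sub => i _.
  have [W uW hW] := invX _ (groupVr Aa).
  have : mxhom N X L (W *m f i *m L a).
    apply/mxhomP=> n Nn; have Nna : (n ^ a^-1)%g \in N by rewrite memJ_norm ?groupV ?(subsetP nNA).
    have An := subsetP sNA n Nn; have Ana := subsetP sNA _ Nna.
    rewrite !mulmxA hW // -(mulmxA W) homf // -!mulmxA.
    have eL : (n ^ a^-1 * a = a * n)%g by rewrite conjgE invgK !mulgA mulgKV.
    by rewrite -!repr_mxM // eL.
  case/imY=> v ev; rewrite -mulmxA; have -> : f i *m L a = invmx W *m combi Y v.
    by rewrite -ev -!mulmxA mulKmx.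
  by rewrite mulmxA -B1 submxMl.
have [P BK KB] : exists2 P : 'M_(m, e * d), B *m P = 1%:M & P *m B = 1%:M.
  by exists (pinvmx B); [apply: mulmxVp | apply: mulVpmx].
have spanB k (Q Q' : 'M_(m, k)) : (forall Z, mxvec Z *m B *m Q = mxvec Z *m B *m Q') -> Q = Q'.
  move=> hQ; have eB : B *m Q = B *m Q'.
    apply/row_matrixP=> i; have := hQ (vec_mx (delta_mx 0 i)).
    by rewrite vec_mxK -!mulmxA -!rowE.
  by rewrite -[Q]mul1mx -[Q']mul1mx -KB -!mulmxA eB.
have spanB1 k (Q Q' : 'M_(m, k)) : (forall v, combi Y v *m Q = combi Y v *m Q') -> Q = Q'.
  move=> hQ; apply: spanB => Z; rewrite BE !mulmx_suml; apply: eq_bigr => i _.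
  by rewrite -!mulmxA fE hQ.
exists e, Y; split.
- split=> //; by move: freeB fullB; rewrite /row_free /row_full => /eqP-> /eqP.
- exact: imY.
- by move=> k Q hQ; apply: spanB1 => v; rewrite mulmx0 hQ.
- move=> M; exists (P *m lin_mx (mulmx M^T) *m B) => v.
  apply/row_matrixP=> k; rewrite !rowE mulmxA -B1 -!mulmxA (mulmxA B) BK mul1mx.
  by rewrite (mulmxA (mxvec _)) mul_vec_lin /= mulmxA -trmx_mul B1.
pose i0 := Ordinal e_gt0; pose j0 := Ordinal d_gt0.
exists (P *m lin1_mx (row i0 \o vec_mx)).
  apply/mxhomP=> n Nn; apply: spanB => Z; rewrite mulmxA -BX // -!mulmxA !(mulmxA B) BK !mul1mx mulmxA.
  by rewrite !mul_rV_lin1 /= !mxvecK row_mul.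
apply/eqP=> /(congr1 (fun R => mxvec (delta_mx i0 j0) *m (B *m R))).
rewrite (mulmxA B) BK mul1mx mulmx0 mulmx0 mul_rV_lin1 /= mxvecK => /rowP/(_ j0).
by rewrite !mxE !eqxx => /eqP; rewrite oner_eq0.
Qed.

(** Linear characters of A/N, inflated to A. *)
Definition quo_char (A N : {set gT}) (delta : gT -> F) : Prop :=
  {in A &, {morph delta : a b / (a * b)%g >-> a * b}} /\ {in N, forall n, delta n = 1}.

(** The twist of L by [delta] is isomorphic to its conjugate by [h]; for [delta] = 1, [h] fixes the
    class of L. *)
Definition twist_iso (A : {set gT}) m (L : gT -> 'M[F]_m) (h : gT) (delta : gT -> F) : Prop :=
  exists2 T, T \in unitmx & {in A, forall a, delta a *: (L a *m T) = T *m L (a ^ h)%g}.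

Lemma quo_char_neq0 A N delta : N \subset A -> quo_char A N delta ->
  {in A, forall a, delta a != 0}.
Proof.
move=> sNA [dM dN] a Aa; have := dM a a^-1%g Aa (groupVr Aa).
rewrite mulgV dN // => /eqP; apply: contraTneq => ->.
by rewrite mul0r oner_eq0.
Qed.

Lemma quo_char_exp A N delta : N <| A -> quo_char A N delta ->
  {in A, forall a, delta a ^+ #|A : N| = 1}.
Proof.
move=> /andP[sNA nNA] [dM dN] a Aa; have dX k : delta (a ^+ k)%g = delta a ^+ k.
  elim: k => [|k IHk]; first by rewrite expg0 dN.
  by rewrite expgS dM ?groupX // IHk exprS.
rewrite -dX dN //; apply: coset_idr; first by rewrite groupX ?(subsetP nNA).
rewrite morphX ?(subsetP nNA) //= -card_quotient // expg_cardG //.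
exact: mem_quotient.
Qed.

Lemma irr_twist A N m (L : mx_representation F A m) eta :
    N \subset A -> mx_irreducible L -> quo_char A N eta ->
  exists2 L' : mx_representation F A m, mx_irreducible L' &
    forall a, L' a = eta a *: L a.
Proof.
move=> sNA irrL qeta; have [eM eN] := qeta; have nze := quo_char_neq0 sNA qeta.
have reprL : mx_repr A (fun a => eta a *: L a).
  split=> [|a b Aa Ab]; first by rewrite eN // repr_mx1 scale1r.
  by rewrite eM // repr_mxM // -scalemxAl -scalemxAr scalerA.
exists (MxRepresentation reprL) => //; apply/mx_irrP.
have /mx_irrP[m_gt0 irr] := irrL; split=> // U modU; apply: irr.
apply/mxmoduleP=> a Aa; have := mxmoduleP modU a Aa; rewrite /= -scalemxAr.
by rewrite eqmx_scale // nze.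
Qed.

Lemma irr_conj A m (L : mx_representation F A m) h :
    h \in 'N(A)%g -> mx_irreducible L ->
  exists2 L' : mx_representation F A m, mx_irreducible L' &
    forall a, L' a = L (a ^ h)%g.
Proof.
move=> nAh irrL.
have reprL : mx_repr A (fun a => L (a ^ h)%g).
  split=> [|a b Aa Ab]; first by rewrite conj1g repr_mx1.
  by rewrite conjMg repr_mxM ?memJ_norm.
exists (MxRepresentation reprL) => //; apply/mx_irrP.
have /mx_irrP[m_gt0 irr] := irrL; split=> // U modU; apply: irr.
apply/mxmoduleP=> a Aa; have Aah : (a ^ h^-1)%g \in A by rewrite memJ_norm ?groupV.
by have := mxmoduleP modU _ Aah; rewrite /= conjgKV.
Qed.

(* [A / N] acts on the [N]-morphisms from [L] to [L'] by commuting operators. *)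
Lemma hom_twist A N m m' (L : mx_representation F A m) (L' : mx_representation F A m') g :
    N <| A -> abelian (A / N) -> (0 < m)%N -> mxhom N L L' g -> g != 0 ->
  exists delta (T : 'M_(m, m')), [/\ quo_char A N delta, T != 0 &
    {in A, forall a, delta a *: (L a *m T) = T *m L' a}].
Proof.
move=> nsNA abAN m_gt0 homg nzg; have [sNA nNA] := andP nsNA.
pose O a := lin_mx (mulmx (L a^-1%g)) *m lin_mx (mulmxr (L' a)) : 'M[F]_(m * m').
have OE a f : mxvec f *m O a = mxvec (L a^-1%g *m f *m L' a).
  by rewrite /O mulmxA !mul_vec_lin.
pose V := hom_mx N L L'.
have VO k (W : 'M_(k, m * m')) a : a \in A -> (W <= V)%MS -> (W *m O a <= V)%MS.
  move=> Aa sWV; apply/row_subP=> i; rewrite row_mul.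
  have := submx_trans (row_sub i W) sWV.
  rewrite hom_mxE -[row i W]vec_mxK mxvecK => /mxhomP hf; rewrite OE hom_mxE mxvecK.
  move: (vec_mx _) hf => f hf; apply/mxhomP=> n Nn.
  have Nna : (n ^ a^-1)%g \in N by rewrite memJ_norm ?groupV ?(subsetP nNA).
  have An := subsetP sNA n Nn; have Ana := subsetP sNA _ Nna.
  have e1 : (n * a^-1 = a^-1 * n ^ a^-1)%g by rewrite conjgE invgK !mulgA mulVg mul1g.
  have e2 : (n ^ a^-1 * a = a * n)%g by rewrite conjgE invgK !mulgA mulgKV.
  rewrite !mulmxA -repr_mxM ?groupV // e1 repr_mxM ?groupV //.
  rewrite -(mulmxA _ (L _) f) hf // -!mulmxA; congr (_ *m (_ *m _)).
  by rewrite -!repr_mxM // e2.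
have [| | |v nzv [sv hv]] := common_eigenvector (s := enum A) (T := O) (V := V).
- have : (mxvec g <= V)%MS by rewrite hom_mxE mxvecK.
  by apply: contraTneq => ->; rewrite submx0 mxvec_eq0.
- by move=> a; rewrite mem_enum => Aa; apply: VO.
- move=> a b; rewrite !mem_enum => Aa Ab; apply/row_matrixP=> i; rewrite !row_mul.
  have := row_sub i V; rewrite hom_mxE -[row i V]vec_mxK mxvecK => /mxhomP.
  move: (vec_mx _) => f hf; rewrite !OE; congr mxvec.
  have Nn : (a * b * a^-1 * b^-1)%g \in N.
    have [na nb] := (subsetP nNA a Aa, subsetP nNA b Ab).
    apply: coset_idr; first by rewrite !groupM ?groupV.
    rewrite !morphM ?groupM ?groupV //= !morphV //=.
    by rewrite (centsP abAN _ (mem_quotient N Aa) _ (mem_quotient N Ab)) mulgK mulgV.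
  rewrite !mulmxA -!repr_mxM ?groupV // -!mulmxA -!repr_mxM //.
  set n := (_ * b^-1)%g in Nn; have An := subsetP sNA n Nn.
  have e1 : (a * b = n * (b * a))%g by rewrite /n !mulgA mulgKV mulgKV.
  rewrite -!invMg {}e1; clearbody n; move: (b * a)%g (groupM Ab Aa) => c Ac.
  have [eL eL'] := (repr_mxM L (groupVr Ac) (groupVr An), repr_mxM L' An Ac).
  rewrite invMg eL eL' -!mulmxA; congr (_ *m _); rewrite (mulmxA f) -hf // !mulmxA.
  by rewrite -repr_mxM ?groupV // mulVg repr_mx1 mul1mx.
have ex a : a \in A -> exists c, v *m O a = c *: v.
  move=> Aa.
  by have [|c ec] := hv a; [rewrite mem_enum | exists c].
have [delta hd] := exists_choice ex 0; pose T := vec_mx v : 'M_(m, m').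
have hT : {in A, forall a, delta a *: (L a *m T) = T *m L' a}.
  move=> a Aa; have := hd a Aa; rewrite -[v]vec_mxK -/T OE -linearZ.
  move/(can_inj mxvecK) => eT; rewrite scalemxAr -eT !mulmxA -repr_mxM ?groupV //.
  by rewrite mulgV repr_mx1 mul1mx.
have nzT : T != 0 by rewrite vec_mx_eq0.
have inj a x y : a \in A -> x *: (L a *m T) = y *: (L a *m T) -> x = y.
  move=> Aa /eqP; rewrite -subr_eq0 -scalerBl scaler_eq0 subr_eq0 => /orP[/eqP// | /eqP e0].
  by case/eqP: nzT; apply: (can_inj (mulKmx (repr_mx_unit L Aa))); rewrite e0 mulmx0.
exists delta, T; split=> //; split=> [a b Aa Ab | n Nn].
  apply: (inj (a * b)%g); first exact: groupM.
  rewrite hT ?groupM // (repr_mxM L') // mulmxA -hT // -scalemxAl -mulmxA -hT //.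
  by rewrite -scalemxAr scalerA repr_mxM // mulmxA.
apply: (inj n); first exact: subsetP Nn.
rewrite hT ?(subsetP sNA) // scale1r.
by move: sv; rewrite -[v]vec_mxK hom_mxE mxvecK => /mxhomP/(_ n Nn).
Qed.

Lemma exists_twist_iso A N m (L : mx_representation F A m) h g :
    N <| A -> abelian (A / N) -> mx_irreducible L -> h \in 'N(A)%g ->
    mxhom N L (fun a => L (a ^ h)%g) g -> g != 0 ->
  exists delta, quo_char A N delta /\ twist_iso A L h delta.
Proof.
move=> nsNA abAN irrL nAh homg nzg; have sNA := normal_sub nsNA.
have [Lh irrLh LhE] := irr_conj nAh irrL.
have homg' : mxhom N L Lh g.
  by apply/mxhomP=> n Nn; rewrite LhE; have /mxhomP-> := homg.
have m_gt0 : (0 < m)%N by case/mx_irrP: irrL.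
have [delta [T [qd nzT hT]]] := hom_twist nsNA abAN m_gt0 homg' nzg.
exists delta; split=> //; exists T; last by move=> a Aa; rewrite hT // LhE.
have [L' irrL' L'E] := irr_twist sNA irrL qd; rewrite -row_free_unit.
apply: (mxhom_free irrL' _ nzT (r2 := Lh)).
by apply/mxhomP=> a Aa; rewrite L'E -scalemxAl hT.
Qed.

End HomogeneousCoordinates.

(** * Averaging twists over a coprime group *)

Section Averaging.

Variables (F : closedFieldType) (gT : finGroupType).
Variables (A N : {group gT}) (m : nat) (L : mx_representation F A m).
Hypothesis nsNA : N <| A.
Implicit Types (H Q : {group gT}) (delta eps : gT -> F).

Let sNA : N \subset A := normal_sub nsNA.

Lemma twist_iso_ext h delta eps :
  {in A, delta =1 eps} -> twist_iso A L h delta -> twist_iso A L h eps.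
Proof. by move=> e [T uT hT]; exists T => // a Aa; rewrite -e ?hT. Qed.

Lemma twist_isoM h g delta eps : h \in 'N(A)%g ->
    twist_iso A L h delta -> twist_iso A L g eps ->
  twist_iso A L (h * g)%g (fun a => delta a * eps (a ^ h)%g).
Proof.
move=> nAh [T uT hT] [U uU hU]; exists (T *m U); first by rewrite unitmx_mul uT.
move=> a Aa; have Aah : (a ^ h)%g \in A by rewrite memJ_norm.
rewrite mulrC -scalerA mulmxA scalemxAl hT // -(mulmxA T (L _)) scalemxAr hU //.
by rewrite conjgM mulmxA.
Qed.

Lemma twist_isoV h delta : h \in 'N(A)%g -> {in A, forall a, delta a != 0} ->
    twist_iso A L h delta ->
  twist_iso A L h^-1%g (fun a => (delta (a ^ h^-1)%g)^-1).
Proof.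
move=> nAh nzd [T uT hT]; exists (invmx T); first by rewrite unitmx_inv.
move=> a Aa; have Ab : (a ^ h^-1)%g \in A by rewrite memJ_norm ?groupV.
have /(congr1 (fun M => invmx T *m M *m invmx T)) := hT _ Ab.
rewrite conjgKV mulKmx // -scalemxAr -scalemxAl mulmxA mulmxK // => <-.
by rewrite scalerA mulVf ?nzd // scale1r.
Qed.

Lemma twist_iso_inner n : n \in A -> twist_iso A L n (fun=> 1).
Proof.
move=> An; exists (L n); first exact: repr_mx_unit.
by move=> a Aa; rewrite scale1r; apply: repr_conj.
Qed.

Lemma twist_iso1_prod (I : finType) (P : pred I) (f : I -> gT -> F) :
    (forall i, P i -> twist_iso A L 1%g (f i)) ->
  twist_iso A L 1%g (fun a => \prod_(i | P i) f i a).
Proof.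
move=> hf; suff [T uT hT] : twist_iso A L 1%g (fun a => \prod_(i <- filter P (index_enum I)) f i a).
  by exists T => // a Aa; rewrite -hT // big_filter.
elim: (index_enum I) => [|i s IHs] /=.
  by apply: twist_iso_ext (twist_iso_inner (group1 A)) => a _; rewrite big_nil.
case: ifP => // Pi; have := twist_isoM (group1 _) (hf i Pi) IHs.
by rewrite mulg1; apply: twist_iso_ext => a _; rewrite big_cons conjg1.
Qed.

Lemma twist_iso1_exp delta k : twist_iso A L 1%g delta ->
  twist_iso A L 1%g (fun a => delta a ^+ k).
Proof.
move=> hd; have := twist_iso1_prod (P := predT) (fun (i : 'I_k) _ => hd).
by apply: twist_iso_ext => a _; rewrite prodr_const card_ord.
Qed.

Lemma twist_iso_div h delta eps : h \in 'N(A)%g -> {in A, forall a, eps a != 0} ->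
    twist_iso A L h delta -> twist_iso A L h eps ->
  twist_iso A L 1%g (fun a => delta a / eps a).
Proof.
move=> nAh nze hd he; have := twist_isoM nAh hd (twist_isoV nAh nze he).
by rewrite mulgV; apply: twist_iso_ext => a _; rewrite conjgK.
Qed.

Lemma twist_iso_mulr h n delta : h \in 'N(A)%g -> n \in A ->
  twist_iso A L (h * n)%g delta -> twist_iso A L h delta.
Proof.
move=> nAh An hd; have nAn : n \in 'N(A)%g by rewrite (subsetP (normG A)).
have := twist_isoM (groupM nAh nAn) hd (twist_iso_inner (groupVr An)).
by rewrite mulgK; apply: twist_iso_ext => a _; rewrite mulr1.
Qed.

(** Characters of A/N have order dividing |A:N|, and Euler's theorem inverts n modulo |A:N|. *)
Lemma coprime_power_char (n : nat) : coprime n #|A : N| ->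
  exists k, forall delta, quo_char A N delta -> {in A, forall a, delta a ^+ (n * k) = delta a}.
Proof.
move=> con; exists (n ^ (totient #|A : N|).-1)%N => eps qe a Aa.
have e1 := quo_char_exp nsNA qe Aa.
rewrite -expnS prednK ?totient_gt0 ?indexg_gt0 // -(expr_mod _ e1).
by rewrite Euler_exp_totient // (expr_mod _ e1) expr1.
Qed.

Variable Q : {group gT}.
Hypotheses (nsNQ : N <| Q) (nAQ : Q \subset 'N(A)) (coQA : coprime #|Q : N| #|A : N|).

Let nNQ : Q \subset 'N(N) := normal_norm nsNQ.

Lemma section_mul (r : coset_of N -> gT) g y :
    {in (Q / N)%g, forall x, r x \in Q /\ coset N (r x) = x} -> g \in Q -> y \in (Q / N)%g ->
  ((r (coset N g * y)%g)^-1 * (g * r y))%g \in N.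
Proof.
move=> hr Qg Qy; have [Qr er] := hr y Qy.
have [|Qr' er'] := hr (coset N g * y)%g; first by rewrite groupM ?mem_quotient.
have [[n1 n2] n3] := (subsetP nNQ _ Qg, subsetP nNQ _ Qr, subsetP nNQ _ Qr').
apply: coset_idr; first by rewrite !groupM ?groupV.
by rewrite !morphM ?groupM ?groupV //= !morphV //= er er' mulVg.
Qed.

(** The characters by which Q twists L form a cocycle modulo those fixing L. The product [P] of
    representatives over Q/N makes its |Q:N|-th power a coboundary, and a power [k] inverse to |Q:N|
    recovers the cocycle. So the twist of L by [eta] is Q-invariant. *)
Lemma twist_averaging :
    {in Q, forall h, exists delta, quo_char A N delta /\ twist_iso A L h delta} ->
  exists eta, quo_char A N eta /\ {in Q, forall g, twist_iso A L g (fun a => eta a / eta (a ^ g)%g)}.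
Proof.
move=> twQ; have [r hr] := exists_section nNQ.
have ex (y : coset_of N) : y \in (Q / N)%g -> exists delta,
    quo_char A N delta /\ twist_iso A L (r y) delta.
  move=> Qy.
  by have [Qr _] := hr y Qy; have [delta hd] := twQ _ Qr; exists delta.
have [D hD] := exists_choice ex (fun=> 1).
have DM y : y \in (Q / N)%g -> {in A &, {morph D y : a b / (a * b)%g >-> a * b}}.
  by move=> Qy; have [[]] := hD y Qy.
have DN y : y \in (Q / N)%g -> {in N, forall n, D y n = 1}.
  by move=> Qy; have [[]] := hD y Qy.
have nzD y : y \in (Q / N)%g -> {in A, forall a, D y a != 0}.
  by move=> Qy; have [qd _] := hD y Qy; apply: quo_char_neq0 qd.
pose P a := \prod_(y in (Q / N)%g) D y a.
have PM : {in A &, {morph P : a b / (a * b)%g >-> a * b}}.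
  move=> a b Aa Ab; rewrite /P -big_split /=; apply: eq_bigr => y Qy.
  by rewrite DM.
have nzP : {in A, forall a, P a != 0}.
  by move=> a Aa; apply/prodf_neq0=> y Qy; apply: nzD.
have [k hk] := coprime_power_char coQA.
pose eta a := P a ^+ k.
have qeta : quo_char A N eta.
  split=> [a b Aa Ab | n Nn]; first by rewrite /eta PM // exprMn.
  by rewrite /eta /P big1 ?expr1n // => y Qy; rewrite DN.
exists eta; split=> // g Qg; have nAg := subsetP nAQ g Qg.
have [eps [qe he]] := twQ g Qg; have nze := quo_char_neq0 sNA qe.
have Qgb : coset N g \in (Q / N)%g by apply: mem_quotient.
have hS : twist_iso A L 1%g (fun a => eps a * eta (a ^ g)%g / eta a).
  have hS y : y \in (Q / N)%g ->
      twist_iso A L 1%g (fun a => eps a * D y (a ^ g)%g / D (coset N g * y)%g a).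
    move=> Qy; have Qgy : (coset N g * y)%g \in (Q / N)%g by rewrite groupM.
    have [[Qr' _] [_ hgy]] := (hr _ Qgy, hD _ Qgy); have nAr := subsetP nAQ _ Qr'.
    apply: (twist_iso_div nAr (nzD _ Qgy) _ hgy).
    apply: (twist_iso_mulr nAr (subsetP sNA _ (section_mul hr Qg Qy))).
    by rewrite mulKVg; apply: twist_isoM nAg he (proj2 (hD y Qy)).
  have := twist_iso1_exp k (twist_iso1_prod (P := mem (Q / N)%g) hS).
  apply: twist_iso_ext => a Aa; rewrite !big_split /= prodfV -/(P _).
  have -> : \prod_(y in (Q / N)%g) D (coset N g * y)%g a = P a.
    rewrite /P [RHS](reindex_inj (mulgI (coset N g))) /=; apply: eq_bigl => y.
    by rewrite groupMl.
  by rewrite !exprMn exprVn prodr_const card_quotient // -exprM hk.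
have nz1 : {in A, forall a, eps a * eta (a ^ g)%g / eta a != 0}.
  move=> a Aa; have Aag : (a ^ g)%g \in A by rewrite memJ_norm.
  by rewrite !mulf_neq0 ?invr_eq0 ?expf_neq0 ?nze ?nzP.
have hS' := twist_isoV (group1 _) nz1 hS; rewrite invg1 in hS'.
have := twist_isoM (group1 _) hS' he; rewrite mul1g; apply: twist_iso_ext => a Aa.
have Aag : (a ^ g)%g \in A by rewrite memJ_norm.
rewrite !conjg1; field.
by rewrite ?nze ?expf_neq0 ?nzP.
Qed.

(** If h twists L by [delta], then for x in Q the quotient of delta^x by delta fixes L, because Q is
    normal in H and fixes L. The product [nu] of the conjugates of [delta] over Q/N is Q-fixed,
    hence trivial; so a power of [delta] with exponent |Q:N| fixes L, and then, by coprimality,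
    [delta] does. *)
Lemma twist_averaging_normal H :
    Q <| H -> H \subset 'N(A) ->
    (forall nu : gT -> F, quo_char A N nu -> {in Q & A, forall x a, nu (a ^ x)%g = nu a} ->
       {in A, forall a, nu a = 1}) ->
    {in Q, forall x, twist_iso A L x (fun=> 1)} ->
    {in H, forall h, exists delta, quo_char A N delta /\ twist_iso A L h delta} ->
  {in H, forall h, twist_iso A L h (fun=> 1)}.
Proof.
move=> nsQH nAH fixQ twQ twH h Hh; have [delta [qd hd]] := twH h Hh.
have [dM dN] := qd; have nzd := quo_char_neq0 sNA qd; have nAh := subsetP nAH h Hh.
have key x : x \in Q -> twist_iso A L 1%g (fun a => delta (a ^ x)%g / delta a).
  move=> Qx; have Qx' : (x ^ h)%g \in Q by rewrite memJ_norm ?(subsetP (normal_norm nsQH)).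
  have nAx := subsetP nAQ x Qx.
  have h1 := twist_isoM nAx (twQ x Qx) hd; have h2 := twist_isoM nAh hd (twQ _ Qx').
  rewrite -conjgC in h2.
  have := twist_iso_div (groupM nAx nAh) _ h1 h2.
  have nzd1 : {in A, forall a, delta a * 1 != 0} by move=> a Aa; rewrite mulr1 nzd.
  by move/(_ nzd1); apply: twist_iso_ext => a _; rewrite mul1r mulr1.
have [r hr] := exists_section nNQ.
pose nu a := \prod_(y in (Q / N)%g) delta (a ^ r y)%g.
have AJ x a : x \in Q -> a \in A -> (a ^ x)%g \in A.
  by move=> Qx Aa; rewrite memJ_norm ?(subsetP nAQ).
have NJ x a : x \in Q -> a \in N -> (a ^ x)%g \in N.
  by move=> Qx Aa; rewrite memJ_norm ?(subsetP nNQ).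
have Qr y : y \in (Q / N)%g -> r y \in Q by case/hr.
have deltaJ a n : a \in A -> n \in N -> delta (a ^ n)%g = delta a.
  move=> Aa Nn; have An := subsetP sNA n Nn.
  have An' := groupVr An; rewrite conjgE !dM ?groupM // (dN n) // (dN n^-1%g) ?groupV //.
  by rewrite mulr1 mul1r.
have qnu : quo_char A N nu.
  split=> [a b Aa Ab | n Nn].
    rewrite /nu -big_split /=; apply: eq_bigr => y Qy.
    by rewrite conjMg dM ?AJ ?Qr.
  by rewrite /nu big1 // => y Qy; rewrite dN // NJ ?Qr.
have nu1 : {in A, forall a, nu a = 1}.
  apply: fixQ => // x a Qx Aa; have Qxb : coset N x \in (Q / N)%g by apply: mem_quotient.
  rewrite /nu [RHS](reindex_inj (mulgI (coset N x))) /=.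
  apply: eq_big => [y | y Qy]; first by rewrite groupMl.
  have Qxy : (coset N x * y)%g \in (Q / N)%g by rewrite groupM.
  have [Qry Qr'] := (Qr y Qy, Qr _ Qxy); have Nn := section_mul hr Qx Qy.
  rewrite -conjgM -[(x * r y)%g](mulKVg (r (coset N x * y)%g)) conjgM.
  by rewrite deltaJ ?AJ.
have [k hk] := coprime_power_char coQA.
have hS : twist_iso A L 1%g (fun a => (delta a)^-1).
  have := twist_iso1_exp k (twist_iso1_prod (P := mem (Q / N)%g)
    (f := fun y a => delta (a ^ r y)%g / delta a) (fun y Qy => key _ (Qr y Qy))).
  apply: twist_iso_ext => a Aa; rewrite big_split /= -/(nu a) nu1 // mul1r prodr_const.
  by rewrite card_quotient // !exprVn -exprM hk.
have := twist_isoM (group1 _) hS hd; rewrite mul1g; apply: twist_iso_ext => a Aa.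
by rewrite conjg1 mulVf ?nzd.
Qed.

End Averaging.

(** * Extension to a product AH, and operators on Hom_N(X, L) *)

Section HomOperators.

Variables (F : closedFieldType) (gT : finGroupType).

Lemma irr_cent_scalar (N : {group gT}) d (X : mx_representation F N d) (f : 'M_d) :
  mx_irreducible X -> {in N, forall n, X n *m f = f *m X n} -> is_scalar_mx f.
Proof.
move=> /closed_abs_irr absX cf; apply: (mx_abs_irr_cent_scalar absX).
by apply/centgmxP=> n Nn; rewrite cf.
Qed.

Lemma intertwiner_scalar (N : {group gT}) d (X : mx_representation F N d)
    (U V : 'M[F]_d) (s : gT -> gT) :
    mx_irreducible X -> U \in unitmx -> V \in unitmx ->
    {in N, forall n, X n *m U = U *m X (s n)} -> {in N, forall n, X n *m V = V *m X (s n)} ->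
  exists2 k, k != 0 & V = k *: U.
Proof.
move=> irrX uU uV hU hV; have d_gt0 : (0 < d)%N by case/mx_irrP: irrX.
have /is_scalar_mxP[k ek] : is_scalar_mx (V *m invmx U).
  apply: irr_cent_scalar irrX _ => n Nn; rewrite mulmxA hV // -!mulmxA; congr (_ *m _).
  by apply: (can_inj (mulmxK uU)); rewrite mulmxKV // -mulmxA hU // mulKmx.
have eV : V = k *: U by rewrite -mul_scalar_mx -ek mulmxKV.
exists k => //; apply: contraTneq uV => k0; rewrite eV k0 scale0r.
by apply/negP=> /(unitmx_neq0 d_gt0); rewrite eqxx.
Qed.

(** By Schur each [T h] is unique up to a scalar, and the stable line spanned by [f] fixes that
    scalar through f T'(h) = rH(h) f. So T' is multiplicative and agrees with L where H meets A;
    hence T'(h) L(a) is well defined on the product. *)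
Lemma irr_product_extension (A H G : {group gT}) d m (rH : mx_representation F H d)
    (L : mx_representation F A m) (f : 'M_(d, m)) (T : gT -> 'M_m) :
    H \subset 'N(A) -> (A * H)%g = G ->
    mx_irreducible L -> mxhom (H :&: A) rH L f -> f != 0 ->
    {in H, forall h, T h \in unitmx /\ {in A, forall a, L a *m T h = T h *m L (a ^ h)%g}} ->
    {in H, forall h, exists c, f *m T h = c *: (rH h *m f)} ->
  exists2 rG : mx_representation F G m, mx_irreducible rG & mxhom H rH rG f.
Proof.
move=> nAH defG irrL /mxhomP homf nzf hT hf.
have ex h : exists T', h \in H -> [/\ T' \in unitmx,
    {in A, forall a, L a *m T' = T' *m L (a ^ h)%g} & f *m T' = rH h *m f].
  have [Hh | _] := boolP (h \in H); last by exists 0.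
  have [c ec] := hf h Hh; have [uT eT] := hT h Hh.
  have nzc : c != 0.
    apply: contraNneq nzf => c0; apply/eqP/(can_inj (mulmxK uT)).
    by rewrite ec c0 scale0r mul0mx.
  exists (c^-1 *: T h) => _; split.
  - by rewrite unitmxZ // unitfE invr_eq0.
  - by move=> a Aa; rewrite -scalemxAr eT // -scalemxAl.
  by rewrite -scalemxAr ec scalerA mulVf // scale1r.
have [T' hT'] := fin_all_exists ex.
have uniqT (U V : 'M_m) (s : gT -> gT) : U \in unitmx -> V \in unitmx ->
    {in A, forall a, L a *m U = U *m L (s a)} -> {in A, forall a, L a *m V = V *m L (s a)} ->
    f *m U = f *m V -> V = U.
  move=> uU uV hU hV e; have [k _ ek] := intertwiner_scalar irrL uU uV hU hV.
  have : (k - 1) *: (f *m U) = 0 by rewrite scalerBl scale1r scalemxAr -ek e subrr.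
  move/eqP; rewrite scaler_eq0 subr_eq0 => /orP[/eqP k1 | /eqP e0]; first by rewrite ek k1 scale1r.
  by case/eqP: nzf; apply: (can_inj (mulmxK uU)); rewrite e0 mul0mx.
have TM h g : h \in H -> g \in H -> T' (h * g)%g = T' h *m T' g.
  move=> Hh Hg; have Hhg := groupM Hh Hg.
  have [[uh ch fh] [ug cg fg] [uhg chg fhg]] := And3 (hT' h Hh) (hT' g Hg) (hT' _ Hhg).
  apply: (uniqT _ _ (fun a => a ^ (h * g))%g) => //.
  - by rewrite unitmx_mul uh.
  - move=> a Aa; have Aah := norm_memJ nAH Hh Aa.
    by rewrite mulmxA ch // -(mulmxA _ (L _)) cg // mulmxA conjgM.
  by rewrite mulmxA fh -mulmxA fg mulmxA -repr_mxM.
have TN n : n \in H :&: A -> T' n = L n.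
  case/setIP=> Hn An; have [un cn fn] := hT' n Hn.
  apply: (uniqT _ _ (fun a => a ^ n)%g) => //; first exact: repr_mx_unit.
    by move=> a Aa; apply: repr_conj.
  by rewrite fn -homf // inE Hn.
have exd g : g \in G -> exists ha : gT * gT, [/\ ha.1 \in H, ha.2 \in A & g = (ha.1 * ha.2)%g].
  move=> Gg.
  move: Gg; rewrite -defG -(normC nAH) => /mulsgP[h a Hh Aa ->].
  by exists (h, a).
have [D hD] := exists_choice exd (1, 1)%g.
have [sHG sAG] : H \subset G /\ A \subset G by rewrite -defG mulG_subl mulG_subr.
pose chi g := T' (D g).1 *m L (D g).2.
have chiE h a : h \in H -> a \in A -> chi (h * a)%g = T' h *m L a.
  move=> Hh Aa; have Gha : (h * a)%g \in G by rewrite groupM // ?(subsetP sHG h) ?(subsetP sAG a).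
  have [Hh' Aa' e] := hD _ Gha; rewrite /chi; move: (D _) Hh' Aa' e => [h' a'] /= Hh' Aa' e.
  have en : (h'^-1 * h = a' * a^-1)%g.
    by apply: (mulgI h'); apply: (mulIg a); rewrite mulKVg mulgA mulgKV.
  have Nn : (h'^-1 * h)%g \in H :&: A.
    by rewrite inE groupM ?groupV // en groupM ?groupV.
  have [Hn An] := setIP Nn; have eT := TM _ _ Hh' Hn; rewrite mulKVg (TN _ Nn) in eT.
  by rewrite eT -mulmxA -repr_mxM // en mulgKV.
have chi_mx : mx_repr G chi.
  split; first by rewrite -[1%g]mulg1 chiE ?group1 // TN ?group1 // !repr_mx1 mulmx1.
  move=> g1 g2 Gg1 Gg2; have [Hh1 Aa1 e1] := hD _ Gg1; have [Hh2 Aa2 e2] := hD _ Gg2.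
  rewrite [in RHS]e1 [in RHS]e2 [in LHS]e1 [in LHS]e2.
  move: (D g1) (D g2) Hh1 Aa1 Hh2 Aa2 {e1 e2} => [h1 a1] [h2 a2] /= Hh1 Aa1 Hh2 Aa2.
  have Aa12 := norm_memJ nAH Hh2 Aa1.
  have -> : (h1 * a1 * (h2 * a2) = (h1 * h2) * (a1 ^ h2 * a2))%g.
    by rewrite !mulgA -(mulgA h1 a1) (conjgC a1) !mulgA.
  rewrite !chiE ?(groupM Hh1 Hh2) ?(groupM Aa12 Aa2) // TM // repr_mxM //.
  have [_ c2 _] := hT' h2 Hh2.
  by rewrite !mulmxA -(mulmxA _ (T' h2)) -c2 // !mulmxA.
exists (MxRepresentation chi_mx).
  have /mx_irrP[m_gt0 irr] := irrL; apply/mx_irrP; split=> // U modU; apply: irr.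
  apply/mxmoduleP=> a Aa; have := mxmoduleP modU a (subsetP sAG a Aa).
  by rewrite /= -[a in chi a]mul1g chiE ?group1 // TN ?group1 // repr_mx1 mul1mx.
apply/mxhomP=> h Hh /=; rewrite -[h in chi h]mulg1 chiE ?group1 // repr_mx1 mulmx1.
by have [_ _ ->] := hT' h Hh.
Qed.

Variables (d m e : nat) (Y : 'M[F]_(e, d * m)).
Hypothesis freeY : row_free Y.

(** [M] is the matrix, in the coordinates of [Y], of f |-> U^-1 f T. *)
Definition is_op (M : 'M[F]_e) (U : 'M[F]_d) (T : 'M[F]_m) : Prop :=
  forall v, combi Y (v *m M) = invmx U *m combi Y v *m T.

Lemma combi_inj : injective (combi Y).
Proof. by move=> v w /(can_inj vec_mxK)/(row_free_inj freeY). Qed.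

Lemma combiZ k v : combi Y (k *: v) = k *: combi Y v.
Proof. by rewrite /combi -scalemxAl linearZ. Qed.

Lemma combi_sum (I : finType) (f : I -> 'rV_e) : combi Y (\sum_i f i) = \sum_i combi Y (f i).
Proof. by rewrite /combi mulmx_suml linear_sum. Qed.

Lemma combi0 : combi Y 0 = 0.
Proof. by rewrite /combi mul0mx linear0. Qed.

Lemma exists_op (U : 'M[F]_d) (T : 'M[F]_m) :
    U \in unitmx -> T \in unitmx ->
    (forall v, exists w, combi Y w = invmx U *m combi Y v *m T) ->
  exists2 M : 'M[F]_e, M \in unitmx & is_op M U T.
Proof.
move=> uU uT ex; have [w hw] := fin_all_exists (fun i : 'I_e => ex (delta_mx 0 i)).
pose M := \matrix_(i < e) w i.
have opM : is_op M U T.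
  move=> v; rewrite [v]row_sum_delta mulmx_suml !combi_sum mulmx_sumr mulmx_suml.
  apply: eq_bigr => i _; rewrite -scalemxAl !combiZ -scalemxAr -scalemxAl; congr (_ *: _).
  by rewrite -rowE rowK hw.
exists M => //; rewrite -row_free_unit -kermx_eq0; apply/rowV0P=> v /sub_kermxP vM0.
apply: combi_inj; have := opM v; rewrite vM0 combi0 => /(congr1 (fun f => f *m invmx T)).
rewrite mulmxK // mul0mx => /(congr1 (mulmx U)); rewrite mulKVmx // mulmx0.
by move=> <-.
Qed.

Lemma is_opM M M' U U' T T' : U \in unitmx -> U' \in unitmx ->
  is_op M U T -> is_op M' U' T' -> is_op (M *m M') (U *m U') (T *m T').
Proof.
move=> uU uU' h h' v; rewrite mulmxA h' h !mulmxA.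
suff -> : invmx (U *m U') = invmx U' *m invmx U by [].
have uUU' : U *m U' \in unitmx by rewrite unitmx_mul uU.
apply: (can_inj (mulKmx uUU')); rewrite mulmxV // -mulmxA (mulmxA U') mulmxV //.
by rewrite mul1mx mulmxV.
Qed.

Lemma is_op_scale M M' U T k l : k != 0 -> U \in unitmx ->
  is_op M U T -> is_op M' (k *: U) (l *: T) -> M' = (l / k) *: M.
Proof.
move=> nzk uU h h'; apply/row_matrixP=> i; apply: combi_inj.
have -> : row i ((l / k) *: M) = (l / k) *: (delta_mx 0 i *m M) by rewrite rowE -scalemxAr.
rewrite rowE h' combiZ h invmxZ; last first.
  by rewrite unitmxZ ?unitfE.
by rewrite -!scalemxAl -scalemxAr scalerA mulrC.
Qed.

End HomOperators.

(** * The case of an A-invariant restriction *)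

Section BaseCase.

Variables (F : closedFieldType) (ell : nat) (charF : ell \in [pchar F]).
Variable gT : finGroupType.
Variables (N A H : {group gT}) (p : nat).
Hypotheses (nsNA : N <| A) (nsNH : N <| H) (nAH : H \subset 'N(A)) (tiHA : H :&: A \subset N).
Hypotheses (abAN : abelian (A / N)) (pAN : p.-group (A / N)) (prp : prime p).
Hypothesis nilHN : nilpotent (H / N).
Hypothesis irrA : irreducible_section N A H.
Hypothesis ntAH : ~~ ([~: A, H] \subset N).

Let Q := (H :&: coset N @*^-1 'O_p^'(H / N))%G.

(** By irreducibility [A, Q] N is A or N. If it were N, O_p'(H/N) would centralise A/N. The fixed
    points of the p-group O_p(H/N) on A/N are nontrivial, so they would be all of A/N, and H would
    centralise it. *)
Lemma pcore_pre_facts :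
  [/\ N <| Q, Q <| H, coprime #|Q : N| #|A : N| & A \subset [~: A, Q] <*> N].
Proof.
have [[sNA nNA] [sNH nNH]] := (andP nsNA, andP nsNH).
have sQH : Q \subset H := subsetIl _ _.
have [sNQ QE nQK] := coset_pre_group nsNH (pcore_sub p^' _); have {nQK} nQH := nQK H (normG H) nNH (gFnorm _ _).
have nNQ := subset_trans sQH nNH.
have coQA : coprime #|Q : N| #|A : N|.
  rewrite -!card_quotient // QE coprime_sym; apply: (pnat_coprime pAN).
  exact: pcore_pgroup.
split=> //; try by apply/andP.
have nDH : H \subset 'N([~: A, Q] <*> N) by rewrite normsY // normsR.
have nAQ := subset_trans sQH nAH.
have sDA : [~: A, Q] <*> N \subset A by rewrite join_subG sNA commg_subl nAQ.
have [DN | DA] := irrA (joing_subr [~: A, Q] N) sDA nDH; last by rewrite DA.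
have cAQ : (A / N)%g \subset 'C('O_p^'(H / N)).
  by rewrite -QE quotient_cents2 // (subset_trans (joing_subl _ N)) // DN.
have nANHN : (H / N)%g \subset 'N(A / N) by rewrite quotient_norms.
pose P := 'O_p(H / N)%G; have sPH : P \subset (H / N)%g := pcore_sub _ _.
have ntAN : (A / N)%G :!=: 1%g.
  rewrite -subG1 quotient_sub1 //; apply: contra ntAH => sAN.
  by rewrite (subset_trans _ sAN) // commg_subl.
pose C := 'C_(A / N)(P)%G.
have ntC : C :!=: 1%g := pgroup_cent_neq1 pAN (pcore_pgroup p _) (subset_trans sPH nANHN) ntAN.
have cCH : (H / N)%g \subset 'C(C).
  have <- : ('O_p(H / N) * 'O_p^'(H / N))%g = (H / N)%g := dprodW (nilpotent_pcoreC p nilHN).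
  rewrite mul_subG // centsC ?subsetIr // (subset_trans (subsetIl _ _)) //.
pose D := (A :&: coset N @*^-1 C)%G.
have sCA : C \subset (A / N)%g := subsetIl _ _.
have [sND DE nDK] := coset_pre_group nsNA sCA.
have nDH' : H \subset 'N(D) := nDK H nAH nNH (cents_norm cCH).
case: (irrA sND (subsetIl _ _) nDH') => e0.
  by case/eqP: ntC; rewrite -DE e0 trivg_quotient.
case/negP: ntAH; rewrite -quotient_cents2 // -{1}e0 DE centsC //.
Qed.

(** Every simple L above X is homogeneous over N, so each h in H gives a nonzero N-homomorphism from
    L to its conjugate and only twists L by a character of A/N. Averaging over Q removes the twists
    by Q, and then those by H. *)
Lemma invariant_irr_above d (rH : mx_representation F H d) (sNH : N \subset H) :
    mx_irreducible (subg_repr rH sNH) -> {in A, forall a, conj_iso N rH a} ->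
  exists m (L : mx_representation F A m) (f : 'M_(d, m)),
    [/\ mx_irreducible L, mxhom N rH L f, f != 0 & {in H, forall h, twist_iso A L h (fun=> 1)}].
Proof.
move=> irrX invX; have sNA := normal_sub nsNA.
have [nsNQ nsQH coQA sAD] := pcore_pre_facts.
have sQH := normal_sub nsQH; have nAQ := subset_trans sQH nAH.
have [m [L0 [f [irrL0 homf nzf _]]]] := exists_irr_above sNA irrX.
have tw (L : mx_representation F A m) : mx_irreducible L -> mxhom N rH L f ->
    {in H, forall h, exists delta, quo_char A N delta /\ twist_iso A L h delta}.
  move=> irrL homL h Hh; have nAh := subsetP nAH h Hh.
  have [_ [_ [_ _ _ _ [q homq nzq]]]] := homogeneous_coords nsNA irrX irrL invX homL nzf.
  have hom2 : mxhom N (subg_repr rH sNH) (fun a => L (a ^ h)%g) (rH h *m f).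
    apply/mxhomP=> n Nn /=; have Hn := subsetP sNH n Nn.
    have Nnh : (n ^ h)%g \in N by rewrite memJ_norm ?(subsetP (normal_norm nsNH)).
    have /mxhomP/(_ _ Nnh) e := homL; by rewrite -mulmxA -e !mulmxA -(repr_conj rH).
  have [Lh irrLh LhE] := irr_conj nAh irrL.
  have nz2 : rH h *m f != 0.
    apply: contraNneq nzf => e0; apply/eqP/(can_inj (mulKmx (repr_mx_unit rH Hh))).
    by rewrite e0 mulmx0.
  have [] := mxhom_trans (subxx N) irrX homq nzq (r3 := subg_repr Lh sNA) _ nz2.
    by apply/mxhomP=> n Nn; rewrite /= LhE; have /mxhomP-> := hom2.
  move=> hom3 nz3; apply: (exists_twist_iso nsNA abAN irrL nAh _ nz3).
  by apply/mxhomP=> n Nn; have /mxhomP-> := hom3; rewrite //= LhE.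
have twQ : {in Q, forall h, exists delta, quo_char A N delta /\ twist_iso A L0 h delta}.
  by move=> h Qh; apply: tw => //; apply: subsetP Qh.
have [eta [qeta heta]] := twist_averaging nsNA nsNQ nAQ coQA twQ.
have [L irrL LE] := irr_twist sNA irrL0 qeta.
have nze := quo_char_neq0 sNA qeta.
have homL : mxhom N rH L f.
  apply/mxhomP=> n Nn; have [_ etaN] := qeta.
  by rewrite LE etaN // scale1r; have /mxhomP-> := homf.
exists m, L, f; split=> //.
apply: (twist_averaging_normal nsNA nsNQ nAQ coQA nsQH nAH) => //; last exact: tw.
  move=> nu [nuM nuN] fixnu.
  (* A Q-fixed character of A/N is trivial on [A, Q] and on N, which together generate A. *)
  pose K := [set a in A | nu a == 1].
  have gK : group_set K.
    apply/group_setP; split; first by rewrite inE group1 nuN ?eqxx.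
    move=> a b; rewrite !inE => /andP[Aa /eqP ea] /andP[Ab /eqP eb].
    by rewrite groupM // nuM // ea eb mulr1 eqxx.
  have sAK : A \subset Group gK.
    apply: (subset_trans sAD); rewrite join_subG gen_subG; apply/andP; split.
      apply/subsetP=> _ /imset2P[a x Aa Qx ->]; rewrite inE commgEl.
      have Aax := norm_memJ nAQ Qx Aa.
      rewrite groupM ?groupV // nuM ?groupV // fixnu // -nuM ?groupV //.
      by rewrite mulVg nuN ?eqxx.
    by apply/subsetP=> n Nn; rewrite inE (subsetP sNA) //= nuN ?eqxx.
  by move=> a /(subsetP sAK); rewrite inE => /andP[_ /eqP].
move=> x Qx; have [T uT hT] := heta x Qx; exists T => // a Aa.
have Aax := norm_memJ nAQ Qx Aa.
rewrite !LE -scalemxAr -hT // scale1r -scalemxAl scalerA.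
by rewrite mulrCA divff ?mulr1 // nze.
Qed.

(* The operators f |-> (W a)^-1 f (L a) and f |-> (rH h)^-1 f (T h) on        *)
(* Hom_N(X, L) are projective representations of A and H.                    *)
Lemma exists_stable_hom d m (rH : mx_representation F H d) (sNH : N \subset H)
    (L : mx_representation F A m) (f0 : 'M_(d, m)) (T : gT -> 'M_m) :
    mx_irreducible (subg_repr rH sNH) -> {in A, forall a, conj_iso N rH a} ->
    mx_irreducible L -> mxhom N rH L f0 -> f0 != 0 ->
    {in H, forall h, T h \in unitmx /\ {in A, forall a, L a *m T h = T h *m L (a ^ h)%g}} ->
  exists f : 'M_(d, m),
    [/\ mxhom N rH L f, f != 0, {in H, forall h, exists c, f *m T h = c *: (rH h *m f)}
      & (m %| #|A : N| * d)%N].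
Proof.
move=> irrX invX irrL homf0 nzf0 hT.
set X := subg_repr rH sNH in irrX.
have [[sNA nNA] nNH] := (andP nsNA, normal_norm nsNH).
have [e [Y [[mE e_gt0 freeY] imY spanY opg _]]] := homogeneous_coords nsNA irrX irrL invX homf0 nzf0.
have [d_gt0 m_gt0] : (0 < d)%N /\ (0 < m)%N.
  by split; [case/mx_irrP: irrX | case/mx_irrP: irrL].
have exW a : a \in A -> exists W : 'M[F]_d, W \in unitmx /\ {in N, forall n, X n *m W = W *m X (n ^ a)%g}.
  move=> Aa.
  by have [W uW hW] := invX a Aa; exists W.
have [W hW] := exists_choice exW 0.
have op_stable g (U : 'M_d) (S : 'M_m) : g \in 'N(N)%g -> U \in unitmx ->
    {in N, forall n, X n *m U = U *m X (n ^ g)%g} -> {in N, forall n, L n *m S = S *m L (n ^ g)%g} ->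
    forall v, exists w, combi Y w = invmx U *m combi Y v *m S.
  move=> nNg uU hU hS v.
  suff /imY[w ew] : mxhom N X L (invmx U *m combi Y v *m S) by exists w.
  have homv : mxhom N X L (combi Y v) by apply/imY; exists v.
  apply/mxhomP=> n Nn; have Nn' : (n ^ g^-1)%g \in N by rewrite memJ_norm ?groupV.
  have en : n = ((n ^ g^-1) ^ g)%g by rewrite conjgKV.
  rewrite -[RHS]mulmxA {2}en -hS // !mulmxA.
  have /mxhomP/(_ _ Nn') hv := homv; rewrite -[_ *m combi Y v *m L _]mulmxA -hv mulmxA; congr (_ *m _ *m _).
  have /(congr1 (fun Z => invmx U *m Z *m invmx U)) := hU _ Nn'.
  by rewrite -en mulKmx // mulmxA mulmxK.
have exw a : a \in A -> exists w : 'M[F]_e, w \in unitmx /\ is_op Y w (W a) (L a).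
  move=> Aa.
  have [uW hWa] := hW a Aa.
  have [|w uw ow] := exists_op freeY uW (repr_mx_unit L Aa); last by exists w.
  apply: (op_stable a) => //; first exact: subsetP nNA a Aa.
  by move=> n Nn; apply: repr_conj => //; apply: (subsetP sNA).
have [w hw] := exists_choice exw 0.
have exu h : h \in H -> exists u : 'M[F]_e, u \in unitmx /\ is_op Y u (rH h) (T h).
  move=> Hh.
  have [uT hTh] := hT h Hh.
  have [|u uu ou] := exists_op freeY (repr_mx_unit rH Hh) uT; last by exists u.
  apply: (op_stable h) => //.
  - exact: subsetP nNH h Hh.
  - exact: repr_mx_unit.
  - by move=> n Nn; apply: (repr_conj rH) => //; apply: (subsetP sNH).
  by move=> n Nn; apply/hTh/(subsetP sNA).
have [u hu] := exists_choice exu 0.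
have uL a : a \in A -> L a \in unitmx by move=> Aa; apply: repr_mx_unit.
have uH h : h \in H -> rH h \in unitmx by move=> Hh; apply: repr_mx_unit.
have projw : projective A w.
  split=> [a Aa | a b Aa Ab]; first by case: (hw a Aa).
  have Aab := groupM Aa Ab.
  have [[uWa hWa] [uWb hWb] [uWab hWab]] := And3 (hW a Aa) (hW b Ab) (hW _ Aab).
  have [[_ oa] [_ ob] [_ oab]] := And3 (hw a Aa) (hw b Ab) (hw _ Aab).
  have [||k nzk ek] := intertwiner_scalar irrX uWab (_ : W a *m W b \in unitmx) hWab.
  - by rewrite unitmx_mul uWa.
  - move=> n Nn; have Nna := norm_memJ nNA Aa Nn.
    by rewrite mulmxA hWa // -(mulmxA (W a) (X _)) hWb // mulmxA conjgM.
  exists (1 / k); apply: (is_op_scale freeY nzk uWab oab).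
  rewrite scale1r repr_mxM // -ek; exact: is_opM.
have proju : projective H u.
  split=> [h Hh | h g Hh Hg]; first by case: (hu h Hh).
  have Hhg := groupM Hh Hg.
  have [[uTh hTh] [uTg hTg] [uThg hThg]] := And3 (hT h Hh) (hT g Hg) (hT _ Hhg).
  have [[_ oh] [_ og] [_ ohg]] := And3 (hu h Hh) (hu g Hg) (hu _ Hhg).
  have [||l nzl el] := intertwiner_scalar irrL uThg (_ : T h *m T g \in unitmx) hThg.
  - by rewrite unitmx_mul uTh.
  - move=> a Aa; have Aah := norm_memJ nAH Hh Aa.
    by rewrite mulmxA hTh // -(mulmxA (T h) (L _)) hTg // mulmxA conjgM.
  exists (l / 1); apply: (is_op_scale freeY (oner_neq0 _) (uH _ Hhg) ohg).
  rewrite scale1r repr_mxM // -el; apply: is_opM => //; exact: uH.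
have actu : projective_action A H w u.
  move=> h a Hh Aa; have Aah := norm_memJ nAH Hh Aa.
  have [[uWa hWa] [uWah hWah]] := (hW a Aa, hW _ Aah); have [uTh hTh] := hT h Hh.
  have [[[_ oa] [_ oah]] [_ oh]] := (hw a Aa, hw _ Aah, hu h Hh).
  have uU : rH h *m W (a ^ h)%g \in unitmx by rewrite unitmx_mul uH.
  have hX n : n \in N -> X n *m rH h = rH h *m X (n ^ h)%g.
    by move=> Nn; apply: (repr_conj rH) => //; apply: (subsetP sNH).
  have NJ g n : g \in A \/ g \in H -> n \in N -> (n ^ g)%g \in N.
    case=> Gg Nn; first by rewrite memJ_norm // (subsetP nNA).
    by rewrite memJ_norm // (subsetP nNH).
  have [|||k nzk ek] := intertwiner_scalar (s := fun n => (n ^ (a * h))%g) irrX uU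
    (_ : W a *m rH h \in unitmx).
  - by rewrite unitmx_mul uWa uH.
  - move=> n Nn; rewrite mulmxA hX // -(mulmxA (rH h) (X _)) hWah ?NJ //; last by right.
    by rewrite mulmxA -conjgM -conjgC.
  - move=> n Nn; rewrite mulmxA hWa // -(mulmxA (W a) (X _)) hX ?NJ //; last by left.
    by rewrite mulmxA conjgM.
  exists (1 / k); apply: (is_op_scale freeY nzk uU (is_opM _ _ oh oah)) => //.
    exact: uH.
  rewrite scale1r -ek -hTh //; apply: is_opM => //; exact: uH.
have op1 n : n \in N -> is_op Y 1%:M (X n) (L n).
  move=> Nn v; rewrite mulmx1.
  have /mxhomP/(_ n Nn) hv : mxhom N X L (combi Y v) by apply/imY; exists v.
  by rewrite -mulmxA -hv mulKmx //; apply/uH/(subsetP sNH).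
have uX n : n \in N -> X n \in unitmx by move=> Nn; apply/uH/(subsetP sNH).
have hXN n x : n \in N -> x \in N -> X x *m X n = X n *m X (x ^ n)%g.
  by move=> Nn Nx; apply: repr_conj.
have scalw : {in N, forall n, is_scalar_mx (w n)}.
  move=> n Nn; have An := subsetP sNA n Nn; have [uWn hWn] := hW n An.
  have [k nzk ek] := intertwiner_scalar irrX (uX n Nn) uWn (hXN n ^~ Nn) hWn.
  apply/is_scalar_mxP; exists (1 / k); rewrite -scalemx1.
  have [_ on] := hw n An; rewrite ek in on; rewrite -[L n]scale1r in on.
  exact: (is_op_scale freeY nzk (uX n Nn) (op1 n Nn) on).
have scalu : {in N, forall n, is_scalar_mx (u n)}.
  move=> n Nn; have Hn := subsetP sNH n Nn; have An := subsetP sNA n Nn.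
  have [uTn hTn] := hT n Hn.
  have hLn : {in A, forall a, L a *m L n = L n *m L (a ^ n)%g}.
    by move=> a Aa; apply: repr_conj.
  have [k nzk ek] := intertwiner_scalar irrL (uL n An) uTn hLn hTn.
  apply/is_scalar_mxP; exists (k / 1); rewrite -scalemx1.
  have [_ on] := hu n Hn; rewrite ek -[rH n]scale1r in on.
  exact: (is_op_scale freeY (oner_neq0 _) (uX n Nn) (op1 n Nn) on).
(* By [opg], [f] is induced by an endomorphism [g] of L. If [f] commutes with all [w a], then [g]
   commutes with A and Schur makes it scalar. *)
have centw f : {in A, forall a, f *m w a = w a *m f} -> is_scalar_mx f.
  move=> cf; have [g hg] := opg f.
  have /is_scalar_mxP[k ek] : is_scalar_mx g.
    apply: irr_cent_scalar irrL _ => a Aa; apply/eqP; rewrite -subr_eq0; apply/eqP.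
    apply: spanY => v; have [uWa _] := hW a Aa; have [_ oa] := hw a Aa.
    have eL z : combi Y z *m L a = W a *m combi Y (z *m w a).
      by rewrite oa -!mulmxA mulKVmx.
    by rewrite mulmxBr !mulmxA hg !eL -(mulmxA (W a)) hg -!(mulmxA v) cf // subrr.
  apply/is_scalar_mxP; exists k; apply/row_matrixP=> i; apply: (combi_inj freeY).
  by rewrite !rowE -hg ek !mul_mx_scalar combiZ.
have [de [v nzv hv]] := quotient_stable_line charF nsNA nsNH nAH tiHA abAN pAN prp nilHN irrA ntAH
  e_gt0 projw proju actu scalw scalu centw.
exists (combi Y v); split.
- by apply/imY; exists v.
- by apply: contraNneq nzv => v0; apply/eqP/(combi_inj freeY); rewrite v0 combi0.
- move=> h Hh; have [c ec] := hv h Hh; exists c; have [_ oh] := hu h Hh.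
  have := oh v; rewrite ec combiZ -mulmxA => /(congr1 (mulmx (rH h))).
  by rewrite mulKVmx ?uH // -scalemxAr.
by rewrite mE dvdn_mul.
Qed.

End BaseCase.

Lemma irr_above_invariant (F : closedFieldType) (ell : nat) (gT : finGroupType)
    (N A H G : {group gT}) (p : nat) d (rH : mx_representation F H d) (sNH : N \subset H) :
    ell \in [pchar F] -> N <| A -> N <| H -> H \subset 'N(A) -> H :&: A = N -> (A * H)%g = G ->
    abelian (A / N) -> p.-group (A / N) -> prime p -> nilpotent (H / N) ->
    irreducible_section N A H ->
    ~~ ([~: A, H] \subset N) ->
    mx_irreducible (subg_repr rH sNH) -> {in A, forall a, conj_iso N rH a} ->
  exists m (rG : mx_representation F G m) (f : 'M_(d, m)),
    [/\ mx_irreducible rG, mxhom H rH rG f, f != 0 & (m %| #|A : N| * d)%N].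
Proof.
move=> charF nsNA nsNH nAH tiHA defG abAN pAN prp nilHN irrA ntAH irrX invX.
have [m [L [f0 [irrL homf0 nzf0 twL]]]] :=
  invariant_irr_above nsNA nsNH nAH abAN pAN nilHN irrA ntAH irrX invX.
have ex h : h \in H -> exists T,
    T \in unitmx /\ {in A, forall a, L a *m T = T *m L (a ^ h)%g}.
  move=> Hh.
  by have [T uT hT] := twL h Hh; exists T ; split=> // a Aa; rewrite -hT // scale1r.
have [T hT] := exists_choice ex 0.
have tiHA' : H :&: A \subset N by rewrite tiHA.
have [f [homf nzf hf dm]] := exists_stable_hom charF nsNA nsNH nAH tiHA' abAN pAN prp nilHN
  irrA ntAH irrX invX irrL homf0 nzf0 hT.
rewrite -tiHA in homf.
have [rG irrG homG] := irr_product_extension nAH defG irrL homf nzf hT hf.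
by exists m, rG, f.
Qed.

(** * Reduction to chief factors *)

Section Induction.

Variables (F : closedFieldType) (ell : nat) (charF : ell \in [pchar F]).
Variable gT : finGroupType.
Implicit Types (A B G H K M N : {group gT}).

Definition divisible_cover H G : Prop :=
  forall d (rH : mx_representation F H d), mx_irreducible rH ->
  exists m (rG : mx_representation F G m) (f : 'M_(d, m)),
    [/\ mx_irreducible rG, mxhom H rH rG f, f != 0 & (m %| #|G : H| * d)%N].

Lemma divisible_cover_refl G : divisible_cover G G.
Proof.
move=> d rG irrG; exists d, rG, 1%:M; split=> //.
- by apply/mxhomP=> x _; rewrite mulmx1 mul1mx.
- by apply: (unitmx_neq0 _ (unitmx1 _ _)); case/mx_irrP: irrG.
by rewrite indexgg mul1n.
Qed.

Lemma divisible_cover_trans H K G : H \subset K -> K \subset G ->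
  divisible_cover H K -> divisible_cover K G -> divisible_cover H G.
Proof.
move=> sHK sKG covHK covKG d rH irrH.
have [k [rK [f [irrK homf nzf dk]]]] := covHK d rH irrH.
have [m [rG [g [irrG homg nzg dm]]]] := covKG k rK irrK.
have [homfg nzfg] := mxhom_trans (r3 := subg_repr rG sKG) sHK irrK homf nzf homg nzg.
exists m, rG, (f *m g); split=> //; apply: dvdn_trans dm _.
by rewrite -(Lagrange_index sKG sHK) -mulnA dvdn_mul.
Qed.

Lemma divisible_cover_prime H G : H <| G -> prime #|G : H| -> divisible_cover H G.
Proof. by move=> nsHG prHG d rH; apply: irr_above_prime_index. Qed.

(** The inertia group T of X in G contains H and meets A in N or A. If in N, then T = H, and
    Clifford's formula bounds the dimension below by |G:H| d, which [exists_irr_above] gives as an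
    upper bound. *)
Lemma free_action_cover N A H G d (rH : mx_representation F H d) (sNH : N \subset H) :
    N <| G -> H \subset G -> A \subset G -> H :&: A = N -> (A * H)%g = G -> H \subset 'N(A) ->
    irreducible_section N A H ->
    mx_irreducible rH -> mx_irreducible (subg_repr rH sNH) ->
    {in A, forall a, conj_iso N rH a} \/
  exists m (rG : mx_representation F G m) (f : 'M_(d, m)),
    [/\ mx_irreducible rG, mxhom H rH rG f, f != 0 & (m %| #|G : H| * d)%N].
Proof.
move=> nsNG sHG sAG tiHA defG nAH irrA irrH irrX.
have [m [rG [f [irrG homf nzf le_m]]]] := exists_irr_above sHG irrH.
have homN : mxhom N (subg_repr rH sNH) rG f := mxhom_sub sNH homf.
have [T [sNT sTG TE [w lew dimT]]] : exists T : {group gT}, [/\ N \subset T, T \subset G,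
    {in G, forall g, g \in T <-> conj_iso N (subg_repr rH sNH) g} &
    exists2 w, (d <= w)%N & (#|G : T| * w)%N = m].
  have [sNT TE dimT sfW _] := Clifford_inertia nsNG irrX irrG homN nzf.
  exists (rstabs_group rG (component_mx (subg_repr rG (normal_sub nsNG)) <<f>>%MS)).
  split=> //; first exact: rstabs_sub.
  exists (\rank (component_mx (subg_repr rG (normal_sub nsNG)) <<f>>%MS)) => //.
  have /eqP rf : row_free f := mxhom_free irrX homN nzf (r2 := subg_repr rG (normal_sub nsNG)).
  by rewrite -[X in (X <= _)%N]rf mxrankS.
have conjH h : h \in H -> conj_iso N (subg_repr rH sNH) h.
  move=> Hh; exists (rH h); first exact: repr_mx_unit.
  by move=> n Nn; apply: (repr_conj rH) => //; apply: (subsetP sNH).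
have sHT : H \subset T by apply/subsetP=> h Hh; apply/TE; [apply: (subsetP sHG) | apply: conjH].
have sNA : N \subset A by rewrite -tiHA subsetIr.
have nSH : H \subset 'N((T :&: A)%G) by rewrite normsI // (subset_trans sHT) ?normG.
have sNS : N \subset (T :&: A)%G by rewrite subsetI sNT.
case: (irrA _ sNS (subsetIr _ _) nSH) => eS; last first.
  left=> a Aa; apply/(TE a (subsetP sAG a Aa)).
  by move: Aa; rewrite -{1}eS => /setIP[].
right; exists m, rG, f; split=> //.
have eT : T :=: H.
  apply/eqP; rewrite eqEsubset sHT andbT -(setIidPl sTG) -defG -group_modr //.
  by rewrite mul_subG //= eS -tiHA subsetIl.
rewrite eT in dimT; suff -> : m = (#|G : H| * d)%N by [].
by apply/eqP; rewrite eqn_leq le_m -dimT leq_mul2l lew orbT.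
Qed.

Lemma chief_complement_cover N A H G p :
    N <| G -> A <| G -> H \subset G -> H :&: A = N -> (A * H)%g = G -> A :!=: N ->
    prime p -> p.-abelem (A / N) -> nilpotent (H / N) ->
    irreducible_section N A H ->
    (forall K : {group gT}, N \subset K -> K <| H -> K :!=: H -> divisible_cover K (K <*> A)) ->
  divisible_cover H G.
Proof.
move=> nsNG nsAG sHG tiHA defG neqAN prp abelA nilHN irrA IH.
have [[sNG nNG] [sAG nAG]] := (andP nsNG, andP nsAG).
have sNA : N \subset A by rewrite -tiHA subsetIr.
have sNH : N \subset H by rewrite -tiHA subsetIl.
have nsNA : N <| A := normalS sNA sAG nsNG.
have nsNH : N <| H := normalS sNH sHG nsNG.
have nAH := subset_trans sHG nAG.
have idxGH : #|G : H| = #|A : N|.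
  by rewrite -tiHA setIC indexgI -defG -(normC nAH) indexMg.
(* When H centralises A/N, every subgroup between N and A is H-invariant, so irreducibility makes
   |A:N| prime. *)
have [cAH | ntAH] := boolP ([~: A, H] \subset N).
  have nHA : A \subset 'N(H) by rewrite -commg_subr (subset_trans cAH).
  have nsHG : H <| G by rewrite /normal sHG -defG mul_subG ?normG.
  apply: divisible_cover_prime => //; rewrite idxGH.
  have pNA : N \proper A by rewrite properEneq eq_sym neqAN.
  have [K [sNK sKA prK]] := exists_prime_index_between nsNA pNA.
  have nKH : H \subset 'N(K).
    by rewrite -commg_subl (subset_trans (commSg _ sKA)) // (subset_trans cAH).
  case: (irrA K sNK sKA nKH) => [KN | <- //].
  by move: prK; rewrite KN indexgg.
move=> d rH irrH.
case: (nilpotent_quo_irr_induced sNH nsNH nilHN irrH) => [irrX | ].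
  case: (free_action_cover nsNG sHG sAG tiHA defG nAH irrA irrH irrX) => // invX.
  rewrite idxGH; have [pAN abAN _] := and3P abelA.
  exact: (irr_above_invariant charF nsNA nsNH nAH tiHA defG abAN pAN prp nilHN irrA ntAH irrX invX).
(* Here [rH] is induced from [rK], so a G-module obtained above [rK] by way of KA automatically lies
   above [rH]. *)
case=> K [k [rK [f [[sNK nsKH prHK dE] irrK homf nzf]]]].
have sKH := normal_sub nsKH.
have neqKH : K :!=: H by apply: contraTneq prHK => ->; rewrite indexgg.
have nAK := subset_trans sKH nAH.
have KAE : (K <*> A = K * A)%g by rewrite norm_joinEl.
have tiKA : K :&: A = N.
  apply/eqP; rewrite eqEsubset subsetI sNK sNA !andbT -tiHA.
  by rewrite setSI.
have [m [rKA [g [irrKA homg nzg dm]]]] := IH K sNK nsKH neqKH k rK irrK.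
have sKAG : K <*> A \subset G by rewrite join_subG (subset_trans sKH).
have nsKAG : K <*> A <| G.
  rewrite /normal sKAG -defG mul_subG //; last by rewrite normsY // normal_norm.
  by rewrite (subset_trans (joing_subr K A)) ?normG.
have idxK : #|K <*> A : K| = #|A : N|.
  by rewrite KAE -tiKA setIC indexgI indexMg.
have idxKA : #|G : K <*> A| = #|H : K|.
  have e1 := Lagrange_index sHG sKH.
  have e2 := Lagrange_index sKAG (joing_subl K A).
  apply/eqP; rewrite -(eqn_pmul2r (indexg_gt0 (K <*> A) K)) e2 -e1 idxGH idxK mulnC //.
have prGKA : prime #|G : K <*> A| by rewrite idxKA.
have [m2 [rG [g2 [irrG homg2 nzg2 dm2]]]] := irr_above_prime_index nsKAG prGKA irrKA.
have [homh nzh] := mxhom_trans (r3 := subg_repr rG sKAG) (joing_subl K A) irrKA homg nzg homg2 nzg2.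
have [|h homH nzH] := mxhom_of_induced (rM := subg_repr rG sHG) sKH irrH _ homf nzf homh nzh.
  by rewrite dE.
exists m2, rG, h; split=> //; apply: dvdn_trans dm2 _.
by rewrite idxGH idxKA -dE mulnCA dvdn_mul // -idxK.
Qed.

(** The measure |G| + |G:N| decreases both when G is replaced by a proper subgroup containing N and
    when N is enlarged inside G. *)
Lemma nilpotent_divisible_cover G N H :
    N <| G -> solvable (G / N) -> N \subset H -> H \subset G -> nilpotent (H / N) ->
  divisible_cover H G.
Proof.
have [n] := ubnP (#|G| + #|G : N|)%N; elim: n G N H => // n IHn G N H lt_n.
move=> nsNG solGN sNH sHG nilHN.
have [eHG | neqHG] := eqVneq (H :> {set gT}) G.
  by have -> : H = G by [apply: val_inj]; apply: divisible_cover_refl.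
have [sNG nNG] := andP nsNG.
pose gP (A : {group gT}) := [&& A <| G, N \subset A & (A * H)%g == G].
have gPG : gP G by rewrite /gP normal_refl sNG mulGSid ?eqxx.
have [A /mingroupP[/and3P[nsAG sNA /eqP defG] minA] _] := mingroup_exists gPG.
have [sAG nAG] := andP nsAG.
have neqAN : A :!=: N.
  by apply: contraNneq neqHG => eA; rewrite -defG eA mulSGid.
pose gB (B : {group gT}) := [&& B \proper A & G \subset 'N(B)].
have gBN : gB N by rewrite /gB properEneq eq_sym neqAN sNA nNG.
have [B maxB sNB] := maxgroup_exists gBN.
have /andP[pBA nBG] := maxgroupp maxB; have sBA := proper_sub pBA.
have nsBG : B <| G by rewrite /normal (subset_trans sBA).
have chiefA : chief_factor G B A by rewrite /chief_factor nsAG andbT.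
have solGB : solvable (G / B).
  by rewrite -(isog_sol (third_isog sNB nsNG nsBG)) quotient_sol.
have [_ _ /is_abelemP[p prp abelA]] :=
  minnormal_solvable (chief_factor_minnormal chiefA) (subxx _) (solvableS (quotientS _ sAG) solGB).
have abAB : abelian (A / B) := abelem_abelian abelA.
(* As A/B is abelian, A normalises D; with H this makes D normal in G = AH, so the chief factor is
   irreducible under H already. *)
have normD (D : {group gT}) : B \subset D -> D \subset A -> H \subset 'N(D) -> D :=: B \/ D :=: A.
  move=> sBD sDA nDH; have nDA : A \subset 'N(D).
    apply: sub_der1_norm sDA; apply: subset_trans sBD.
    by apply: der1_min => //; apply: subset_trans nBG.
  have nDG : G \subset 'N(D) by rewrite -defG mul_subG.
  have [-> | neDA] := eqVneq (D :> {set gT}) A; first by right.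
  left; have /maxgroupP[_ mB] := maxB; apply: mB => //.
  by rewrite /gB properEneq neDA sDA.
have nBH := subset_trans sHG nBG.
pose M := (H <*> B)%G; have ME : M :=: (H * B)%g by rewrite /M /= norm_joinEl.
have sHM : H \subset M := joing_subl H B; have sBM : B \subset M := joing_subr H B.
have sMG : M \subset G by rewrite join_subG sHG (subset_trans sBA).
(* If HB = G, then B would contradict the minimality of A among normal subgroups supplementing H. *)
have neqMG : M :!=: G.
  apply: contraTneq pBA => eM; rewrite (minA B) ?properxx //.
  by rewrite /gP nsBG sNB -(normC nBH) -ME eM /=.
have tiMA : M :&: A = B.
  have sBMA : B \subset (M :&: A)%G by rewrite subsetI sBM.
  have nMAH : H \subset 'N((M :&: A)%G).
    by rewrite normsI //; [apply: subset_trans sHM (normG M) | apply: subset_trans sHG nAG].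
  case: (normD _ sBMA (subsetIr _ _) nMAH) => // eA.
  case/eqP: neqMG; apply/eqP; rewrite eqEsubset sMG -defG mul_subG //.
  by rewrite -eA subsetIl.
have ltI (K : {group gT}) : N \subset K -> K \subset G -> K :!=: G -> (#|K| + #|K : N| < n)%N.
  move=> sNK sKG neqKG; rewrite -ltnS; apply: leq_trans lt_n; rewrite ltnS -addSn leq_add //.
    by rewrite proper_card // properEneq neqKG.
  by rewrite dvdn_leq ?indexg_gt0 // indexSg.
(* If B <> N, pass from H to M = HB inside the proper subgroup M, then from M to G with B in the
   place of N, M/B being a quotient of H/N. *)
have [eBN | neqBN] := eqVneq (B :> {set gT}) N; last first.
  have nsNM : N <| M := normalS (subset_trans sNH sHM) sMG nsNG.
  apply: (divisible_cover_trans sHM sMG).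
    apply: (IHn M N H) => //; first by apply: ltI => //; apply: subset_trans sHM.
    exact: solvableS (quotientS _ sMG) solGN.
  apply: (IHn G B M) => //.
    rewrite -ltnS; apply: leq_trans lt_n; rewrite ltnS -addnS leq_add2l.
    rewrite -(Lagrange_index (normal_sub nsBG) sNB) ltn_Pmulr ?indexg_gt0 //.
    by rewrite indexg_gt1; apply: contra neqBN => sBN; rewrite eqEsubset sBN.
  have -> : (M / B)%g = (H / B)%g by rewrite ME quotientMidr.
  have /homgP[f <-] := homg_quotientS (subset_trans sHG nNG) nBH sNB.
  exact: morphim_nil.
have eMH : M :=: H by rewrite ME eBN mulGSid.
rewrite eMH eBN in tiMA; rewrite eBN in abelA.
apply: (chief_complement_cover nsNG nsAG sHG tiMA defG neqAN prp abelA nilHN).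
  by move=> D sND; move: (normD D); rewrite eBN; apply.
move=> K sNK nsKH neqKH; have sKH := normal_sub nsKH.
have sKAG : K <*> A \subset G by rewrite join_subG (subset_trans sKH).
have sNKA : N \subset K <*> A := subset_trans sNK (joing_subl _ _).
apply: (IHn (K <*> A)%G N K) => //.
- apply: ltI => //; apply: contra neqKH => /eqP /= eKA.
  have eH : (K * (A :&: H))%g = H.
    by rewrite group_modl // -norm_joinEl ?(subset_trans sKH (subset_trans sHG nAG)) // eKA (setIidPr sHG).
  by rewrite -eH setIC tiMA mulGSid.
- exact: normalS sNKA sKAG nsNG.
- exact: solvableS (quotientS _ sKAG) solGN.
- exact: joing_subl.
exact: nilpotentS (quotientS _ sKH) nilHN.
Qed.

End Induction.

(** * Brauer characters *)

Lemma char_poly_lblock (R : comNzRingType) m n (A : 'M[R]_m) (Z : 'M_(n, m)) (D : 'M_n) :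
  char_poly (block_mx A 0 Z D) = char_poly A * char_poly D.
Proof.
rewrite /char_poly /char_poly_mx map_block_mx /= map_mx0.
by rewrite scalar_mx_block opp_block_mx add_block_mx subr0 det_lblock.
Qed.

Lemma char_poly_similar (F : fieldType) a n (P : 'M[F]_(a, n)) (A : 'M_n) (B : 'M_a) :
  a = n -> row_free P -> P *m A = B *m P -> char_poly A = char_poly B.
Proof.
move=> e; case: n / e in P A *; rewrite row_free_unit => uP ePA.
have -> : B = P *m A *m invmx P by rewrite ePA mulmxK.
by rewrite char_poly_conj // mulmxV.
Qed.

Lemma eigenvalues_cat (F : closedFieldType) n n1 n2 (A : 'M[F]_n) (A1 : 'M_n1) (A2 : 'M_n2) :
  char_poly A = char_poly A1 * char_poly A2 ->
  perm_eq (eigenvalues A) (eigenvalues A1 ++ eigenvalues A2).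
Proof. by move=> e; apply: prod_XsubC_eq; rewrite big_cat /= -!eigenvaluesP. Qed.

Section Decomposition.

Variables (F : closedFieldType) (lift : F -> algC) (ell : nat).
Variables (gT : finGroupType) (G : {group gT}).
Local Notation brauer := (brauer lift ell).

(** In the basis [col_mx S V] adapted to the submodule the matrices are block triangular, so
    characteristic polynomials multiply and lists of eigenvalues concatenate. *)
Lemma brauer_extension n n1 (r : mx_representation F G n) (r1 : mx_representation F G n1)
    (S : 'M_(n1, n)) :
    row_free S -> mxhom G r1 r S ->
  exists n2 (r2 : mx_representation F G n2),
    (n1 + n2)%N = n /\ brauer r = brauer r1 + brauer r2.
Proof.
move=> freeS homS; have modS := mxhom_image_module homS.
have modU : mxmodule r <<S>>%MS by rewrite (eqmx_module _ (genmxE S)).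
pose r2 := factmod_repr modU; pose V := val_factmod (1%:M : 'M_(\rank (cokermx <<S>>%MS))).
have rS : \rank <<S>>%MS = n1 by rewrite genmxE; apply/eqP.
have dimE : (n1 + \rank (cokermx <<S>>%MS))%N = n.
  by rewrite mxrank_coker rS subnKC // -rS rank_leq_row.
exists _, r2; split=> //.
have freeP : row_free (col_mx S V).
  rewrite -kermx_eq0; apply/rowV0P=> z /sub_kermxP; rewrite -[z]hsubmxK mul_row_col => e0.
  have y0 : rsubmx z = 0.
    have := congr1 (in_factmod <<S>>%MS) e0; rewrite linearD /= linear0.
    have /eqP -> : in_factmod <<S>>%MS (lsubmx z *m S) == 0.
      by rewrite in_factmod_eq0 genmxE submxMl.
    by rewrite add0r in_factmodE -mulmxA -in_factmodE val_factmodK mulmx1.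
  rewrite y0 mul0mx addr0 in e0; rewrite y0.
  suff -> : lsubmx z = 0 by rewrite row_mx0.
  by apply: (row_free_inj freeS); rewrite e0 mul0mx.
have cpE x : x \in G -> char_poly (r x) = char_poly (r1 x) * char_poly (r2 x).
  move=> Gx; have sD : (V *m r x - r2 x *m V <= S)%MS.
    rewrite -(genmxE S) -in_factmod_eq0 linearB /= in_factmodJ // val_factmodK mul1mx.
    by rewrite in_factmodE -mulmxA -in_factmodE val_factmodK mulmx1 subrr.
  case/submxP: sD => Z eZ; rewrite -(char_poly_lblock (r1 x) Z (r2 x)).
  apply: (char_poly_similar dimE freeP); rewrite mul_col_mx mul_block_col mul0mx addr0.
  have /mxhomP/(_ x Gx) -> := homS.
  by rewrite -eZ subrK.
apply/cfunP=> x; rewrite !cfunE /=.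
have [Gx | _] := boolP (x \in G); last by rewrite /= !mulr0n addr0.
by rewrite -mulrnDl (perm_big _ (eigenvalues_cat (cpE x Gx))) big_cat.
Qed.

Lemma brauer_decomposition n (r : mx_representation F G n) :
  exists s : seq 'CF(G), (forall phi, phi \in s -> IBr lift ell phi) /\ brauer r = \sum_(phi <- s) phi.
Proof.
have [k] := ubnP n; elim: k n r => // k IHk n r lt_n.
have [n0 | n_gt0] := posnP n.
  exists [::]; split=> //; rewrite big_nil; apply/cfunP=> x; rewrite !cfunE /=.
  have /size0nil -> : size (eigenvalues (r x)) = 0%N.
    have /(congr1 (fun p : {poly F} => size p)) := eigenvaluesP (r x).
    by rewrite size_char_poly size_prod_XsubC => -[<-].
  by rewrite big_nil mul0rn.
have [|W simW _] := dec_mxsimple_exists (mxmodule1 r).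
  by rewrite -mxrank_eq0 mxrank1 -lt0n.
have modW := mxsimple_module simW.
have irrW : mx_irreducible (submod_repr modW) by apply/submod_mx_irr.
have freeS : row_free (val_submod (1%:M : 'M_(\rank W))).
  by rewrite /row_free val_submod1; apply/eqP.
have [n2 [r2 [e ->]]] := brauer_extension freeS (mxhom_submod modW).
have [|s [hs ->]] := IHk n2 r2.
  have rW : (0 < \rank W)%N by rewrite lt0n mxrank_eq0; case/mxsimpleP: simW.
  by apply: leq_trans (_ : n2 < n)%N _; rewrite // -[X in (_ < X)%N]e -addn1 addnC leq_add2r.
exists (brauer (submod_repr modW) :: s); split; last by rewrite big_cons.
by move=> phi; rewrite inE => /predU1P[-> | /hs //]; exists (\rank W), (submod_repr modW).
Qed.

Lemma constituent_of_sum (theta : 'CF(G)) (s : seq 'CF(G)) :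
    IBr lift ell theta -> (forall phi, phi \in s -> IBr lift ell phi) ->
  IBr_constituent lift ell theta (theta + \sum_(phi <- s) phi).
Proof.
move=> irrt hs; exists (undup (theta :: s)), (fun phi => count_mem phi (theta :: s)); split.
- exact: undup_uniq.
- by move=> phi; rewrite mem_undup inE => /predU1P[-> | /hs].
- transitivity (\sum_(phi <- theta :: s) phi); first by rewrite big_cons.
  rewrite -big_undup_iterop_count; apply: eq_bigr => phi _.
  by rewrite Monoid.iteropE; elim: (count_mem _ _) => //= k ->; rewrite mulrS.
- by rewrite mem_undup inE eqxx.
by rewrite /= eqxx.
Qed.

Lemma brauer1 n (r : mx_representation F G n) : lift 1 = 1 -> brauer r 1%g = n%:R.
Proof.
move=> lift1; rewrite cfunE group1 /p_elt order1 /= mulr1n repr_mx1.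
have : perm_eq (eigenvalues (1%:M : 'M[F]_n)) (nseq n 1).
  apply: prod_XsubC_eq; rewrite -eigenvaluesP big_nseq -Monoid.iteropE /=.
  by rewrite /char_poly /char_poly_mx map_scalar_mx /= -raddfB det_scalar.
move=> h; rewrite (perm_big _ h) big_nseq.
by elim: (n) => //= k ->; rewrite lift1 -natr1 addrC.
Qed.

End Decomposition.

Lemma brauer_Res (F : closedFieldType) (lift : F -> algC) ell (gT : finGroupType)
    (G H : {group gT}) n (r : mx_representation F G n) (sHG : H \subset G) :
  'Res[H] (brauer lift ell r) = brauer lift ell (subg_repr r sHG).
Proof.
apply/cfun_inP=> x Hx; rewrite cfResE // !cfunE Hx (subsetP sHG) //.
Qed.

Theorem theorem1p1 (ell : nat) (ell_prime : prime ell)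
    (F : closedFieldType) (charF : ell \in [pchar F])
    (lift : F -> algC) (liftP : unity_lift lift)
    (gT : finGroupType) (G N H : {group gT})
    (nNG : N <| G) (solGN : solvable (G / N))
    (sNH : N \subset H) (sHG : H \subset G) (nilHN : nilpotent (H / N))
    (theta : 'CF(H)) (IBr_theta : IBr lift ell theta) :
  exists chi : 'CF(G),
    [/\ IBr lift ell chi,
        IBr_constituent lift ell theta ('Res[H] chi)
      & (chi 1%g %| #|G : H|%:R * theta 1%g)%C].
Proof.
have [lift1 _ _] := liftP.
case: (IBr_theta) => d [rH [irrH thetaE]].
have [m [rG [f [irrG homf nzf dm]]]] := nilpotent_divisible_cover charF nNG solGN sNH sHG nilHN irrH.
exists (brauer lift ell rG); split; first by exists m, rG.
  rewrite (brauer_Res _ _ _ sHG).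
  (* [f] embeds the module of [theta] in the restriction, so [theta] splits off from its Brauer
     character; the quotient module contributes the remaining sum of irreducibles. *)
  have freef := mxhom_free (r2 := subg_repr rG sHG) irrH homf nzf.
  have [n2 [r2 [_ ->]]] := brauer_extension lift ell (r := subg_repr rG sHG) freef homf.
  have [s [hs ->]] := brauer_decomposition lift ell r2.
  by rewrite -thetaE; apply: constituent_of_sum.
by rewrite thetaE !brauer1 // -natrM dvdC_nat.
Qed.
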